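(* Let $\delta\in[\delta_{\min},\delta_{\max}]$, let $f\in V'$ be independent of $\delta$, let $u=u(\delta)\in V$ solve $a(u,v;\delta)=\langle f,v\rangle$ for all $v\in V$, and let $\widetilde u_N=\widetilde u_N(\delta)\in V_N$ solve $\widetilde a_K(\widetilde u_N,v;\delta)=\langle f,v\rangle$ for all $v\in V_N$, where $V_N\subset V$ is the span of finitely many solutions $u(\delta^{(i)})$, $\delta^{(i)}\in[\delta_{\min},\delta_{\max}]$, $i=1,\dots,N$, of the first problem. Let $r(v;\delta)=\widetilde a_K(\widetilde u_N,v;\delta)-\langle f,v\rangle$, $v\in V$. Assume (H1), (H2), (H3), and in Case 2 below assume additionally that $\gamma$ is radial, $\gamma(x,x')=\hat\gamma(|x-x'|)$, that $\hat\gamma$ is Lipschitz continuous on $[\delta_{\min},\delta_{\max}]$ with constant $L_\gamma$, and that $u(\delta')\in H^1_0(\Omega)$ for all $\delta'\in[\delta_{\min},\delta_{\max}]$. Then $$\|\widetilde u_N-u\|_V\le\frac{\|r\|_{V'}}{\alpha_a}+\frac{C_P}{\alpha_a}\begin{cases}C_a\,\Delta\delta\,\|\widetilde u_N\|_{L^2(\Omega)}&\text{in Case 1},\\ L_{a'}(\Delta\delta)^2\,\|\widetilde u_N\|_{H^1_0(\Omega)}&\text{in Case 2}.\end{cases}$$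
   Context: $\Omega\subset\mathbb{R}^n$ is a bounded domain with Lipschitz boundary and $0<\delta_{\min}<\delta_{\max}<\infty$. $\gamma:\mathbb{R}^n\times\mathbb{R}^n\to[0,\infty)$ is a (measurable) symmetric kernel; for $\delta\in[\delta_{\min},\delta_{\max}]$ the truncated kernel is $\gamma(x,x';\delta)=\gamma(x,x')$ if $|x-x'|\le\delta$ and $0$ otherwise. (H1): $\gamma(x,x';\delta)\ge0$, it vanishes for $|x-x'|>\delta$, and there is $\gamma_0>0$ with $\gamma(x,x';\delta)\ge\gamma_0$ whenever $|x-x'|\le\delta_{\min}/2$. (H2): there is $\hat\gamma:\mathbb{R}^+\to\mathbb{R}^+$ with $\gamma(x,x';\delta)\le\hat\gamma(|x-x'|)$ and $\xi^{n-1}\hat\gamma(\xi)\in L^1((\delta_{\min},\delta_{\max}))$. (H3): there is $C_\gamma>0$ with $\xi^{n-1}\hat\gamma(\xi)\le C_\gamma$ for $\xi\in(\delta_{\min},\delta_{\max})$. $\omega_{n-1}=2\pi^{n/2}/\Gamma(n/2)$. Functions on $\Omega$ are extended by zero to $\mathbb{R}^n$. Let $S_\delta=\{(x,x')\in\mathbb{R}^{2n}:|x-x'|\le\delta\}$, $$a(u,v;\delta)=\int_{S_\delta}(u(x)-u(x'))(v(x)-v(x'))\gamma(x,x')\,d(x',x),\qquad \|u\|_{V_\delta}^2=a(u,u;\delta),$$ and $V_\delta=\{v\in L^2(\mathbb{R}^n): v=0 \text{ a.e. outside }\Omega,\ \|v\|_{V_\delta}<\infty\}$. For a fixed $\delta^\star\in[\delta_{\min},\delta_{\max}]$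 put $V=V_{\delta^\star}$, $\|\cdot\|_V=\|\cdot\|_{V_{\delta^\star}}$ (all $V_\delta$ coincide as sets with equivalent norms); $V'$ is its dual and $\langle\cdot,\cdot\rangle$ the duality pairing. Standing assumption (Poincaré): $\|v\|_{L^2(\Omega)}\le C_P\|v\|_{V_\delta}$ for all $v\in V_\delta$, with $C_P>0$ independent of $\delta\in[\delta_{\min},\delta_{\max}]$; $C_P$ is also taken to satisfy $\|v\|_{L^2(\Omega)}\le C_P\|v\|_{H^1_0(\Omega)}=C_P\|\nabla v\|_{L^2(\Omega)}$ on $H^1_0(\Omega)$. Affine approximation: given a partition $\delta_{\min}=\delta_0<\delta_1<\dots<\delta_K=\delta_{\max}$, $\Delta\delta=\max_k(\delta_k-\delta_{k-1})$, set $\widetilde a_K(u,v;\delta)=\sum_{k=0}^K\Theta_k^\delta(\delta)a(u,v;\delta_k)$. Case 1 (piecewise constant): with $\alpha_k(\delta)=\int_{\delta_k}^\delta\rho^{n-1}\hat\gamma(\rho)d\rho$, $\beta_k(\delta)=\int_\delta^{\delta_k}\rho^{n-1}\hat\gamma(\rho)d\rho$, let $\Theta_k^\delta(\delta)=1$ if $\delta\in(\delta_{k-1},\delta_k]$ and $\alpha_{k-1}(\delta)>\beta_k(\delta)$, or if $\delta\in(\delta_k,\delta_{k+1}]$ and $\alpha_k(\delta)\le\beta_{k+1}(\delta)$; and $\Theta_k^\delta(\delta)=0$ otherwise. Case 2 (piecewise linear): $\Theta_k^\delta(\delta)=\frac{\delta-\delta_{k-1}}{\delta_k-\delta_{k-1}}$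 on $(\delta_{k-1},\delta_k]$, $\frac{\delta_{k+1}-\delta}{\delta_{k+1}-\delta_k}$ on $(\delta_k,\delta_{k+1}]$, $0$ otherwise. In both cases $\Theta_0^\delta(\delta_0)=1$ and $\Theta_k^\delta(\delta_0)=0$ for $k\geq 1$; conditions involving $\delta_{-1}$ or $\delta_{K+1}$ are void. Constants: $\alpha_a=1/(1+4C_P^2C_\gamma^1)$ with $C_\gamma^1=\omega_{n-1}\int_{\delta_{\min}}^{\delta_{\max}}\xi^{n-1}\hat\gamma(\xi)d\xi$ (so that $a(v,v;\delta)\ge\alpha_a\|v\|_V^2$); $C_a=4\omega_{n-1}C_\gamma$; and $L_{a'}=\sup_{\delta_{\min}\le t_1<t_2\le\delta_{\max}}2\omega_{n-1}t_2^{n-1}\big(2C_P((n-1)t_2^{-1}\hat\gamma(t_1)+L_\gamma)+\hat\gamma(t_2)\big)$. *)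

(* Defs.v *)
From HB Require Import structures.
From mathcomp Require Import all_boot all_order all_algebra.
From mathcomp Require Import all_classical all_reals all_analysis.

Set Implicit Arguments.
Unset Strict Implicit.
Unset Printing Implicit Defensive.
Import Order.TTheory GRing.Theory Num.Theory.
Import numFieldNormedType.Exports.

Local Open Scope classical_set_scope.
Local Open Scope ring_scope.

(* The coordinate sigma-algebra on 'rV[R]_n, that is, the Borel sets of R^n. *)
Definition rV_display : measure_display. Proof. exact. Qed.

Section measurable_rV.
Context (R : realType) (n : nat).

Definition rV_coord (i : 'I_n) (x : 'rV[R]_n) : measurableTypeR R := x ord0 i.

Let rV_set0 : g_sigma_preimage rV_coord set0.
Proof. exact: sigma_algebra0. Qed.

Let rV_setC A : g_sigma_preimage rV_coord A -> g_sigma_preimage rV_coord (~` A).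
Proof. exact: sigma_algebraC. Qed.

Let rV_bigcup (F : (set 'rV[R]_n)^nat) :
  (forall i, g_sigma_preimage rV_coord (F i)) ->
  g_sigma_preimage rV_coord (\bigcup_i (F i)).
Proof. exact: sigma_algebra_bigcup. Qed.

HB.instance Definition _ := @isMeasurable.Build rV_display 'rV[R]_n
  (g_sigma_preimage rV_coord) rV_set0 rV_setC rV_bigcup.

Lemma measurable_rV_coord (i : 'I_n) :
  measurable_fun [set: 'rV[R]_n] (rV_coord i).
Proof.
move=> _ B mB; rewrite setTI; apply: sub_sigma_algebra.
by rewrite -bigcup_seq/=; exists i; [rewrite /= mem_index_enum|exists B; rewrite ?setTI].
Qed.

Lemma measurable_fun_rVP d (T : measurableType d) (f : T -> 'rV[R]_n) :
  (forall i, measurable_fun [set: T] (rV_coord i \o f)) ->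
  measurable_fun [set: T] f.
Proof.
move=> mf; refine (@measurability _ _ T 'rV[R]_n setT f
  (\big[setU/set0]_(i < n) preimage_set_system setT (@rV_coord i) measurable) erefl _).
move=> _ [B + <-].
rewrite -bigcup_seq => -[i/= _ [A mA <-]].
by rewrite !setTI -comp_preimage -[X in measurable X]setTI; exact: mf.
Qed.

End measurable_rV.

Section rV_cons.
Context (R : realType) (n : nat).

Definition rV_cons (p : measurableTypeR R * 'rV[R]_n) : 'rV[R]_n.+1 :=
  row_mx (p.1%:M : 'rV[R]_1) p.2.

Definition rV_uncons (x : 'rV[R]_n.+1) : measurableTypeR R * 'rV[R]_n :=
  (rV_coord ord0 x, rsubmx (x : 'rV[R]_(1 + n))).

Lemma rV_consK : cancel rV_cons rV_uncons.
Proof.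
move=> [a x]; congr (_, _); last by rewrite /= row_mxKr.
rewrite /rV_coord /rV_cons /= mxE; case: splitP => // j _.
by rewrite mxE [j]ord1 mulr1n.
Qed.

Lemma measurable_rV_cons : measurable_fun setT rV_cons.
Proof.
apply: measurable_fun_rVP => i; case: (@splitP 1 n i) => j ij.
- rewrite (_ : _ \o _ = fst)//; apply/funext => -[a x] /=.
  rewrite /rV_coord /rV_cons mxE; case: splitP => k ik.
    by rewrite mxE [k]ord1 [X in X == _]ord1 mulr1n.
  by have := ltn_ord j; rewrite -ij ik.
- rewrite (_ : _ \o _ = rV_coord j \o snd); last first.
    apply/funext => -[a x] /=.
    rewrite /rV_coord /rV_cons mxE; case: splitP => k ik.
      by have := ltn_ord k; rewrite -ik ij.
    by congr (x _ _); apply/val_inj/eqP; rewrite -(eqn_add2l 1) -ij ik.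
  by apply: measurableT_comp => //; exact: measurable_rV_coord.
Qed.

Lemma measurable_rV_uncons : measurable_fun setT rV_uncons.
Proof.
apply/measurable_fun_pair; first exact: measurable_rV_coord.
apply: measurable_fun_rVP => i.
rewrite (_ : _ \o _ = rV_coord (rshift 1 i)); first exact: measurable_rV_coord.
by apply/funext => x /=; rewrite /rV_coord mxE.
Qed.

Variable m : {sigma_finite_measure set 'rV[R]_n -> \bar R}.

Definition lebesgue_cons : set 'rV[R]_n.+1 -> \bar R :=
  pushforward (lebesgue_measure \x m)%E rV_cons.

Let lebesgue_cons0 : lebesgue_cons set0 = 0%E.
Proof. by rewrite /lebesgue_cons /pushforward preimage_set0 measure0. Qed.

Let lebesgue_cons_ge0 A : (0 <= lebesgue_cons A)%E.
Proof. by rewrite /lebesgue_cons /pushforward measure_ge0. Qed.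

Let lebesgue_cons_sigma_additive : semi_sigma_additive lebesgue_cons.
Proof.
move=> F mF tF mUF; rewrite /lebesgue_cons /pushforward preimage_bigcup.
apply: measure_semi_sigma_additive.
- by move=> i; rewrite -[X in measurable X]setTI; exact: measurable_rV_cons.
- apply/trivIsetP => /= i j _ _ ij; rewrite -preimage_setI.
  by move/trivIsetP : tF => /(_ _ _ _ _ ij) ->//; rewrite preimage_set0.
- rewrite -preimage_bigcup -[X in measurable X]setTI.
  exact: measurable_rV_cons.
Qed.

HB.instance Definition _ := isMeasure.Build _ _ _ lebesgue_cons
  lebesgue_cons0 lebesgue_cons_ge0 lebesgue_cons_sigma_additive.

Let lebesgue_cons_sigma_finite : sigma_finite setT lebesgue_cons.
Proof.
have /sigma_finiteP[F [TF ndF Foo]] := sigma_finiteT (@lebesgue_measure R).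
have /sigma_finiteP[G [TG ndG Goo]] := sigma_finiteT m.
exists (fun k => rV_uncons @^-1` (F k `*` G k)).
  rewrite -preimage_bigcup; apply/esym; rewrite -subTset => x _ /=.
  have [i _ Fi] : (\bigcup_i F i) (rV_uncons x).1 by rewrite -TF.
  have [j _ Gj] : (\bigcup_j G j) (rV_uncons x).2 by rewrite -TG.
  exists (maxn i j) => //; split.
  - by move: Fi; exact/subsetPset/ndF/leq_maxl.
  - by move: Gj; exact/subsetPset/ndG/leq_maxr.
move=> k; have [mF oF] := Foo k; have [mG oG] := Goo k.
split; first by rewrite -[X in measurable X]setTI;
  apply: measurable_rV_uncons => //; exact: measurableX.
rewrite /lebesgue_cons /pushforward -comp_preimage (_ : _ \o _ = id); last first.
  by apply/funext => p /=; rewrite rV_consK.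
by rewrite preimage_id product_measure1E// lte_mul_pinfty// ge0_fin_numE.
Qed.

HB.instance Definition _ :=
  Measure_isSigmaFinite.Build _ _ _ lebesgue_cons lebesgue_cons_sigma_finite.

End rV_cons.

Fixpoint lebesgue_rV (R : realType) (n : nat) :
    {sigma_finite_measure set 'rV[R]_n -> \bar R} :=
  match n with
  | 0 => \d_(0 : 'rV[R]_0)
  | m.+1 => lebesgue_cons (lebesgue_rV R m)
  end.

Lemma lebesgue_rV_box (R : realType) (n : nat) (a b : 'rV[R]_n) :
  (forall i, a ord0 i <= b ord0 i) ->
  lebesgue_rV R n [set x | forall i, a ord0 i <= x ord0 i <= b ord0 i] =
  (\prod_(i < n) (b ord0 i - a ord0 i))%:E.
Proof.
elim: n a b => [|n IHn] a b ab /=.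
  rewrite big_ord0 diracE mem_set// => -[]//.
set B := (X in _ X = _); pose a' := \row_(i < n) a ord0 (lift ord0 i).
pose b' := \row_(i < n) b ord0 (lift ord0 i).
pose B' := [set x : 'rV[R]_n | forall i, a' ord0 i <= x ord0 i <= b' ord0 i].
have mB' : measurable B'.
  rewrite (_ : B' = \big[setI/setT]_(i < n)
      (rV_coord i @^-1` `[a' ord0 i, b' ord0 i]%classic)).
    apply: bigsetI_measurable => i _; rewrite -[X in measurable X]setTI.
    exact: measurable_rV_coord.
  apply/seteqP; split => x /=.
    by move=> xB; rewrite -bigcap_seq => i _ /=; rewrite in_itv /=; exact: xB.
  by rewrite -bigcap_seq => xB i; have := xB i (mem_index_enum i); rewrite /= in_itv.
have x0E (p : measurableTypeR R * 'rV[R]_n) : rV_cons p ord0 ord0 = p.1.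
  rewrite /rV_cons mxE; case: splitP => // j _.
  by rewrite mxE [j]ord1 mulr1n.
have xSE (p : measurableTypeR R * 'rV[R]_n) i : rV_cons p ord0 (lift ord0 i) = p.2 ord0 i.
  rewrite /rV_cons mxE; case: splitP => j.
    by have := ltn_ord j; case: j => [[]].
  by rewrite lift0 => -[ij]; congr (p.2 _ _); exact: val_inj.
rewrite /lebesgue_cons /pushforward.
rewrite (_ : _ @^-1` B = `[a ord0 ord0, b ord0 ord0]%classic `*` B').
  rewrite product_measure1E//= lebesgue_measure_itv/= lte_fin IHn.
    rewrite big_ord_recl; under eq_bigr do rewrite !mxE.
    case: ltP => [_|ba]; first by rewrite -EFinD -EFinM.
    by rewrite (_ : b ord0 ord0 = a ord0 ord0) ?subrr ?mul0r ?mul0e//; apply/le_anti; rewrite ba ab.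
  by move=> i; rewrite !mxE.
apply/seteqP; split => -[t x] /= H.
  split; first by have := H ord0; rewrite x0E in_itv.
  by move=> i; have := H (lift ord0 i); rewrite xSE !mxE.
case: H => t0 xB i; case: (unliftP ord0 i) => [j ->|->]; last by rewrite x0E; move: t0; rewrite in_itv.
by have := xB j; rewrite xSE !mxE.
Qed.

(* The norm `|x| of 'rV[R]_n is the sup norm, hence a separate |x|. *)
Definition enorm (R : realType) (n : nat) (x : 'rV[R]_n) : R :=
  Num.sqrt (\sum_(i < n) x ord0 i ^+ 2).

Definition edot (R : realType) (n : nat) (x y : 'rV[R]_n) : R :=
  \sum_(i < n) x ord0 i * y ord0 i.

Definition is_domain (R : realType) (n : nat) (Omega : set 'rV[R]_n) : Prop :=
  [/\ Omega !=set0, open Omega & connected Omega].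

(* Near each boundary point p, Omega is the strict epigraph of a Lipschitz
   function of n - 1 variables in some rotated coordinates, whose last axis is
   the unit vector e; the hyperplane of the remaining n - 1 variables is the
   orthogonal complement of e, on which phi is evaluated. *)
Definition lipschitz_boundary (R : realType) (n : nat) (Omega : set 'rV[R]_n)
    : Prop :=
  forall p, (closure Omega `\` interior Omega) p ->
  exists (r L : R) (e : 'rV[R]_n) (phi : 'rV[R]_n -> R),
    [/\ 0 < r, enorm e = 1,
        (forall y z, `|phi y - phi z| <= L * enorm (y - z)) &
        (forall x, enorm (x - p) < r ->
           (Omega x <-> phi (x - edot x e *: e) < edot x e))].

Section Lebesgue_spaces.
Context (R : realType) (n : nat).
Notation mu := (lebesgue_rV R n).
Implicit Types (D : set 'rV[R]_n) (v : 'rV[R]_n -> R).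

(* Elements of L^2 are represented by Borel functions, not identified when
   they agree almost everywhere. *)
Definition L2fun D v : Prop := v \_ D \in Lfun mu 2%:E.

Definition L2norm D v : R := fine ('N[mu]_2%:E[EFin \o (v \_ D)])%E.

End Lebesgue_spaces.

Section H10.
Context (R : realType) (n : nat) (Omega : set 'rV[R]_n).
Notation mu := (lebesgue_rV R n).
Implicit Types (v phi : 'rV[R]_n -> R) (g : 'I_n -> 'rV[R]_n -> R).

Definition partial_deriv (i : 'I_n) phi : 'rV[R]_n -> R :=
  'D_(delta_mx ord0 i : 'rV[R]_n) phi.

Definition smooth_fun phi : Prop :=
  forall s : seq 'I_n,
    continuous (foldr partial_deriv phi s) /\
    forall i x, derivable (foldr partial_deriv phi s) x (delta_mx ord0 i).

Definition test_function phi : Prop :=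
  smooth_fun phi /\
  exists K, [/\ compact K, K `<=` Omega & forall x, ~ K x -> phi x = 0].

Definition weak_gradient v g : Prop :=
  (forall i, L2fun Omega (g i)) /\
  forall phi i, test_function phi ->
    \int[mu]_(x in Omega) (v x * partial_deriv i phi x) =
    - \int[mu]_(x in Omega) (g i x * phi x).

(* Membership in H^1_0(Omega), the H^1 closure of the test functions, for
   functions extended by zero to R^n. *)
Definition H10 v : Prop :=
  [/\ L2fun setT v,
      {ae mu, forall x, ~ Omega x -> v x = 0} &
      exists2 g, weak_gradient v g &
      exists phi : nat -> 'rV[R]_n -> R,
        [/\ (forall k, test_function (phi k)),
            L2norm Omega (phi k \- v) @[k --> \oo] --> (0 : R) &
            forall i, L2norm Omega (partial_deriv i (phi k) \- g i) @[k --> \oo]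
                      --> (0 : R)]].

(* The weak gradient is unique up to null sets, so the choice of a
   representative is immaterial. *)
Definition weak_grad v : 'I_n -> 'rV[R]_n -> R :=
  xget (fun=> cst 0) (weak_gradient v).

Definition H10norm v : R :=
  Num.sqrt (\sum_(i < n) L2norm Omega (weak_grad v i) ^+ 2).

End H10.

Section nonlocal.
Context (R : realType) (n : nat).
Notation mu := (lebesgue_rV R n).
Implicit Types (Omega : set 'rV[R]_n) (gamma : 'rV[R]_n -> 'rV[R]_n -> R).
Implicit Types (ghat : R -> R) (dmin dmax delta : R) (u v w : 'rV[R]_n -> R).

Definition symmetric_kernel gamma : Prop :=
  [/\ measurable_fun setT (fun z : 'rV[R]_n * 'rV[R]_n => gamma z.1 z.2),
      (forall x x', 0 <= gamma x x') &
      (forall x x', gamma x x' = gamma x' x)].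

Definition truncated_kernel gamma delta x x' : R :=
  if enorm (x - x') <= delta then gamma x x' else 0.

Definition kernel_H1 dmin dmax gamma : Prop :=
  (forall delta x x', dmin <= delta <= dmax ->
     0 <= truncated_kernel gamma delta x x' /\
     (delta < enorm (x - x') -> truncated_kernel gamma delta x x' = 0)) /\
  exists2 gamma0, 0 < gamma0 &
    forall delta x x', dmin <= delta <= dmax -> enorm (x - x') <= dmin / 2 ->
      gamma0 <= truncated_kernel gamma delta x x'.

(* ghat is a function on (0, +oo), possibly singular at 0; its values elsewhere
   are irrelevant, hence the condition x != x'. *)
Definition kernel_H2 dmin dmax gamma ghat : Prop :=
  [/\ (forall xi, 0 < xi -> 0 <= ghat xi),
      (forall delta x x', dmin <= delta <= dmax -> x != x' ->
         truncated_kernel gamma delta x x' <= ghat (enorm (x - x'))) &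
      lebesgue_measure.-integrable `]dmin, dmax[
        (fun xi => (xi ^+ n.-1 * ghat xi)%:E)].

Definition kernel_H3 dmin dmax ghat (Cgamma : R) : Prop :=
  0 < Cgamma /\
  forall xi, dmin < xi < dmax -> xi ^+ n.-1 * ghat xi <= Cgamma.

Definition radial_kernel gamma ghat : Prop :=
  forall x x', x != x' -> gamma x x' = ghat (enorm (x - x')).

Definition strip delta : set ('rV[R]_n * 'rV[R]_n) :=
  [set z | enorm (z.1 - z.2) <= delta].

Definition aform gamma u v delta : R :=
  \int[(mu \x mu)%E]_(z in strip delta)
    ((u z.1 - u z.2) * (v z.1 - v z.2) * gamma z.1 z.2).

Definition Vnorm gamma delta v : R := Num.sqrt (aform gamma v v delta).

Definition Vspace Omega gamma delta : set ('rV[R]_n -> R) :=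
  [set v | [/\ L2fun setT v,
               {ae mu, forall x, ~ Omega x -> v x = 0} &
               (\int[(mu \x mu)%E]_(z in strip delta)
                  ((v z.1 - v z.2) ^+ 2 * gamma z.1 z.2)%:E < +oo)%E]].

Definition poincare_constant Omega gamma dmin dmax (CP : R) : Prop :=
  [/\ 0 < CP,
      (forall delta v, dmin <= delta <= dmax -> Vspace Omega gamma delta v ->
         L2norm Omega v <= CP * Vnorm gamma delta v) &
      (forall v, H10 Omega v -> L2norm Omega v <= CP * H10norm Omega v)].

(* F belongs to the dual of the space V with seminorm N. *)
Definition in_dual (V : set ('rV[R]_n -> R)) (N : ('rV[R]_n -> R) -> R)
    (F : ('rV[R]_n -> R) -> R) : Prop :=
  (forall c v w, V v -> V w -> F (fun x => c * v x + w x) = c * F v + F w) /\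
  exists C, forall v, V v -> `|F v| <= C * N v.

Definition dual_norm (V : set ('rV[R]_n -> R)) (N : ('rV[R]_n -> R) -> R)
    (F : ('rV[R]_n -> R) -> R) : R :=
  sup [set `|F v| | v in [set v | V v /\ N v <= 1]].

Definition span_in (V : set ('rV[R]_n -> R)) (N : nat)
    (b : 'I_N -> 'rV[R]_n -> R) : set ('rV[R]_n -> R) :=
  [set v | V v /\ exists c : 'I_N -> R,
     {ae mu, forall x, v x = \sum_(i < N) c i * b i x}].

Definition nonlocal_solution gamma (V : set ('rV[R]_n -> R))
    (f : ('rV[R]_n -> R) -> R) delta u : Prop :=
  V u /\ forall v, V v -> aform gamma u v delta = f v.

Definition radial_integral ghat (a b : R) : R :=
  \int[lebesgue_measure]_(rho in `]a, b[) (rho ^+ n.-1 * ghat rho).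

End nonlocal.

Section affine_approximation.
Context (R : realType).
Implicit Types (K k : nat) (d : nat -> R) (delta : R).

(* Only the values d 0, ..., d K matter. *)
Definition partition_of (dmin dmax : R) K d : Prop :=
  [/\ d 0%N = dmin, d K = dmax & forall k, (k < K)%N -> d k < d k.+1].

Definition mesh K d : R := \big[Num.max/0]_(k < K) (d k.+1 - d k).

Variant approx_case := PiecewiseConstant | PiecewiseLinear.

Definition theta_constant (n : nat) (ghat : R -> R) K d k delta : R :=
  let alpha k := radial_integral n ghat (d k) delta in
  let beta k := radial_integral n ghat delta (d k) in
  if [|| (k == 0%N) && (delta == d 0%N),
         [&& (0 < k)%N, d k.-1 < delta <= d k & beta k < alpha k.-1] |
         [&& (k < K)%N, d k < delta <= d k.+1 & alpha k <= beta k.+1]]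
  then 1 else 0.

Definition theta_linear K d k delta : R :=
  if (k == 0%N) && (delta == d 0%N) then 1
  else if (0 < k)%N && (d k.-1 < delta <= d k) then
    (delta - d k.-1) / (d k - d k.-1)
  else if (k < K)%N && (d k < delta <= d k.+1) then
    (d k.+1 - delta) / (d k.+1 - d k)
  else 0.

Definition theta_approx (c : approx_case) (n : nat) (ghat : R -> R) K d k delta
    : R :=
  match c with
  | PiecewiseConstant => theta_constant n ghat K d k delta
  | PiecewiseLinear => theta_linear K d k delta
  end.

Definition aform_approx (c : approx_case) (n : nat)
    (gamma : 'rV[R]_n -> 'rV[R]_n -> R) (ghat : R -> R) K d
    (u v : 'rV[R]_n -> R) delta : R :=
  \sum_(k < K.+1) theta_approx c n ghat K d k delta * aform gamma u v (d k).

End affine_approximation.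

Section constants.
Context (R : realType) (n : nat).
Implicit Types (ghat : R -> R) (dmin dmax CP : R).

Definition Gamma_fun (s : R) : R :=
  \int[lebesgue_measure]_(t in `]0, +oo[) (t `^ (s - 1) * expR (- t)).

(* The constant omega_{n-1}, the surface area of the unit sphere of R^n. *)
Definition sphere_area : R := 2 * pi `^ (n%:R / 2) / Gamma_fun (n%:R / 2).

Definition C1gamma ghat dmin dmax : R :=
  sphere_area * radial_integral n ghat dmin dmax.

Definition alpha_a ghat dmin dmax CP : R :=
  1 / (1 + 4 * CP ^+ 2 * C1gamma ghat dmin dmax).

Definition C_a (Cgamma : R) : R := 4 * sphere_area * Cgamma.

Definition L_a' ghat dmin dmax CP (Lgamma : R) : R :=
  sup [set y | exists t1 t2 : R, [/\ dmin <= t1, t1 < t2, t2 <= dmax &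
    y = 2 * sphere_area * t2 ^+ n.-1 *
        (2 * CP * (n.-1%:R * t2^-1 * ghat t1 + Lgamma) + ghat t2)]].

End constants.

(* Main.v *)
(** The error [e = uN - u] satisfies
    [a(e, e; delta) = (a - a_K)(uN, e; delta) + r(e)], and [a(e, e; delta)]
    controls [alpha_a * |e|_V^2]: the forms of two horizons differ by the energy
    of a shell [a < |x - x'| <= b], which is at most
    [4 omega |v|_2^2 * int_a^b rho^(n-1) ghat]. The same shell estimate gives the
    piecewise constant case. For linear interpolation on [(a, b]], the error is
    [int w(|h|) ghat(|h|) W(h) dh], where [W] is the correlation
    [int (u(x) - u(x+h)) (e(x) - e(x+h)) dx] and [w] is a radial weight
    of zero mean; in polar coordinates only the oscillation of
    [rho^(n-1) ghat(rho) W(rho s)] on [(a, b]] matters, and [W] is Lipschitz by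
    the translation estimate [|u(. + h) - u|_2 <= |h| |grad u|_2] of [H^1_0].

    No measure on the sphere is needed: the unit ball with the radial density
    [n rho^(n-1)] replaces it, and its volume is matched with [sphere_area] by
    integrating a Gaussian. *)

Require Import Defs.
From mathcomp Require Import all_boot all_order all_algebra.
From mathcomp Require Import all_classical all_reals all_analysis.
From mathcomp Require Import measurable_realfun ring lra.
Set Implicit Arguments.
Unset Strict Implicit.
Unset Printing Implicit Defensive.
Import Order.TTheory GRing.Theory Num.Theory.
Import numFieldNormedType.Exports.
Local Open Scope classical_set_scope.
Local Open Scope ring_scope.

(** * Lebesgue measure on row vectors *)

(** The error [e] may enter the bound only through |e|_2 <= C_P |e|_V, whereas [uN] enters the
    linear case through its gradient. This shapes the correlation: expanded, it equals 2 <u, e> -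
    <u(. - h), e> - <u(. + h), e>, with every translation on [u], so that varying h costs |grad u|_2
    |e|_2.

    Up to the factor [sphere_area], the constant [L_a'] is a Lipschitz constant of rho^(n-1) ghat W.
    Its three summands are the increments of the power, of [ghat] and of W; the factor 2 C_P comes
    from |W| <= 4 |u|_2 |e|_2 and |u|_2 <= C_P |grad u|_2. The zero mean extracts a second order
    from mere Lipschitz regularity: one power of the cell size is the oscillation, the other is the
    length of the cell.

    The constant [alpha_a] is the inverse of the factor relating the energies of two horizons: the
    shell energy involves |v|_2^2, which the Poincaré inequality at the smaller horizon turns into
    energy.

    Real integrals are [fine] parts of extended ones, so an infinite integral is read as 0.
    Finiteness is therefore secured before linearity is used. *)

Section real_line.
Context (R : realType).
Notation mu := (@lebesgue_measure R).
Local Open Scope ereal_scope.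

(** The pushforward under a translation gives each []a, b]] its length, which characterises Lebesgue
    measure. *)
Lemma lebesgue_measure_shift (h : R) (A : set (measurableTypeR R)) :
  measurable A -> mu ((fun t : measurableTypeR R => (t + h)%R) @^-1` A) = mu A.
Proof.
move=> mA.
have mh : measurable_fun [set: measurableTypeR R]
  (fun t : measurableTypeR R => (t + h)%R : measurableTypeR R).
  exact: measurable_funD.
rewrite -[LHS]/(pushforward mu (fun t : measurableTypeR R => (t + h)%R : measurableTypeR R) A).
have := @lebesgue_measure_unique R
  (pushforward mu (fun t : measurableTypeR R => (t + h)%R : measurableTypeR R)).
move=> ->//= X [[a b] _ <-]; rewrite /pushforward.
have -> : (fun t => t + h)%R @^-1` `]a, b] = `](a - h)%R, (b - h)%R]%classic.
  by apply/seteqP; split => t /=; rewrite !in_itv/= ltrBlDr lerBrDr.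
rewrite !lebesgue_measure_itv/= !lte_fin ltrD2r; case: ifPn => // _.
by rewrite -!EFinB; congr EFin; ring.
Qed.

(** The pushforward under t |-> a t divides lengths by [a], so [a] times this pushforward is the
    measure that uniqueness identifies with Lebesgue measure. *)
Lemma lebesgue_measure_scale (a : R) (A : set (measurableTypeR R)) :
  (0 < a)%R -> measurable A ->
  mu ((fun t : measurableTypeR R => (a * t)%R) @^-1` A) = a^-1%:E * mu A.
Proof.
move=> a0 mA.
have ma : measurable_fun [set: measurableTypeR R]
  (fun t : measurableTypeR R => (a * t)%R : measurableTypeR R).
  exact: measurable_funM.
have a0' : (0 <= a)%R by exact: ltW.
pose k : {nonneg R} := NngNum a0'.
suff -> : mu A = mscale k (pushforward mu (fun t : measurableTypeR R => (a * t)%R : measurableTypeR R)) A.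
  rewrite /mscale/= muleA -EFinM mulVf ?mul1e//; last exact: lt0r_neq0.
have := @lebesgue_measure_unique R
  (mscale k (pushforward mu (fun t : measurableTypeR R => (a * t)%R : measurableTypeR R))).
move=> ->//= X [[c b] _ <-]; rewrite /mscale/= /pushforward.
have -> : (fun t => a * t)%R @^-1` `]c, b] = `](c / a)%R, (b / a)%R]%classic.
  by apply/seteqP; split => t /=; rewrite !in_itv/= ltr_pdivrMr// ler_pdivlMr// mulrC.
rewrite !lebesgue_measure_itv/= !lte_fin ltr_pM2r ?invr_gt0//; case: ifPn => // _.
  by rewrite -!EFinB -EFinM; congr EFin; field; exact: lt0r_neq0.
by rewrite mule0.
Qed.

Lemma ge0_integral_shift (h : R) (f : measurableTypeR R -> \bar R) :
  measurable_fun setT f -> (forall t, 0 <= f t) ->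
  \int[mu]_t f (t + h)%R = \int[mu]_t f t.
Proof.
move=> mf f0.
have mh : measurable_fun [set: measurableTypeR R]
  (fun t : measurableTypeR R => (t + h)%R : measurableTypeR R).
  exact: measurable_funD.
have := @ge0_integral_pushforward _ _ _ _ _ _ mh mu setT f measurableT mf (fun t _ => f0 t).
rewrite preimage_setT => <-.
by apply: eq_measure_integral => // A mA _; exact: lebesgue_measure_shift.
Qed.

Lemma ge0_integral_scale (a : R) (f : measurableTypeR R -> \bar R) :
  (0 < a)%R -> measurable_fun setT f -> (forall t, 0 <= f t) ->
  \int[mu]_t f t = a%:E * \int[mu]_t f (a * t)%R.
Proof.
move=> a0 mf f0.
have ma : measurable_fun [set: measurableTypeR R]
  (fun t : measurableTypeR R => (a * t)%R : measurableTypeR R).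
  exact: measurable_funM.
have a0' : (0 <= a)%R by exact: ltW.
pose k : {nonneg R} := NngNum a0'.
have := @ge0_integral_pushforward _ _ _ _ _ _ ma mu setT f measurableT mf (fun t _ => f0 t).
rewrite preimage_setT => <-.
have := @ge0_integral_mscale _ _ R _ setT measurableT k f mf (fun t _ => f0 t).
move=> /= <-; apply: eq_measure_integral => // A mA _.
transitivity (a%:E * mu ((fun t : measurableTypeR R => (a * t)%R) @^-1` A)); last by [].
by rewrite lebesgue_measure_scale// muleA -EFinM divff ?mul1e//; exact: lt0r_neq0.
Qed.

End real_line.

Section measurability_rV.
Context (R : realType) (n : nat).

Lemma measurable_rV_add d (T : measurableType d) (f g : T -> 'rV[R]_n) :
  measurable_fun setT f -> measurable_fun setT g ->
  measurable_fun setT (fun x => f x + g x).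
Proof.
move=> mf mg; apply: measurable_fun_rVP => i.
rewrite (_ : _ \o _ = (fun x => rV_coord i (f x) + rV_coord i (g x))); last first.
  by apply/funext => x; rewrite /= /rV_coord mxE.
by apply: measurable_funD; apply: measurableT_comp => //; exact: measurable_rV_coord.
Qed.

Lemma measurable_rV_scale d (T : measurableType d) (f : T -> R) (g : T -> 'rV[R]_n) :
  measurable_fun setT f -> measurable_fun setT g ->
  measurable_fun setT (fun x => f x *: g x).
Proof.
move=> mf mg; apply: measurable_fun_rVP => i.
rewrite (_ : _ \o _ = (fun x => f x * rV_coord i (g x))); last first.
  by apply/funext => x; rewrite /= /rV_coord mxE.
by apply: measurable_funM => //; apply: measurableT_comp => //; exact: measurable_rV_coord.
Qed.

Lemma measurable_rV_sub d (T : measurableType d) (f g : T -> 'rV[R]_n) :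
  measurable_fun setT f -> measurable_fun setT g ->
  measurable_fun setT (fun x => f x - g x).
Proof.
move=> mf mg; under eq_fun do rewrite -[- _]scaleN1r.
by apply: measurable_rV_add => //; exact: measurable_rV_scale.
Qed.

Lemma measurable_enorm : measurable_fun setT (@enorm R n).
Proof.
have ms : measurable_fun setT (fun x : 'rV[R]_n => \sum_(i < n) x ord0 i ^+ 2).
  apply: measurable_sum => i; apply: measurable_funX.
  exact: measurable_rV_coord.
apply: (measurableT_comp (f := @Num.sqrt R)) ms.
by apply: continuous_measurable_fun; exact: sqrt_continuous.
Qed.

End measurability_rV.

(** Induction by slicing along the first coordinate: the slices are translated by the tail of [h],
    the outer integral by its head. In dimension 0 the space is a single point. *)
Lemma lebesgue_rV_shift (R : realType) (n : nat) (h : 'rV[R]_n) (A : set 'rV[R]_n) :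
  measurable A -> lebesgue_rV R n ((fun x => x + h) @^-1` A) = lebesgue_rV R n A.
Proof.
elim: n h A => [|n IH] h A mA.
  by congr (lebesgue_rV R 0 _); apply/seteqP; split => x /=; rewrite !thinmx0.
have mC : measurable (@rV_cons R n @^-1` A).
  by rewrite -[X in measurable X]setTI; exact: measurable_rV_cons.
rewrite /= /lebesgue_cons /pushforward /product_measure1.
pose phi (t : measurableTypeR R) := lebesgue_rV R n (xsection (@rV_cons R n @^-1` A) t).
have mphi : measurable_fun setT phi by exact: measurable_fun_xsection.
transitivity (\int[lebesgue_measure]_t phi ((t : R) + h ord0 ord0)%R)%E; last first.
  by rewrite (@ge0_integral_shift R (h ord0 ord0) phi).
apply: eq_integral => t _ /=; rewrite /phi/=.
rewrite -[RHS](IH (rsubmx (h : 'rV_(1 + n)))); last exact: measurable_xsection.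
congr (lebesgue_rV R n _); apply/seteqP; split => x; rewrite /xsection/= !inE/=;
  rewrite /rV_cons/=.
all: have hE : row_mx (t%:M : 'rV_1) x + h =
   row_mx ((t + h ord0 ord0)%:M : 'rV_1) (x + rsubmx (h : 'rV_(1 + n))).
1,3: rewrite -[X in _ + X](@hsubmxK _ 1 1 n) add_row_mx; congr row_mx.
1,2: by apply/matrixP => i j; rewrite !mxE !ord1 eqxx !mulr1n; congr (_ + h _ _); apply: val_inj.
all: by rewrite hE.
Qed.

(** The same slicing; each coordinate contributes one factor [a^-1]. *)
Lemma lebesgue_rV_scale (R : realType) (n : nat) (a : R) (A : set 'rV[R]_n) :
  0 < a -> measurable A ->
  lebesgue_rV R n ((fun x => a *: x) @^-1` A) = ((a^-1 ^+ n)%:E * lebesgue_rV R n A)%E.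
Proof.
move=> a0; elim: n A => [|n IH] A mA.
  rewrite expr0 mul1e.
  by congr (lebesgue_rV R 0 _); apply/seteqP; split => x /=; rewrite !thinmx0.
have mC : measurable (@rV_cons R n @^-1` A).
  by rewrite -[X in measurable X]setTI; exact: measurable_rV_cons.
rewrite /= /lebesgue_cons /pushforward /product_measure1.
pose phi (t : measurableTypeR R) := lebesgue_rV R n (xsection (@rV_cons R n @^-1` A) t).
have mphi : measurable_fun setT phi by exact: measurable_fun_xsection.
rewrite -[X in (_ * X)%E]/(\int[lebesgue_measure]_t phi t)%E.
rewrite (@ge0_integral_scale R a phi)//= muleA -EFinM exprSr -mulrA mulVf ?lt0r_neq0// mulr1.
rewrite -ge0_integralZl//=; last 2 first.
- by apply: (measurableT_comp mphi); exact: measurable_funM.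
- by rewrite lee_fin exprn_ge0// invr_ge0 ltW.
apply: eq_integral => t _ /=; rewrite /phi/=.
rewrite -[RHS]IH; last exact: measurable_xsection.
congr (lebesgue_rV R n _); apply/seteqP; split => x; rewrite /xsection/= !inE/=;
  rewrite /rV_cons/= (@scale_row_mx _ 1 1 n) scale_scalar_mx//.
Qed.

Section lebesgue_rV_integral.
Context (R : realType) (n : nat).
Notation mu := (lebesgue_rV R n).
Local Open Scope ereal_scope.

Lemma measurable_rV_shift (h : 'rV[R]_n) :
  measurable_fun [set: 'rV[R]_n] (fun x => (x + h)%R).
Proof. by apply: measurable_rV_add => //; exact: measurable_id. Qed.

Lemma ge0_integral_rV_shift (h : 'rV[R]_n) (f : 'rV[R]_n -> \bar R) :
  measurable_fun setT f -> (forall t, 0 <= f t) ->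
  \int[mu]_t f (t + h)%R = \int[mu]_t f t.
Proof.
move=> mf f0.
have := @ge0_integral_pushforward _ _ _ _ _ _ (measurable_rV_shift h) mu setT f
  measurableT mf (fun t _ => f0 t).
rewrite preimage_setT => <-.
apply: eq_measure_integral => [|mh A mA _]; first exact: measurable_rV_shift.
by transitivity (mu ((fun x => x + h)%R @^-1` A)); last exact: lebesgue_rV_shift.
Qed.

Lemma ge0_integral_rV_scale (a : R) (f : 'rV[R]_n -> \bar R) :
  (0 < a)%R -> measurable_fun setT f -> (forall t, 0 <= f t) ->
  \int[mu]_t f t = (a ^+ n)%:E * \int[mu]_t f (a *: t)%R.
Proof.
move=> a0 mf f0.
have ma : measurable_fun [set: 'rV[R]_n] (fun t => (a *: t)%R).
  exact: measurable_rV_scale.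
have a0' : (0 <= a ^+ n)%R by rewrite exprn_ge0// ltW.
pose k : {nonneg R} := NngNum a0'.
have := @ge0_integral_pushforward _ _ _ _ _ _ ma mu setT f measurableT mf (fun t _ => f0 t).
rewrite preimage_setT => <-.
have := @ge0_integral_mscale _ _ R _ setT measurableT k f mf (fun t _ => f0 t).
move=> /= <-; apply: eq_measure_integral => A mA _.
transitivity ((a ^+ n)%:E * mu ((fun t => a *: t)%R @^-1` A)); last by [].
rewrite lebesgue_rV_scale// muleA -EFinM -exprMn divff ?lt0r_neq0//.
by rewrite expr1n mul1e.
Qed.

(** Over a fixed x the slice is merely translated by x. This justifies passing from a pair (x, x')
    to the base point x and the increment h = x' - x. *)
Lemma lebesgue_rV_shear (C : set ('rV[R]_n * 'rV[R]_n)) : measurable C ->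
  pushforward (mu \x mu) (fun z => (z.1, z.1 + z.2)%R) C = (mu \x mu) C.
Proof.
move=> mC; rewrite /pushforward /product_measure1.
apply: eq_integral => x _ /=.
rewrite -[RHS](lebesgue_rV_shift x); last exact: measurable_xsection.
congr (mu _); apply/seteqP; split => y; rewrite /xsection/= !inE/=; by rewrite addrC.
Qed.

End lebesgue_rV_integral.

Section enorm_theory.
Context (R : realType) (n : nat).
Implicit Types (x : 'rV[R]_n) (a : R).

Lemma sqr_enorm x : enorm x ^+ 2 = \sum_(i < n) x ord0 i ^+ 2.
Proof. by rewrite /enorm sqr_sqrtr//; apply: sumr_ge0 => i _; exact: sqr_ge0. Qed.

Lemma enorm_ge0 x : 0 <= enorm x.
Proof. exact: sqrtr_ge0. Qed.

Lemma enormZ a x : enorm (a *: x) = `|a| * enorm x.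
Proof.
rewrite /enorm; under eq_bigr do rewrite mxE exprMn.
by rewrite -mulr_sumr sqrtrM ?sqr_ge0// sqrtr_sqr.
Qed.

Lemma enormN x : enorm (- x) = enorm x.
Proof. by rewrite -scaleN1r enormZ normrN1 mul1r. Qed.

Lemma enorm_eq0 x : (enorm x == 0) = (x == 0).
Proof.
apply/eqP/eqP => [x0|->]; last first.
  by rewrite /enorm big1 ?sqrtr0// => i _; rewrite mxE expr0n.
have /eqP : \sum_(i < n) x ord0 i ^+ 2 = 0 by rewrite -sqr_enorm x0 expr0n.
rewrite psumr_eq0 => [/allP H|i _]; last exact: sqr_ge0.
apply/matrixP => i j; rewrite ord1 mxE.
by have := H j (mem_index_enum _); rewrite /= sqrf_eq0 => /eqP.
Qed.

Lemma enorm_gt0 x : (0 < enorm x) = (x != 0).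
Proof. by rewrite lt_def enorm_eq0 enorm_ge0 andbT. Qed.

End enorm_theory.

Section polar.
Context (R : realType) (n : nat).
Hypothesis n_gt0 : (0 < n)%N.
Notation mu := (lebesgue_rV R n).
Notation leb := (@lebesgue_measure R).
Local Open Scope ereal_scope.

Lemma measurable_rV_set0 : measurable [set (0%R : 'rV[R]_n)].
Proof.
rewrite (_ : [set _] = enorm (n:=n) @^-1` [set 0%R]).
  by rewrite -[X in measurable X]setTI; exact: measurable_enorm.
apply/seteqP; split => x /= => [->|/eqP]; last by rewrite enorm_eq0 => /eqP.
by apply/eqP; rewrite enorm_eq0.
Qed.

(** A degenerate box, null because [n > 0]; in dimension 0 the measure is the Dirac mass at this
    very point. The origin has to be negligible since it has no direction. *)
Lemma lebesgue_rV_set0 : mu [set (0%R : 'rV[R]_n)] = 0.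
Proof.
transitivity (mu [set x | forall i, ((0%R : 'rV[R]_n) ord0 i <= x ord0 i <= (0%R : 'rV[R]_n) ord0 i)%R]).
  congr (mu _); apply/seteqP; split => x /=; first by move=> -> i; rewrite mxE lexx.
  move=> H; apply/matrixP => i j; rewrite ord1 mxE.
  by have := H j; rewrite mxE => /le_anti.
rewrite lebesgue_rV_box//; congr EFin.
by case: n n_gt0 => // m _; rewrite big_ord_recl mxE subrr mul0r.
Qed.

Lemma cvgy_exprn : (t ^+ n : R)%R @[t --> +oo%R] --> +oo%R.
Proof.
apply: (ger_cvgy (f := id)) => //; near=> t.
rewrite -[leLHS]expr1; apply: ler_weXn2l => //.
Unshelve. all: by end_near. Qed.

(** [- t ^- n] is a primitive, and it vanishes at infinity because [n > 0]. *)
Lemma integral_exprN (a : R) : (0 < a)%R ->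
  \int[leb]_(t in `[a, +oo[) (n%:R * t ^- n.+1)%:E = (a ^- n)%:E.
Proof.
move=> a0.
have tn0 m (t : R) : (0 < t)%R -> (t ^+ m != 0 :> R)%R.
  by move=> t0; rewrite expf_neq0// gt_eqF.
have d (t : R) : (0 < t)%R -> is_derive t 1%R (fun t : R => - (t ^- n))%R (n%:R * t ^- n.+1)%R.
  move=> t0.
  have dX : is_derive t 1%R (fun t : R => t ^+ n)%R (n%:R * t ^+ n.-1)%R.
    have := @is_deriveX R R^o id n t 1%R 1%R (is_derive_id t 1%R).
    by rewrite exprfctE => H; apply: is_derive_eq; exact: mulr1.
  have dV := @is_deriveV R _ t _ 1%R (tn0 n t t0) dX.
  apply: is_derive_eq.
  rewrite -[LHS]mulNr opprK; case: n n_gt0 => // m _ /=.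
  have := gt_eqF t0 => /negbT t1.
  have := tn0 m t t0; rewrite !exprS; set q := (t ^+ m)%R => q0.
  by rewrite expr0; field; rewrite q0 t1.
have cV m (t : R) : (0 < t)%R -> {for t, continuous (fun t : R => t ^- m)%R}.
  by move=> t0; apply: cvgV; [exact: tn0|exact: exprn_continuous].
rewrite (@ge0_continuous_FTC2y _ _ (fun t : R => - (t ^- n))%R _ 0%R)//.
- by rewrite sub0e -EFinN opprK.
- by move=> x ax; rewrite mulr_ge0// invr_ge0 exprn_ge0// (le_trans _ ax)// ltW.
- apply: continuous_in_subspaceT => x; rewrite inE/= in_itv/= andbT => ax.
  by apply: cvgM; [exact: cvg_cst|apply: cV; exact: lt_le_trans ax].
- rewrite -oppr0; apply: cvgN; apply/gtr0_cvgV0; last exact: cvgy_exprn.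
  by near=> t; rewrite exprn_gt0//.
- by move=> x ax; have [] := d x (lt_trans a0 ax).
- by apply: cvg_at_right_filter; apply: cvgN; exact: cV.
- move=> x; rewrite in_itv/= andbT => ax.
  by rewrite derive1E; have [_ ->] := d x (lt_trans a0 ax).
Unshelve. all: by end_near. Qed.

End polar.

(** * Polar coordinates *)

Section measurability_misc.
Context d (T : measurableType d) (R : realType).

Lemma measurable_set_le (f g : T -> R) :
  measurable_fun setT f -> measurable_fun setT g ->
  measurable [set x | f x <= g x].
Proof.
move=> mf mg; rewrite -[X in measurable X]setTI.
exact: (measurable_fun_ler mf mg) measurableT [set true] _.
Qed.

Lemma measurable_set_lt (f g : T -> R) :
  measurable_fun setT f -> measurable_fun setT g ->
  measurable [set x | f x < g x].
Proof.
move=> mf mg; rewrite -[X in measurable X]setTI.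
exact: (measurable_fun_ltr mf mg) measurableT [set true] _.
Qed.

Lemma measurable_ge0_inv (f : T -> R) : (forall x, 0 <= f x) ->
  measurable_fun setT f -> measurable_fun setT (fun x => (f x)^-1).
Proof.
move=> f0 mf; under eq_fun do rewrite -powR_inv1//.
exact: (measurableT_comp (measurable_powR _)).
Qed.

End measurability_misc.

Lemma indic_predE (T : Type) (R : pzRingType) (P : T -> bool) (x : T) :
  \1_[set x | P x] x = (P x)%:R :> R.
Proof.
rewrite indicE; congr ((nat_of_bool _)%:R).
by apply/idP/idP => [/set_mem//|Px]; exact/mem_set.
Qed.

Section polar_weights.
Context (R : realType) (n : nat).

(* The unit ball, weighted by the density of the radius, plays the role of the
   surface measure of the unit sphere. *)
Definition ball_indic (y : 'rV[R]_n) : R := \1_[set y : 'rV[R]_n | (enorm y <= 1)%R] y.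

(** The factor [n] gives []0, 1]] mass 1, and with the ball volume |B| it produces the surface area
    n |B|. The weight is not cut at 1: the ball only samples directions, while rays run to
    infinity. *)
Definition radial_weight (t : R) : R := \1_[set t : R | (0 < t)%R] t * (n%:R * t ^+ n.-1).

Lemma ball_indicE y : ball_indic y = (enorm y <= 1)%R%:R.
Proof. by rewrite /ball_indic indic_predE. Qed.

Lemma radial_weightE t : radial_weight t = if 0 < t then n%:R * t ^+ n.-1 else 0.
Proof.
by rewrite /radial_weight indic_predE; case: ltP => _; rewrite ?mul1r ?mul0r.
Qed.

Lemma ball_indic_ge0 y : 0 <= ball_indic y.
Proof. by rewrite ball_indicE ler0n. Qed.

Lemma radial_weight_ge0 t : 0 <= radial_weight t.
Proof. by rewrite radial_weightE; case: ifPn => // /ltW t0; rewrite mulr_ge0// exprn_ge0. Qed.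

Lemma measurable_ball_indic : measurable_fun setT ball_indic.
Proof. by apply: measurable_indic; apply: measurable_set_le => //; exact: measurable_enorm. Qed.

Lemma measurable_radial_weight : measurable_fun [set: measurableTypeR R] radial_weight.
Proof.
apply: measurable_funM.
  by apply: measurable_indic; exact: measurable_set_lt.
by apply: measurable_funM => //; exact: measurable_funX.
Qed.

(** At the origin the convention 0^-1 = 0 makes this 0, so it is a unit vector only off a null
    set. *)
Definition sphere_proj (y : 'rV[R]_n) : 'rV[R]_n := (enorm y)^-1 *: y.

Lemma measurable_sphere_proj : measurable_fun setT sphere_proj.
Proof.
apply: measurable_rV_scale => //.
by apply: measurable_ge0_inv; [exact: enorm_ge0|exact: measurable_enorm].
Qed.

Lemma enorm_sphere_proj y : y != 0 -> enorm (sphere_proj y) = 1.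
Proof.
move=> y0; have r0 : 0 < enorm y by rewrite enorm_gt0.
by rewrite enormZ ger0_norm ?invr_ge0 ?ltW// mulVf// gt_eqF.
Qed.

End polar_weights.

Section polar.
Context (R : realType) (n : nat).
Hypothesis n_gt0 : (0 < n)%N.
Notation mu := (lebesgue_rV R n).
Notation leb := (@lebesgue_measure R).
Local Open Scope ereal_scope.
Notation b := (@ball_indic R n).
Notation k := (@radial_weight R n).

Let nE (x : R) : (x ^+ n = x * x ^+ n.-1)%R.
Proof. by rewrite -exprS prednK. Qed.

(** Indicators and a real power are used so that joint measurability follows by composition; [cE]
    gives the readable form. *)
Let c (z : 'rV[R]_n) (t : R) : R :=
  (\1_[set p : 'rV[R]_n * measurableTypeR R | (0 < p.2)%R] (z, t) *
   (\1_[set p : 'rV[R]_n * measurableTypeR R | (enorm p.1 <= p.2)%R] (z, t) *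
   (n%:R * (t `^ (-1)) ^+ n.+1)))%R.

Let cE z t : c z t = if (0 < t)%R && (enorm z <= t)%R then (n%:R * t ^- n.+1)%R else 0%R.
Proof.
rewrite /c !indic_predE/=; case: ltP => t0; case: leP => zt; rewrite ?mul1r ?mul0r//=.
by rewrite powR_inv1 ?ltW// exprVn.
Qed.

Let c_ge0 z t : (0 <= c z t)%R.
Proof.
rewrite cE; case: ifP => // /andP[t0 _].
by rewrite mulr_ge0// invr_ge0 exprn_ge0// ltW.
Qed.

Let measurable_c : measurable_fun [set: 'rV[R]_n * measurableTypeR R] (fun p => c p.1 p.2).
Proof.
apply: measurable_funM.
  rewrite (_ : (fun _ => _) = \1_[set p : 'rV[R]_n * measurableTypeR R | (0 < p.2)%R]);
    last by apply/funext => -[].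
  apply: measurable_indic; apply: measurable_set_lt => //; exact: measurable_snd.
apply: measurable_funM.
  rewrite (_ : (fun _ => _) = \1_[set p : 'rV[R]_n * measurableTypeR R | (enorm p.1 <= p.2)%R]);
    last by apply/funext => -[].
  apply: measurable_indic; apply: measurable_set_le.
    by apply: measurableT_comp => //; exact: measurable_enorm.
  exact: measurable_snd.
apply: measurable_funM => //; apply: measurable_funX.
by apply: (measurableT_comp (measurable_powR _)); exact: measurable_snd.
Qed.

Let integral_c z : z != 0%R -> \int[leb]_t (c z t)%:E = (enorm z ^- n)%:E.
Proof.
move=> z0; have r0 : (0 < enorm z)%R by rewrite enorm_gt0.
rewrite -integral_exprN// [RHS]integral_mkcond; apply: eq_integral => t _.
rewrite patchE mem_setE in_itv/= andbT cE.
case: (leP (enorm z) t) => rt; last by rewrite andbF.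
by rewrite (lt_le_trans r0 rt).
Qed.

Variable F : 'rV[R]_n -> \bar R.
Hypotheses (mF : measurable_fun setT F) (F0 : forall x, 0 <= F x).

Let stepA y : y != 0%R ->
  \int[leb]_t ((b y * k t)%:E * F (t *: sphere_proj y)%R) =
  \int[leb]_t ((b y * (enorm y ^+ n * k t))%:E * F (t *: y)%R).
Proof.
move=> y0; have r0 : (0 < enorm y)%R by rewrite enorm_gt0.
have mk : measurable_fun setT k by exact: measurable_radial_weight.
rewrite (@ge0_integral_scale R (enorm y))//; last 2 first.
- apply: emeasurable_funM.
    by apply/measurable_EFinP; apply: measurable_funM.
  by apply: (measurableT_comp mF); exact: measurable_rV_scale.
- by move=> t; rewrite mule_ge0// lee_fin mulr_ge0 ?radial_weight_ge0 ?ball_indic_ge0.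
rewrite -ge0_integralZl//=; last 3 first.
- apply: emeasurable_funM.
    apply/measurable_EFinP; apply: measurable_funM => //; apply: (measurableT_comp mk).
    exact: measurable_funM.
  by apply: (measurableT_comp mF); apply: measurable_rV_scale => //; exact: measurable_funM.
- by move=> t _; rewrite mule_ge0// lee_fin mulr_ge0 ?radial_weight_ge0 ?ball_indic_ge0.
- by rewrite lee_fin ltW.
apply: eq_integral => t _; rewrite muleA -EFinM; congr (_%:E * F _); last first.
  by rewrite /sphere_proj scalerA mulrAC mulfV ?gt_eqF// mul1r.
rewrite !radial_weightE pmulr_rgt0//; case: ifPn => t0; last by rewrite !mulr0.
by rewrite nE exprMn; ring.
Qed.

(** Under z = t y the ball condition |y| <= 1 becomes |z| <= t, the support of [c]. The powers
    match: t^n (Jacobian) times n t^(-n-1) times t^n |y|^n is n t^(n-1) |y|^n. For t <= 0 both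
    integrands vanish. *)
Let stepC t :
  \int[mu]_y ((b y * (enorm y ^+ n * k t))%:E * F (t *: y)%R) =
  \int[mu]_z ((c z t)%:E * ((enorm z ^+ n)%:E * F z)).
Proof.
have [t0|t0] := ltP 0%R t; last first.
  rewrite [LHS]integral0_eq ?[RHS]integral0_eq// => z _.
    by rewrite cE ltNge t0 mul0e.
  by rewrite radial_weightE ltNge t0/= !mulr0 mul0e.
have mc : measurable_fun setT (c ^~ t).
  exact: (measurableT_comp measurable_c (measurable_pair2 t)).
have mg : measurable_fun setT (fun z => (c z t)%:E * ((enorm z ^+ n)%:E * F z)).
  apply: emeasurable_funM; first exact/measurable_EFinP.
  apply: emeasurable_funM => //; apply/measurable_EFinP/measurable_funX.
  exact: measurable_enorm.
have g0 z : 0 <= (c z t)%:E * ((enorm z ^+ n)%:E * F z).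
  by rewrite mule_ge0 ?lee_fin// mule_ge0// lee_fin exprn_ge0// enorm_ge0.
rewrite [RHS](@ge0_integral_rV_scale R n t)//.
rewrite -ge0_integralZl//=; last 2 first.
- by apply: (measurableT_comp mg); exact: measurable_rV_scale.
- by rewrite lee_fin exprn_ge0// ltW.
apply: eq_integral => y _; rewrite !muleA -!EFinM; congr (_%:E * _).
rewrite cE t0/= enormZ gtr0_norm// ger_pMr// ball_indicE radial_weightE t0.
case: leP => y1; last by rewrite !(mulr0,mul0r).
have tm : (t ^+ n.-1 != 0)%R by rewrite expf_neq0// gt_eqF.
by rewrite mul1r exprMn exprS !nE; field; rewrite tm gt_eqF.
Qed.

(* On the right, substitute [t = |y| s], exchange, and put [z = s y]; there remains
   [|z|^n] times the integral of [n s^(-n-1)] over [s >= |z|], which is 1. *)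
Lemma polar_integral : \int[mu]_h F h =
  \int[mu]_y \int[leb]_t ((b y * k t)%:E * F (t *: sphere_proj y)%R).
Proof.
have mb : measurable_fun setT b by exact: measurable_ball_indic.
have mk : measurable_fun setT k by exact: measurable_radial_weight.
have men := @measurable_enorm R n.
have mr : measurable_fun setT (fun z : 'rV[R]_n => enorm z ^+ n)%R by exact: measurable_funX.
have zae : {ae mu, forall z : 'rV[R]_n, z != 0%R}.
  exists [set 0%R]; split; [exact: measurable_rV_set0|exact: lebesgue_rV_set0|].
  by move=> z /= /negP; rewrite negbK => /eqP.
pose G (p : 'rV[R]_n * measurableTypeR R) :=
  (b p.1 * (enorm p.1 ^+ n * k p.2))%:E * F (p.2 *: p.1)%R.
have mG : measurable_fun setT G.
  apply: emeasurable_funM.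
    apply/measurable_EFinP; apply: measurable_funM; first exact: measurableT_comp.
    by apply: measurable_funM; [exact: (measurableT_comp mr)|exact: (measurableT_comp mk)].
  by apply: (measurableT_comp mF); exact: measurable_rV_scale.
have G0 p : 0 <= G p.
  rewrite mule_ge0// lee_fin; apply: mulr_ge0; first exact: ball_indic_ge0.
  by apply: mulr_ge0; [apply: exprn_ge0; exact: enorm_ge0|exact: radial_weight_ge0].
pose G1 (p : 'rV[R]_n * measurableTypeR R) :=
  (b p.1 * k p.2)%:E * F (p.2 *: sphere_proj p.1)%R.
have mG1 : measurable_fun setT G1.
  apply: emeasurable_funM.
    by apply/measurable_EFinP; apply: measurable_funM;
      [exact: (measurableT_comp mb)|exact: (measurableT_comp mk)].
  apply: (measurableT_comp mF); apply: measurable_rV_scale => //.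
  exact: (measurableT_comp (@measurable_sphere_proj R n)).
have G10 p : 0 <= G1 p.
  rewrite mule_ge0// lee_fin; apply: mulr_ge0; first exact: ball_indic_ge0.
  exact: radial_weight_ge0.
pose H (p : 'rV[R]_n * measurableTypeR R) :=
  (c p.1 p.2)%:E * ((enorm p.1 ^+ n)%:E * F p.1).
have mH : measurable_fun setT H.
  apply: emeasurable_funM; first exact/measurable_EFinP.
  apply: emeasurable_funM; last exact: (measurableT_comp mF).
  by apply/measurable_EFinP; exact: (measurableT_comp mr).
have H0 p : 0 <= H p.
  by rewrite mule_ge0 ?lee_fin// mule_ge0// lee_fin exprn_ge0// enorm_ge0.
transitivity (\int[mu]_y \int[leb]_t G (y, t)); last first.
  apply: ge0_ae_eq_integral => //.
  - exact: (measurable_fun_fubini_tonelli_F G).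
  - exact: (measurable_fun_fubini_tonelli_F G1).
  - by move=> y _; apply: integral_ge0.
  - by move=> y _; apply: integral_ge0 => t _; exact: (G10 (y, t)).
  - by apply: filterS zae => y y0 _; rewrite -stepA.
rewrite (fubini_tonelli G)//.
transitivity (\int[leb]_t \int[mu]_z H (z, t)); last first.
  by apply: eq_integral => t _; rewrite /G/= stepC.
rewrite -(fubini_tonelli H)//.
apply: ge0_ae_eq_integral => //.
- exact: (measurable_fun_fubini_tonelli_F H).
- by move=> y _; apply: integral_ge0.
apply: filterS zae => z z0 _; rewrite /H/=.
have r0 : (0 < enorm z)%R by rewrite enorm_gt0.
rewrite ge0_integralZr//; last 3 first.
- apply/measurable_EFinP.
  exact: (measurableT_comp measurable_c (measurable_pair1 z)).
- by move=> t _; rewrite lee_fin.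
- by rewrite mule_ge0// lee_fin exprn_ge0// enorm_ge0.
rewrite integral_c// muleA -EFinM mulVf ?mul1e//.
by rewrite expf_neq0// gt_eqF.
Qed.

End polar.

Section radial.
Context (R : realType) (n : nat).
Hypothesis n_gt0 : (0 < n)%N.
Notation mu := (lebesgue_rV R n).
Notation leb := (@lebesgue_measure R).
Local Open Scope ereal_scope.
Notation b := (@ball_indic R n).
Notation k := (@radial_weight R n).

(** Off the origin |t [sphere_proj] y| = t for t > 0, so the double integral of the polar formula
    splits into a product. *)
Lemma radial_integral_ball (g : measurableTypeR R -> \bar R) :
  measurable_fun setT g -> (forall t, 0 <= g t) ->
  \int[mu]_h g (enorm h) =
  (\int[mu]_y (b y)%:E) * \int[leb]_t ((k t)%:E * g t).
Proof.
move=> mg g0.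
have mb : measurable_fun setT b by exact: measurable_ball_indic.
have mk : measurable_fun setT k by exact: measurable_radial_weight.
have mgn : measurable_fun setT (fun h : 'rV[R]_n => g (enorm h)).
  by apply: (measurableT_comp mg); exact: measurable_enorm.
rewrite polar_integral//.
have mkg : measurable_fun setT (fun t : measurableTypeR R => (k t)%:E * g t).
  by apply: emeasurable_funM => //; exact/measurable_EFinP.
have kg0 t : 0 <= (k t)%:E * g t by rewrite mule_ge0// lee_fin radial_weight_ge0.
rewrite -ge0_integralZr//; last 3 first.
- exact/measurable_EFinP.
- by move=> y _; rewrite lee_fin ball_indic_ge0.
- exact: integral_ge0.
apply: ge0_ae_eq_integral => //.
- pose G (p : 'rV[R]_n * measurableTypeR R) :=
    (b p.1 * k p.2)%:E * g (enorm (p.2 *: sphere_proj p.1)%R).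
  apply: (measurable_fun_fubini_tonelli_F G) => //.
    apply: emeasurable_funM.
      by apply/measurable_EFinP; apply: measurable_funM;
        [exact: (measurableT_comp mb)|exact: (measurableT_comp mk)].
    apply: (measurableT_comp mgn); apply: measurable_rV_scale => //.
    exact: (measurableT_comp (@measurable_sphere_proj R n)).
  move=> p; rewrite mule_ge0// lee_fin; apply: mulr_ge0; first exact: ball_indic_ge0.
  exact: radial_weight_ge0.
- by apply: emeasurable_funM => //; exact/measurable_EFinP.
- move=> y _; apply: integral_ge0 => t _.
  rewrite mule_ge0// lee_fin; apply: mulr_ge0; first exact: ball_indic_ge0.
  exact: radial_weight_ge0.
- by move=> y _; rewrite mule_ge0// ?integral_ge0// lee_fin ball_indic_ge0.
exists [set 0%R]; split; [exact: measurable_rV_set0|exact: lebesgue_rV_set0|].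
move=> y /= H; apply: contrapT => /eqP y0; apply: H => _.
rewrite -ge0_integralZl//; last by rewrite lee_fin ball_indic_ge0.
apply: eq_integral => t _; rewrite EFinM -muleA enormZ enorm_sphere_proj// mulr1.
rewrite radial_weightE; case: ltP => t0; last by rewrite !mul0e.
by rewrite gtr0_norm.
Qed.

End radial.

(** The Gaussian of |h| is a product over coordinates, so peeling off the first one leaves the
    one-dimensional Gaussian integral. The value identifies [sphere_area] and later shows that it is
    positive. *)
Lemma integral_gauss_rV (R : realType) (n : nat) :
  (\int[lebesgue_rV R n]_h (expR (- enorm h ^+ 2))%:E = (Num.sqrt pi ^+ n)%:E)%E.
Proof.
elim: n => [|n IH].
  rewrite integral_dirac//; last first.
    apply/measurable_EFinP; apply: measurableT_comp => //; apply: measurableT_comp => //.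
    by apply: measurable_funX; exact: measurable_enorm.
  by rewrite diracT mul1e sqr_enorm big_ord0 oppr0 expR0 expr0.
rewrite /= /lebesgue_cons.
have me m : measurable_fun setT (fun h : 'rV[R]_m => (expR (- enorm h ^+ 2))%:E).
  apply/measurable_EFinP; apply: measurableT_comp => //; apply: measurableT_comp => //.
  by apply: measurable_funX; exact: measurable_enorm.
have := @ge0_integral_pushforward _ _ _ _ R _ (@measurable_rV_cons R n)
  (lebesgue_measure \x lebesgue_rV R n)%E setT _ measurableT (me n.+1)
  (fun=> fun=> expR_ge0 _).
rewrite preimage_setT => H.
transitivity (\int[(lebesgue_measure \x lebesgue_rV R n)%E]_x (expR (- enorm (@rV_cons R n x) ^+ 2))%:E)%E.
  exact: H.
rewrite fubini_tonelli1//; last first.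
  exact: (measurableT_comp (me n.+1) (@measurable_rV_cons R n)).
rewrite /fubini_F.
transitivity (\int[@lebesgue_measure R]_t ((gauss_fun t)%:E * (Num.sqrt pi ^+ n)%:E))%E.
  apply: eq_integral => t _; rewrite -IH -ge0_integralZl//; last 2 first.
  - exact: (me n).
  - by rewrite lee_fin expR_ge0.
  apply: eq_integral => x _; rewrite /gauss_fun -EFinM -expRD -opprD; congr (expR (- _))%:E.
  rewrite !sqr_enorm big_ord_recl /rV_cons/=; congr (_ + _).
    by rewrite mxE; case: splitP => // j _; rewrite mxE [j]ord1 mulr1n.
  apply: eq_bigr => i _; rewrite mxE; case: splitP => j.
    by have := ltn_ord j; case: j => [[]].
  by rewrite lift0 => -[ij]; congr (x _ _ ^+ _); exact: val_inj.
rewrite ge0_integralZr//; last 2 first.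
- by apply/measurable_EFinP; exact: measurable_gauss_fun.
- by move=> t _; rewrite lee_fin gauss_fun_ge0.
by rewrite integralT_gauss -EFinM exprS.
Qed.

Section sphere.
Context (R : realType) (n : nat).
Hypothesis n_gt0 : (0 < n)%N.
Notation mu := (lebesgue_rV R n).
Notation leb := (@lebesgue_measure R).
Local Open Scope ereal_scope.
Notation b := (@ball_indic R n).
Notation k := (@radial_weight R n).

Let G (s : R) : R := (s `^ (n%:R / 2 - 1) * expR (- s))%R.

(** Two exhaustions of the half-line by compact intervals, exchanged by the substitution s = t^2:
    radius i + 1 for t, radius (i + 1)^2 for s. *)
Let bigcup_itv (r : nat -> R) : (forall i, r i = (i.+1%:R)%R \/ r i = (i.+1%:R ^+ 2)%R) ->
  \bigcup_i `[(r i)^-1%R, r i]%classic = `]0%R, +oo[%classic.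
Proof.
move=> rE; have r1 i : (1 <= r i /\ i.+1%:R <= r i)%R.
  have i1 : (1 <= i.+1%:R :> R)%R by rewrite ler1n.
  case: (rE i) => ->; split => //; first by rewrite expr_ge1// (le_trans ler01).
  by rewrite expr2 ler_peMr// (le_trans ler01).
apply/seteqP; split => [t [i _]|t]/=; rewrite !in_itv/= andbT.
  move=> /andP[+ _]; apply: lt_le_trans; rewrite invr_gt0.
  by have [/(lt_le_trans ltr01)] := r1 i.
move=> t0; pose N := maxn (Num.truncn t) (Num.truncn t^-1); exists N => //=; rewrite in_itv/=.
have [N1 N2] := r1 N; have rN := lt_le_trans ltr01 N1.
have tN x : (x = t \/ x = t^-1)%R -> (x <= r N)%R.
  move=> xE; apply: le_trans N2; apply/ltW; apply: (lt_le_trans (truncnS_gt x)).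
  by rewrite ler_nat ltnS; case: xE => ->; rewrite ?leq_maxl ?leq_maxr.
apply/andP; split; last by apply: tN; left.
by rewrite -[leRHS]invrK lef_pV2 ?posrE ?invr_gt0//; apply: tN; right.
Qed.

Let measurable_G : measurable_fun [set: measurableTypeR R] G.
Proof.
apply: measurable_funM; first exact: measurable_powR.
by apply: measurableT_comp => //; exact: measurable_funN.
Qed.

Let G_ge0 s : (0 <= G s)%R.
Proof. by rewrite mulr_ge0 ?powR_ge0 ?expR_ge0. Qed.

(** With s = t^2 one has s^(n/2 - 1) ds = 2 t^(n-1) dt. The interval stays away from 0, where [G] is
    singular when n = 1. *)
Let substitution (x y : R) : (0 < x)%R -> (x <= y)%R ->
  \int[leb]_(s in `[(x ^+ 2)%R, (y ^+ 2)%R]) (G s)%:E =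
  \int[leb]_(t in `[x, y]) (2 * t ^+ n.-1 * expR (- t ^+ 2))%:E.
Proof.
move=> x0 xy.
have dF t : is_derive (t : R) 1%R (fun t : R => t ^+ 2)%R (2 * t)%R.
  have := @is_deriveX R R^o id 2 t 1%R 1%R (is_derive_id t 1%R).
  by rewrite exprfctE => H; apply: is_derive_eq; rewrite expr1; exact: mulr1.
have dFE : (fun t : R => t ^+ 2)%R^`()%classic = (fun t => 2 * t)%R.
  by apply/funext => t; rewrite derive1E; have [_ ->] := dF t.
have c2 : continuous (fun t : R => 2 * t)%R.
  by move=> t; apply: cvgM => //; exact: cvg_cst.
have cF : continuous (fun t : R => t ^+ 2)%R by exact: exprn_continuous.
rewrite (@integration_by_substitution_increasing _ (fun t : R => t ^+ 2)%R G)//.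
- rewrite dFE; apply: eq_integral => t; rewrite inE/= in_itv/= => /andP[xt _].
  have t0 := lt_le_trans x0 xt.
  have t1 : (t != 0)%R by rewrite gt_eqF.
  congr EFin; rewrite fctE/= /G mulrAC; congr (_ * _)%R.
  rewrite powRB ?(gt_eqF (exprn_gt0 2 t0)) ?implybT// powRr1 ?sqr_ge0//.
  have -> : ((t ^+ 2) `^ (n%:R / 2) = t ^+ n)%R.
    rewrite -[X in (X `^ _)%R](powR_mulrn 2 (ltW t0)) -powRrM mulrC mulfVK ?pnatr_eq0//.
    by rewrite powR_mulrn ?ltW.
  by rewrite -{1}(prednK n_gt0) exprS; field.
- move=> s t; rewrite !in_itv/= => /andP[xs _] /andP[xt _] st.
  by rewrite ltr_pXn2r// nnegrE ltW// (lt_le_trans x0).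
- by rewrite dFE => t _; exact: c2.
- by rewrite dFE; apply: cvgP; apply: cvg_at_right_filter; exact: c2.
- by rewrite dFE; apply: cvgP; apply: cvg_at_left_filter; exact: c2.
- split.
  + by move=> t _; have [] := dF t.
  + by apply: cvg_at_right_filter; exact: cF.
  + by apply: cvg_at_left_filter; exact: cF.
apply: continuous_in_subspaceT => s; rewrite inE/= in_itv/= => /andP[xs _].
have s0 : (0 < s)%R by rewrite (lt_le_trans _ xs)// exprn_gt0.
have cp : {for s, continuous (fun s : R => s `^ (n%:R / 2 - 1))%R}.
  apply: differentiable_continuous; apply/derivable1_diffP; apply: derivable_powR.
  by rewrite in_itv/= s0.
apply: cvgM; first exact: cp.
by apply: (continuous_comp (f := -%R)); [exact: opp_continuous|exact: continuous_expR].
Qed.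

(** The substitution s = t^2 on each compact interval of the exhaustion, followed by monotone
    convergence on both sides. *)
Lemma integral_radial_gauss :
  \int[leb]_t ((k t)%:E * (expR (- t ^+ 2))%:E) =
  (n%:R / 2)%:E * \int[leb]_(s in `]0%R, +oo[) (G s)%:E.
Proof.
have mH : measurable_fun [set: measurableTypeR R]
    (fun t : R => (n%:R / 2) * (2 * t ^+ n.-1 * expR (- t ^+ 2)))%R.
  apply: measurable_funM => //; apply: measurable_funM.
    by apply: measurable_funM => //; exact: measurable_funX.
  by apply: measurableT_comp => //; apply: measurable_funN; exact: measurable_funX.
have H0 (t : R) : (0 < t)%R -> (0 <= 2 * t ^+ n.-1 * expR (- t ^+ 2))%R.
  by move=> t0; rewrite mulr_ge0 ?expR_ge0// mulr_ge0// exprn_ge0// ltW.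
have nd (r : nat -> R) : (forall i, 0 < r i)%R -> {homo r : i j / (i <= j)%N >-> (i <= j)%R} ->
    nondecreasing_seq (fun i => `[(r i)^-1%R, r i]%classic).
  move=> r0 rnd i j ij; apply/subsetPset; apply: subset_itv; rewrite bnd_simp ?rnd//.
  by rewrite lef_pV2 ?posrE// rnd.
pose r1 i : R := i.+1%:R; pose r2 i : R := (i.+1%:R ^+ 2)%R.
have r10 i : (0 < r1 i)%R by rewrite ltr0n.
have r20 i : (0 < r2 i)%R by rewrite exprn_gt0// ltr0n.
have r1nd : {homo r1 : i j / (i <= j)%N >-> (i <= j)%R} by move=> i j ij; rewrite ler_nat ltnS.
have r2nd : {homo r2 : i j / (i <= j)%N >-> (i <= j)%R}.
  by move=> i j ij; rewrite ler_sqr ?nnegrE// ler_nat ltnS.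
have cG := @ge0_nondecreasing_set_cvg_integral _ (measurableTypeR R) R _ (EFin \o G) leb
  (nd _ r20 r2nd) (fun i => measurable_itv _).
have cH := @ge0_nondecreasing_set_cvg_integral _ (measurableTypeR R) R _
  (fun t : R => ((n%:R / 2) * (2 * t ^+ n.-1 * expR (- t ^+ 2)))%:E)%R leb
  (nd _ r10 r1nd) (fun i => measurable_itv _).
transitivity (\int[leb]_(t in `]0%R, +oo[)
    ((n%:R / 2) * (2 * t ^+ n.-1 * expR (- t ^+ 2)))%:E).
  rewrite [RHS]integral_mkcond; apply: eq_integral => t _.
  rewrite patchE radial_weightE -EFinM; case: ltP => t0; last first.
    by rewrite memNset ?mul0r//= in_itv/= ltNge t0.
  by rewrite mem_set/= ?in_itv/= ?t0//; congr EFin; field.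
rewrite -[in LHS](bigcup_itv (r := r1)); last by left.
rewrite -[in RHS](bigcup_itv (r := r2)); last by right.
apply: (cvg_unique _ (cH _ _)) => //.
- by move=> i; apply/measurable_EFinP; exact: measurable_funTS.
- move=> i t /=; rewrite in_itv/= => /andP[it _]; rewrite lee_fin mulr_ge0// H0//.
  by rewrite (lt_le_trans _ it)// invr_gt0.
rewrite (_ : (fun i => _) = (fun i => (n%:R / 2)%:E *
    \int[leb]_(x in `[(r2 i)^-1%R, r2 i]) (EFin \o G) x)); last first.
  apply/funext => i; rewrite /r2 -exprVn substitution; last 2 first.
  - by rewrite invr_gt0.
  - rewrite (@le_trans _ _ 1%R)//; last by rewrite ler1n.
    by rewrite invf_le1// ler1n.
  rewrite -ge0_integralZl//.
  + by apply/measurable_EFinP; apply: measurable_funTS; apply: measurable_funM;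
      [apply: measurable_funM => //; exact: measurable_funX|
       apply: measurableT_comp => //; apply: measurable_funN; exact: measurable_funX].
  + move=> t /=; rewrite in_itv/= => /andP[it _]; rewrite lee_fin H0//.
    by rewrite (lt_le_trans _ it)// invr_gt0.
apply: cvgeZl => //; apply: cG.
- by move=> i; apply/measurable_EFinP; exact: measurable_funTS.
- by move=> i t _; rewrite lee_fin.
Qed.

(** The Gaussian integral computed in two ways: by coordinates it is pi^(n/2), by radii it is |B|
    (n/2) Gamma(n/2). *)
Lemma ball_sphere_area :
  (n%:R)%:E * \int[mu]_y (b y)%:E = (sphere_area R n)%:E.
Proof.
have mg : measurable_fun [set: measurableTypeR R] (fun t : R => (expR (- t ^+ 2))%:E).
  apply/measurable_EFinP; apply: measurableT_comp => //; apply: measurable_funN.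
  exact: measurable_funX.
have := @radial_integral_ball R n n_gt0 _ mg (fun t => expR_ge0 _).
rewrite integral_gauss_rV integral_radial_gauss.
set V := \int[mu]_y (b y)%:E; set I := \int[leb]_(s in _) _ => E.
have V0 : 0 <= V by apply: integral_ge0 => y _; rewrite lee_fin ball_indic_ge0.
have I0 : 0 <= I by apply: integral_ge0 => y _; rewrite lee_fin.
have P0 : (0 < (Num.sqrt pi : R) ^+ n)%R by rewrite exprn_gt0// sqrtr_gt0 pi_gt0.
have n0 : (0 < n%:R / 2 :> R)%R by rewrite divr_gt0// ltr0n.
have GE : Gamma_fun (n%:R / 2) = fine I by [].
have pE : (pi `^ (n%:R / 2) = Num.sqrt pi ^+ n :> R)%R.
  by rewrite mulrC powRrM powR12_sqrt ?pi_ge0// powR_mulrn ?sqrtr_ge0.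
rewrite /sphere_area GE pE {GE}.
have PE0 : ((Num.sqrt pi : R) ^+ n != 0)%R by rewrite gt_eqF.
(* [Gamma_fun] is the [fine] part of [I], so [I] must be shown finite before the equation can be
   solved. An infinite factor is excluded because the product of [V] and [I] is finite and nonzero;
   the same argument settles [V]. *)
case: I I0 E => [i||//] I0 E; last first.
  move: E; rewrite gt0_muley ?lte_fin//.
  have [->|V1] := eqVneq V 0; first by rewrite mul0e => -[/eqP]; rewrite (negPf PE0).
  by rewrite gt0_muley// lt0e V1.
case: V V0 E => [v||//] V0 E; last first.
  move: E; rewrite -EFinM; have [->|i1] := eqVneq i 0%R.
    by rewrite mulr0 mule0 => -[/eqP]; rewrite (negPf PE0).
  by rewrite gt0_mulye// lte_fin mulr_gt0// lt_def i1 -lee_fin.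
move: E; rewrite -!EFinM => -[E]; congr EFin; rewrite E /=.
have i1 : (i != 0)%R.
  by apply: contraNneq PE0 => i0; rewrite E i0 !mulr0.
by field.
Qed.

Lemma integral_radial_rV (g : measurableTypeR R -> \bar R) :
  measurable_fun setT g -> (forall t, 0 <= g t) ->
  \int[mu]_h g (enorm h) =
  (sphere_area R n)%:E * \int[leb]_(t in `]0%R, +oo[) ((t ^+ n.-1)%:E * g t).
Proof.
move=> mg g0; rewrite radial_integral_ball// -ball_sphere_area.
rewrite [in RHS](muleC n%:R%:E) -[RHS]muleA; congr (_ * _).
have mf : measurable_fun (`]0%R, +oo[%classic : set (measurableTypeR R))
    (fun t : measurableTypeR R => (t ^+ n.-1)%:E * g t).
  apply: measurable_funTS; apply: emeasurable_funM => //.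
  by apply/measurable_EFinP; exact: measurable_funX.
have f0 (t : R) : (`]0%R, +oo[%classic : set (measurableTypeR R)) t -> 0 <= (t ^+ n.-1)%:E * g t.
  by rewrite /= in_itv/= andbT => t0; rewrite mule_ge0// lee_fin exprn_ge0// ltW.
rewrite -ge0_integralZl//.
rewrite [RHS]integral_mkcond; apply: eq_integral => t _.
rewrite patchE radial_weightE; case: ltP => t0; last first.
  by rewrite memNset ?mul0e//= in_itv/= ltNge t0.
by rewrite mem_set/= ?in_itv/= ?t0// EFinM muleA.
Qed.

End sphere.

Section open_measurable_rV.
Context (R : realType) (n : nat).

(** An open set is the union of the countably many cubes with rational centre and radius 1/(k+1)
    that it contains. *)
Lemma open_measurable_rV (A : set 'rV[R]_n) : open A -> measurable A.
Proof.
move=> oA.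
pose box (q : 'rV[rat]_n) (k : nat) : set 'rV[R]_n :=
  [set y | forall i, `|ratr (q ord0 i) - y ord0 i| < k.+1%:R^-1].
have mbox q k : measurable (box q k).
  rewrite (_ : box q k = \big[setI/setT]_(i < n)
      [set y : 'rV[R]_n | `|ratr (q ord0 i) - y ord0 i| < k.+1%:R^-1]).
    apply: bigsetI_measurable => i _; apply: measurable_set_lt => //.
    apply: measurableT_comp => //; apply: measurable_funB => //.
    exact: measurable_rV_coord.
  apply/seteqP; split => y /=.
    by move=> yB; rewrite -bigcap_seq => i _ /=; exact: yB.
  by rewrite -bigcap_seq => yB i; have := yB i (mem_index_enum i).
pose D : set ('rV[rat]_n * nat) := [set p | box p.1 p.2 `<=` A].
rewrite (_ : A = \bigcup_(p in D) box p.1 p.2).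
  rewrite bigcup_mkcond; apply: countable_bigcupT_measurable => // p.
  by case: ifP => _; [exact: mbox|exact: measurable0].
apply/seteqP; split => [x Ax|x [p Dp]]; last exact: Dp.
have [e /= e0 eA] : nbhs_ball x A by apply/nbhs_ballP; exact: open_nbhs_nbhs.
(* Radius below e/2: a cube whose centre lies within this radius of x then stays inside the ball of
   radius e around x. *)
have [k ke] : exists k : nat, k.+1%:R^-1 < e / 2.
  exists (Num.truncn (e / 2)^-1); rewrite -[ltRHS]invrK ltf_pV2 ?posrE ?invr_gt0 ?divr_gt0//.
  exact: truncnS_gt.
have q_ex (i : 'I_n) : exists q : rat, `|ratr q - x ord0 i| < k.+1%:R^-1 :> R.
  have [q] := @rat_in_itvoo R (x ord0 i - k.+1%:R^-1) (x ord0 i + k.+1%:R^-1)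
    ltac:(by rewrite ltrD2l gtrN// invr_gt0).
  by rewrite in_itv/= -ltr_distl => qx; exists q.
pose q : 'rV[rat]_n := \row_i projT1 (cid (q_ex i)).
have qx i : `|ratr (q ord0 i) - x ord0 i| < k.+1%:R^-1.
  by rewrite mxE; case: cid.
exists (q, k) => //= y yB; apply: eA; split=> // i j; rewrite ord1.
rewrite -ball_normE/=.
rewrite (le_lt_trans (ler_distD (ratr (q ord0 j)) _ _))// [e]splitr ltrD//.
  by rewrite distrC (lt_trans (qx j)).
by rewrite (lt_trans (yB j)).
Qed.

Lemma continuous_measurable_rV (f : 'rV[R]_n -> R) :
  continuous f -> measurable_fun setT f.
Proof.
move=> /continuousP cf; apply: (measurability _ (RGenOpens.measurableE R)).
move=> _ [_ [a [b ->] <-]]; rewrite setTI; apply: open_measurable_rV.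
by apply: cf; exact: interval_open.
Qed.

End open_measurable_rV.

Section signed_polar.
Context (R : realType) (n : nat).
Hypothesis n_gt0 : (0 < n)%N.
Notation mu := (lebesgue_rV R n).
Notation leb := (@lebesgue_measure R).
Local Open Scope ereal_scope.
Notation b := (@ball_indic R n).
Notation k := (@radial_weight R n).

Let G (F : 'rV[R]_n -> \bar R) (p : 'rV[R]_n * measurableTypeR R) :=
  (b p.1 * k p.2)%:E * F (p.2 *: sphere_proj p.1)%R.

Let measurable_G F : measurable_fun setT F -> measurable_fun setT (G F).
Proof.
move=> mF; apply: emeasurable_funM.
  by apply/measurable_EFinP; apply: measurable_funM;
    [exact: (measurableT_comp (@measurable_ball_indic R n))|
     exact: (measurableT_comp (@measurable_radial_weight R n))].
apply: (measurableT_comp mF); apply: measurable_rV_scale => //.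
exact: (measurableT_comp (@measurable_sphere_proj R n)).
Qed.

Let bk_ge0 y t : (0 <= b y * k t)%R.
Proof. by apply: mulr_ge0; [exact: ball_indic_ge0|exact: radial_weight_ge0]. Qed.

Let G_ge0 F : (forall x, 0 <= F x) -> forall p, 0 <= G F p.
Proof. by move=> F0 p; rewrite mule_ge0// lee_fin. Qed.

Let integral_G F : measurable_fun setT F -> (forall x, 0 <= F x) ->
  \int[mu \x leb]_p G F p = \int[mu]_h F h.
Proof.
move=> mF F0; rewrite polar_integral// fubini_tonelli1//; first exact: measurable_G.
exact: G_ge0.
Qed.

Variable F : 'rV[R]_n -> \bar R.
Hypothesis iF : mu.-integrable setT F.

Let mF : measurable_fun setT F. Proof. exact: measurable_int iF. Qed.

Let integrable_G : (mu \x leb).-integrable setT (G F).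
Proof.
apply/integrableP; split; first exact: measurable_G.
rewrite (eq_integral (G (abse \o F))).
  rewrite integral_G; [|exact: measurableT_comp|by move=> x; exact: abse_ge0].
  by have /integrableP[] := iF.
by move=> p _; rewrite /G abseM gee0_abs// lee_fin.
Qed.

(** The nonnegative formula applied to the positive and negative parts; the density is nonnegative
    and so passes through both. *)
Let signed_integral_G : \int[mu \x leb]_p G F p = \int[mu]_h F h.
Proof.
rewrite integralE [RHS]integralE.
rewrite -(integral_G (measurable_funepos mF) (funepos_ge0 F)).
rewrite -(integral_G (measurable_funeneg mF) (funeneg_ge0 F)).
congr (_ - _); apply: eq_integral => p _; rewrite /G.
  by rewrite !funeposE [RHS]maxe_pMr ?mule0// lee_fin.
by rewrite !funenegE [RHS]maxe_pMr ?mule0 ?muleN// lee_fin.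
Qed.

(** It suffices to bound the integral along each ray: integrating the bound n M over the unit ball
    of directions gives n |B| M, the surface area times M. *)
Lemma polar_integral_bound (M : R) :
  (forall s, enorm s = 1%R ->
    `|\int[leb]_t ((k t)%:E * F (t *: s)%R)| <= (n%:R * M)%:E) ->
  `|\int[mu]_h F h| <= (sphere_area R n * M)%:E.
Proof.
move=> FM; rewrite -signed_integral_G -integral12_prod_meas1//.
apply: le_trans (le_abse_integral _ _ _) _ => //.
  exact: (measurable_fubini_F integrable_G).
rewrite EFinM -ball_sphere_area// [n%:R%:E * _]muleC -muleA -EFinM.
(* The sign of [M] is not assumed; it follows from the hypothesis at one unit vector, which exists
   because [n > 0]. *)
have nM0 : 0 <= (n%:R * M)%:E.
  have [s s1] : exists s : 'rV[R]_n, enorm s = 1%R.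
    exists (sphere_proj (const_mx 1%R)); apply: enorm_sphere_proj.
    apply/eqP => /matrixP /(_ ord0 (Ordinal n_gt0)); rewrite !mxE.
    exact/eqP/oner_neq0.
  exact: le_trans (abse_ge0 _) (FM s s1).
rewrite -ge0_integralZr//; last 2 first.
- by apply/measurable_EFinP; exact: measurable_ball_indic.
- by move=> y _; rewrite lee_fin ball_indic_ge0.
apply: ae_ge0_le_integral => //.
- by apply: measurableT_comp => //; exact: (measurable_fubini_F integrable_G).
- by move=> y _; rewrite mule_ge0// lee_fin ball_indic_ge0.
- apply: emeasurable_funM => //.
  by apply/measurable_EFinP; exact: measurable_ball_indic.
exists [set 0%R]; split; [exact: measurable_rV_set0|exact: lebesgue_rV_set0|].
move=> y /= H; apply: contrapT => /eqP y0; apply: H => _.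
rewrite /fubini_F /G/= ball_indicE; case: (leP (enorm y) 1%R) => y1.
  under eq_integral do rewrite mul1r.
  by rewrite mul1e; apply: FM; exact: enorm_sphere_proj.
by rewrite mul0e integral0_eq ?abse0// => t _; rewrite mul0r mul0e.
Qed.

End signed_polar.

(** * Square-integrable functions *)

(** Evaluation at the vertex t = B / C. Both Cauchy-Schwarz inequalities, for finite sums and for
    L^2, rest on it. *)
Lemma quadratic_ge0_discr (R : realFieldType) (A B C : R) : 0 <= C ->
  (forall t, 0 <= A - 2 * t * B + t ^+ 2 * C) -> B ^+ 2 <= A * C.
Proof.
rewrite le_eqVlt => /orP[/eqP C0|C0] P.
  have [->|B0] := eqVneq B 0; first by rewrite -C0 expr0n mulr0.
  (* With C = 0 and B nonzero, this t makes the polynomial equal to -1. *)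
  have := P ((A + 1) / (2 * B)).
  rewrite -C0 mulr0 addr0 mulrAC mulrCA mulfV ?mulr1; last by rewrite mulf_neq0// pnatr_eq0.
  lra.
have : 0 <= (A - 2 * (B / C) * B + (B / C) ^+ 2 * C) * C by rewrite mulr_ge0// ltW.
have -> : (A - 2 * (B / C) * B + (B / C) ^+ 2 * C) * C = A * C - B ^+ 2.
  by field; rewrite gt_eqF.
by rewrite subr_ge0.
Qed.

Lemma sum_cauchy_schwarz (R : realFieldType) (I : Type) (s : seq I) (a b : I -> R) :
  (\sum_(i <- s) a i * b i) ^+ 2 <= (\sum_(i <- s) a i ^+ 2) * (\sum_(i <- s) b i ^+ 2).
Proof.
apply: quadratic_ge0_discr => [|t]; first by apply: sumr_ge0 => i _; exact: sqr_ge0.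
rewrite !mulr_sumr -sumrN -!big_split/=; apply: sumr_ge0 => i _.
by have -> : a i ^+ 2 - 2 * t * (a i * b i) + t ^+ 2 * b i ^+ 2 = (a i - t * b i) ^+ 2;
  [ring|exact: sqr_ge0].
Qed.

Section L2_inner_product.
Context d (T : measurableType d) (R : realType) (mu : {measure set T -> \bar R}).
Implicit Types (f g h : T -> R) (a : R).
Notation L2 f := (f \in Lfun mu 2%:E).

(** A real integral: an infinite value is read as 0, so the linearity rules below carry L^2
    hypotheses. *)
Definition ip f g : R := \int[mu]_x (f x * g x).
Definition n2 f : R := Num.sqrt (ip f f).

Let one_le2 : (1 <= 2%:E :> \bar R)%E. Proof. by rewrite lee_fin ler1n. Qed.

Let sqr_norm_powR f x : (`|(f x)%:E| `^ 2)%E = (f x ^+ 2)%:E.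
Proof. by rewrite poweR_EFin powR_mulrn// real_normK// num_real. Qed.

Let Lnorm2E f : ('N[mu]_2%:E[EFin \o f] = (\int[mu]_x (f x ^+ 2)%:E) `^ 2^-1)%E.
Proof.
rewrite unlock /Lnorm; congr (_ `^ _)%E; apply: eq_integral => x _.
exact: sqr_norm_powR.
Qed.

Lemma L2P f : L2 f <-> measurable_fun setT f /\ (\int[mu]_x (f x ^+ 2)%:E < +oo)%E.
Proof.
have I0 : (0 <= \int[mu]_x (f x ^+ 2)%:E)%E.
  by apply: integral_ge0 => x _; rewrite lee_fin sqr_ge0.
split.
  move=> /[dup] /sub_Lfun_mfun; rewrite inE /= => mf.
  move=> /Lfun2_integrable_sqr /integrableP[_]; split=> //.
  apply: le_lt_trans b; rewrite le_eqVlt; apply/orP; left; apply/eqP.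
  by apply: eq_integral => x _; rewrite gee0_abs ?lee_fin ?sqr_ge0.
move=> [mf foo]; rewrite inE; apply/andP; split; rewrite inE//=.
by rewrite /finite_norm Lnorm2E poweR_lty.
Qed.

Lemma L2_measurable f : L2 f -> measurable_fun setT f.
Proof. by case/L2P. Qed.

Lemma L2D f g : L2 f -> L2 g -> L2 (fun x => f x + g x).
Proof. by move=> f2 g2; have := (Lfun_addr_closed mu one_le2).2 f g f2 g2. Qed.

Lemma L2Z a f : L2 f -> L2 (fun x => a * f x).
Proof.
move=> f2; have := @Lfun_scale _ _ _ mu f a 2 _ f2.
by under eq_fun do rewrite /= mulrC; apply; rewrite ler1n.
Qed.

Lemma L2N f : L2 f -> L2 (fun x => - f x).
Proof. by move=> /(L2Z (-1)); under eq_fun do rewrite mulN1r. Qed.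

Lemma L2B f g : L2 f -> L2 g -> L2 (fun x => f x - g x).
Proof. by move=> f2 /L2N; exact: L2D. Qed.

Lemma L2_integrable f g : L2 f -> L2 g ->
  mu.-integrable setT (EFin \o (fun x => f x * g x)).
Proof. by move=> f2 g2; apply/Lfun1_integrable; exact: Lfun2_mul_Lfun1. Qed.

Lemma ipC f g : ip f g = ip g f.
Proof. by apply: eq_Rintegral => x _; rewrite mulrC. Qed.

Lemma ipDl f g h : L2 f -> L2 g -> L2 h -> ip (fun x => f x + g x) h = ip f h + ip g h.
Proof.
move=> f2 g2 h2; rewrite -RintegralD//; [|exact: L2_integrable..].
by apply: eq_Rintegral => x _; rewrite mulrDl.
Qed.

Lemma ipZl a f h : L2 f -> L2 h -> ip (fun x => a * f x) h = a * ip f h.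
Proof.
move=> f2 h2; rewrite -RintegralZl//; last exact: L2_integrable.
by apply: eq_Rintegral => x _; rewrite mulrA.
Qed.

Lemma ipNl f h : L2 f -> L2 h -> ip (fun x => - f x) h = - ip f h.
Proof.
by move=> f2 h2; rewrite -mulN1r -ipZl//; congr ip; apply/funext => x; rewrite mulN1r.
Qed.

Lemma ipBl f g h : L2 f -> L2 g -> L2 h -> ip (fun x => f x - g x) h = ip f h - ip g h.
Proof. by move=> f2 g2 h2; rewrite ipDl ?ipNl//; exact: L2N. Qed.

Lemma ipDr f g h : L2 f -> L2 g -> L2 h -> ip h (fun x => f x + g x) = ip h f + ip h g.
Proof. by move=> *; rewrite ipC ipDl// ![ip _ h]ipC. Qed.

Lemma ipBr f g h : L2 f -> L2 g -> L2 h -> ip h (fun x => f x - g x) = ip h f - ip h g.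
Proof. by move=> *; rewrite ipC ipBl// ![ip _ h]ipC. Qed.

Lemma ipZr a f h : L2 f -> L2 h -> ip h (fun x => a * f x) = a * ip h f.
Proof. by move=> *; rewrite ipC ipZl// ipC. Qed.

Lemma ip_ge0 f : 0 <= ip f f.
Proof. by apply: Rintegral_ge0 => x _; rewrite -expr2 sqr_ge0. Qed.

Lemma n2_ge0 f : 0 <= n2 f.
Proof. exact: sqrtr_ge0. Qed.

Lemma sqr_n2 f : n2 f ^+ 2 = ip f f.
Proof. by rewrite sqr_sqrtr// ip_ge0. Qed.

Lemma sqr_n2E f : L2 f -> ((n2 f ^+ 2)%:E = \int[mu]_x (f x ^+ 2)%:E)%E.
Proof.
move=> f2; rewrite sqr_n2 /ip /Rintegral fineK; last first.
  by apply: integrable_fin_num => //; exact: L2_integrable.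
by apply: eq_integral => x _; rewrite expr2.
Qed.

Lemma cauchy_schwarz f g : L2 f -> L2 g -> `|ip f g| <= n2 f * n2 g.
Proof.
move=> f2 g2.
have P (t : R) : 0 <= n2 f ^+ 2 - 2 * t * ip f g + t ^+ 2 * n2 g ^+ 2.
  have tg2 : L2 (fun x => t * g x) by exact: L2Z.
  have := ip_ge0 (fun x => f x - t * g x).
  rewrite ipBl ?ipBr ?ipZl ?ipZr//; try exact: L2B.
  by rewrite (ipC g) -!sqr_n2 => H; apply: (le_trans H); lra.
rewrite -ler_sqr ?nnegrE ?mulr_ge0 ?n2_ge0// real_normK ?num_real// exprMn.
by apply: quadratic_ge0_discr => //; exact: sqr_ge0.
Qed.

Lemma n2Z a f : L2 f -> n2 (fun x => a * f x) = `|a| * n2 f.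
Proof.
move=> f2; rewrite /n2 ipZl ?ipZr//; last exact: L2Z.
by rewrite mulrA -expr2 sqrtrM ?sqr_ge0// sqrtr_sqr.
Qed.

Lemma n2N f : n2 (fun x => - f x) = n2 f.
Proof. by congr Num.sqrt; apply: eq_Rintegral => x _; rewrite mulrNN. Qed.

Lemma n2D f g : L2 f -> L2 g -> n2 (fun x => f x + g x) <= n2 f + n2 g.
Proof.
move=> f2 g2; rewrite -ler_sqr ?nnegrE ?addr_ge0 ?n2_ge0// sqr_n2.
have := cauchy_schwarz f2 g2; have := ler_norm (ip f g).
rewrite ipDl ?ipDr//; try exact: L2D.
rewrite (ipC g) -!sqr_n2; nra.
Qed.

Lemma n2B f g : L2 f -> L2 g -> n2 (fun x => f x - g x) <= n2 f + n2 g.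
Proof. by move=> f2 g2; rewrite -(n2N g); apply: n2D => //; exact: L2N. Qed.

(** Valid for every [f]: if the integral of the square is infinite, both sides are 0. *)
Lemma n2_Lnorm f : fine ('N[mu]_2%:E[EFin \o f])%E = n2 f.
Proof.
rewrite Lnorm2E /n2 /ip /Rintegral.
under [in RHS]eq_integral do rewrite -expr2.
have : (0 <= \int[mu]_x (f x ^+ 2)%:E)%E.
  by apply: integral_ge0 => x _; rewrite lee_fin sqr_ge0.
case: (\int[mu]_x _)%E => [r r0|_|//]; first by rewrite poweR_EFin/= powR12_sqrt.
by rewrite poweRyr ?invr_eq0//= sqrtr0.
Qed.

Lemma ip_ae_eql f g h : L2 f -> L2 g -> L2 h ->
  {ae mu, forall x, f x = g x} -> ip f h = ip g h.
Proof.
move=> f2 g2 h2 fg; congr fine; apply: ae_eq_integral => //.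
- by case/integrableP: (L2_integrable f2 h2).
- by case/integrableP: (L2_integrable g2 h2).
by apply: filterS fg => x /= -> _.
Qed.

Lemma n2_ae_eq f g : L2 f -> L2 g -> {ae mu, forall x, f x = g x} -> n2 f = n2 g.
Proof. by move=> f2 g2 fg; rewrite /n2 (ip_ae_eql f2 g2 f2 fg) ipC (ip_ae_eql f2 g2 g2 fg). Qed.

End L2_inner_product.

(** * Translates of C^1 and H^1_0 functions *)

Lemma cvg_bigsum (R : realType) (I T : Type) (F : set_system T) (FF : Filter F)
    (s : seq I) (f : I -> T -> R) (l : I -> R) :
  (forall i, f i x @[x --> F] --> l i) ->
  (\sum_(i <- s) f i x) @[x --> F] --> \sum_(i <- s) l i.
Proof.
move=> fl; elim: s => [|i s IH].
  by rewrite big_nil; under eq_fun do rewrite big_nil; exact: cvg_cst.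
by rewrite big_cons; under eq_fun do rewrite big_cons; exact: cvgD.
Qed.

Section directional_derivative.
Context (R : realType) (n : nat).
Implicit Types (phi : 'rV[R]_n -> R) (x y e h : 'rV[R]_n).

(** The two difference quotients are the same function of the increment. *)
Lemma is_derive_line phi y e (t L : R) :
  is_derive (y + t *: e) e phi L <-> is_derive t 1 (fun s : R => phi (y + s *: e)) L.
Proof.
have E : (fun r : R => r^-1 *: ((phi \o shift (y + t *: e)) (r *: e) - phi (y + t *: e))) =
    (fun r : R => r^-1 *: (((fun s : R => phi (y + s *: e)) \o shift t) (r *: 1) -
      phi (y + t *: e))).
  apply/funext => r /=; congr (_ *: (phi _ - _)).
  by rewrite addrCA; congr (_ + _); rewrite scalerDl [r *: 1]mulr1.
split=> -[D1 D2]; split.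
- by move: D1; rewrite /derivable E.
- by move: D2; rewrite /derive E.
- by rewrite /derivable E.
- by rewrite /derive E.
Qed.

Lemma MVT_coord phi (i : 'I_n) y (s : R) :
  (forall x, derivable phi x (delta_mx ord0 i)) ->
  exists2 t : R, `|t| <= `|s| &
    phi (y + s *: delta_mx ord0 i) - phi y = s * partial_deriv i phi (y + t *: delta_mx ord0 i).
Proof.
move=> dphi; set e := delta_mx ord0 i.
have D (t : R) : is_derive t 1 (fun s : R => phi (y + s *: e)) (partial_deriv i phi (y + t *: e)).
  by apply/is_derive_line; exact: derivableP.
have C (a b : R) : {within `[a, b], continuous (fun s : R => phi (y + s *: e))}.
  apply: continuous_subspaceT => t; apply: differentiable_continuous.
  by apply/derivable1_diffP; have [] := D t.
have E0 : phi (y + 0 *: e) = phi y by rewrite scale0r addr0.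
have [s0|s0] := leP 0 s.
  have [t] := MVT_segment s0 (fun t _ => D t) (C _ _).
  rewrite in_itv/= => /andP[t0 ts]; rewrite E0 subr0 mulrC => H.
  by exists t => //; rewrite !ger0_norm.
have [t] := MVT_segment (ltW s0) (fun t _ => D t) (C _ _).
rewrite in_itv/= => /andP[ts t0]; rewrite E0 sub0r mulrN => H.
exists t; first by rewrite (ler0_norm t0) (ler0_norm (ltW s0)) lerN2.
by rewrite -[LHS]opprB H opprK mulrC.
Qed.

(** Only partial derivatives along the axes are given. The segment from x to x + r h is replaced by
    a path parallel to the axes, the mean value theorem is applied on each leg, and continuity of
    the partials at x gives the limit. *)
Lemma C1_is_derive phi :
  (forall i x, derivable phi x (delta_mx ord0 i)) ->
  (forall i, continuous (partial_deriv i phi)) ->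
  forall x h, is_derive x h phi (\sum_(i < n) h ord0 i * partial_deriv i phi x).
Proof.
move=> dphi cphi x h.
(* [tr m] keeps the first m coordinates of h, so that [z m r] are the corners of the path from x to
   x + r h. *)
pose tr (m : nat) : 'rV[R]_n := \row_(i < n) (if (i < m)%N then h ord0 i else 0).
pose z m (r : R) : 'rV[R]_n := x + r *: tr m.
have trS (m : 'I_n) : tr m.+1 = tr m + h ord0 m *: delta_mx ord0 m.
  apply/matrixP => i j; rewrite !mxE !ord1 eqxx/= ltnS leq_eqVlt.
  have [->|jm] := eqVneq j m; first by rewrite eqxx ltnn mulr1 add0r.
  rewrite (_ : (j == m :> nat) = false); first by rewrite mulr0 addr0.
  exact: negbTE.
have tr0 : tr 0%N = 0 by apply/matrixP => i j; rewrite !mxE ltn0.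
have trn : tr n = h by apply/matrixP => i j; rewrite !mxE !ord1 ltn_ord.
have zS (m : 'I_n) r : z m.+1 r = z m r + (r * h ord0 m) *: delta_mx ord0 m.
  by rewrite /z trS scalerDr scalerA addrA.
suff H : (fun r : R => r^-1 *: ((phi \o shift x) (r *: h) - phi x)) @ 0^' -->
    \sum_(i < n) h ord0 i * partial_deriv i phi x.
  by split; [apply/cvg_ex; eexists; exact: H|apply: cvg_lim => //; exact: H].
have -> : (fun r : R => r^-1 *: ((phi \o shift x) (r *: h) - phi x)) =
    (fun r : R => \sum_(m < n) r^-1 * (phi (z m.+1 r) - phi (z m r))).
  apply/funext => r; rewrite -mulr_sumr /=; congr (_ * _).
  rewrite -(big_mkord xpredT (fun m => phi (z m.+1 r) - phi (z m r))) telescope_sumr//.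
  by rewrite /z trn tr0 scaler0 addr0 [x + _]addrC.
apply: cvg_bigsum => m.
(* The intermediate points of one leg are chosen as a function of r, and they tend to x since
   [|t r| <= |r * h ord0 m|]. *)
have /choice[t Ht] : forall r, exists t : R, `|t| <= `|r * h ord0 m| /\
    phi (z m.+1 r) - phi (z m r) =
    r * h ord0 m * partial_deriv m phi (z m r + t *: delta_mx ord0 m).
  by move=> r; have [t t1 t2] := MVT_coord (z m r) (r * h ord0 m) (dphi m); exists t; rewrite zS.
have id0 : (r : R) @[r --> 0^'] --> (0 : R) by exact: cvg_within.
have rh0 : `|r * h ord0 m| @[r --> 0^'] --> (0 : R).
  have : `|r * h ord0 m| @[r --> 0^'] --> `|0 * h ord0 m : R|.
    by apply: cvg_norm; apply: cvgM => //; exact: cvg_cst.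
  by rewrite mul0r normr0.
have t_cvg : t r @[r --> 0^'] --> (0 : R).
  apply: (@squeeze_cvgr _ _ _ _ (fun r => - `|r * h ord0 m|) (fun r => `|r * h ord0 m|)) => //.
  - by near=> r; rewrite -ler_norml; have [] := Ht r.
  - by rewrite -[X in _ --> X]oppr0; exact: cvgN.
apply: (@cvg_trans _ ((fun r => h ord0 m *
    partial_deriv m phi (z m r + t r *: delta_mx ord0 m)) @ 0^')).
  apply: near_eq_cvg; near=> r.
  have r0 : r != 0 by near: r; exact: nbhs_dnbhs_neq.
  by rewrite (Ht r).2 mulrA mulKf// mulrA.
have zx : z m r + t r *: delta_mx ord0 m @[r --> 0^'] --> x.
  have : z m r + t r *: (delta_mx ord0 m : 'rV[R]_n) @[r --> 0^'] -->
      x + (0 : R) *: tr m + (0 : R) *: (delta_mx ord0 m : 'rV[R]_n).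
    apply: cvgD; last exact: cvgZr_tmp.
    by apply: cvgD; [exact: cvg_cst|exact: cvgZr_tmp].
  by rewrite !scale0r !addr0.
by apply: cvgM; [exact: cvg_cst|exact: (cvg_comp _ _ zx (cphi m x))].
Unshelve. all: by end_near. Qed.

End directional_derivative.

Section L2_rV.
Context (R : realType) (n : nat).
Notation mu := (lebesgue_rV R n).
Notation leb := (@lebesgue_measure R).
Notation L2 f := (f \in Lfun mu 2%:E).
Implicit Types (f g : 'rV[R]_n -> R) (h : 'rV[R]_n).

Lemma integral_rV_shift h (f : 'rV[R]_n -> \bar R) : measurable_fun setT f ->
  (\int[mu]_x f (x + h)%R = \int[mu]_x f x)%E.
Proof.
move=> mf; rewrite integralE [RHS]integralE.
rewrite -(ge0_integral_rV_shift h (measurable_funepos mf) (funepos_ge0 f)).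
rewrite -(ge0_integral_rV_shift h (measurable_funeneg mf) (funeneg_ge0 f)).
by congr (_ - _)%E; apply: eq_integral => x _; rewrite ?funeposE ?funenegE.
Qed.

Lemma L2_shift h f : L2 f -> L2 (fun x => f (x + h)).
Proof.
move=> /L2P[mf foo]; apply/L2P; split.
  by apply: (measurableT_comp mf); exact: measurable_rV_shift.
rewrite (integral_rV_shift h (f := fun x => (f x ^+ 2)%:E))//.
by apply/measurable_EFinP; exact: measurable_funX.
Qed.

Lemma ip_shift h f g : L2 f -> L2 g ->
  ip mu (fun x => f (x + h)) (fun x => g (x + h)) = ip mu f g.
Proof.
move=> /L2_measurable mf /L2_measurable mg; congr fine.
rewrite (integral_rV_shift h (f := fun x => (f x * g x)%:E))//.
by apply/measurable_EFinP; exact: measurable_funM.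
Qed.

Lemma n2_shift h f : L2 f -> n2 mu (fun x => f (x + h)) = n2 mu f.
Proof. by move=> f2; rewrite /n2 ip_shift. Qed.

(** Cauchy-Schwarz against the indicator of [0, 1], which has norm 1. The integral is over the whole
    line, with the indicator inside, so that Tonelli applies without a domain. *)
Let segment_sqr_le (G : R -> R) (phi : R -> R) :
  continuous G -> (forall t : R, is_derive t 1 phi (G t)) ->
  (((phi 1 - phi 0) ^+ 2)%:E <= \int[leb]_t (\1_(`[0, 1]%classic) t * G t ^+ 2)%:E)%E.
Proof.
move=> cG dphi.
have mG : measurable_fun [set: measurableTypeR R] G by exact: continuous_measurable_fun.
have mI : measurable (`[0, 1]%classic : set (measurableTypeR R)) by exact: measurable_itv.
have m1 : measurable_fun [set: measurableTypeR R] (\1_(`[0, 1]%classic) : R -> R).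
  exact: measurable_indic.
pose I (t : measurableTypeR R) : R := \1_(`[0, 1]%classic) t.
pose G1 (t : measurableTypeR R) : R := I t * G t.
have II t : I t * I t = I t by rewrite /I indicE; case: (_ \in _); rewrite ?mulr1 ?mulr0.
have I2 : I \in Lfun leb 2%:E.
  apply/L2P; split=> //; under eq_integral do rewrite expr2 II.
  by rewrite integral_indic//= setIT lebesgue_measure_itv/= lte01 oppr0 adde0 ltry.
have G1E t : G1 t ^+ 2 = I t * G t ^+ 2 by rewrite exprMn expr2 II.
have patchI (f : R -> R) t : ((EFin \o f) \_ `[0, 1]) t = (I t * f t)%:E.
  by rewrite patchE /I indicE; case: (_ \in _); rewrite ?mul1r ?mul0r.
have G12 : G1 \in Lfun leb 2%:E.
  apply/L2P; split; first exact: measurable_funM.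
  under eq_integral do rewrite G1E -(patchI (fun t => G t ^+ 2)).
  rewrite -integral_mkcond; apply: integrable_lty => //.
  apply: continuous_compact_integrable; first exact: segment_compact.
  by apply: continuous_subspaceT => t; exact: (cvg_comp _ _ (cG t) (@exprn_continuous _ 2 _)).
have ipE : ip leb G1 I = phi 1 - phi 0.
  rewrite /ip /Rintegral.
  have -> : (\int[leb]_t (G1 t * I t)%:E = (phi 1)%:E - (phi 0)%:E)%E.
    rewrite -(continuous_FTC2 ltr01 (continuous_subspaceT cG)).
    - rewrite [RHS]integral_mkcond; apply: eq_integral => t _.
      by rewrite (patchI G) /G1 mulrAC II.
    - have cphi t : {for t, continuous phi}.
        by apply: differentiable_continuous; apply/derivable1_diffP; have [] := dphi t.
      split; first by move=> t _; have [] := dphi t.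
      + exact: cvg_at_right_filter (cphi _).
      + exact: cvg_at_left_filter (cphi _).
    - by move=> t _; rewrite derive1E; have [_ ->] := dphi t.
  by [].
have n2I : n2 leb I = 1.
  apply/eqP; rewrite -(@eqrXn2 _ 2)// ?n2_ge0// expr1n -eqe sqr_n2E//.
  under eq_integral do rewrite expr2 II.
  by rewrite integral_indic//= setIT lebesgue_measure_itv/= lte01 oppr0 adde0.
under eq_integral do rewrite -G1E.
rewrite -sqr_n2E// lee_fin -ipE -ler_sqrt ?sqr_ge0// sqrtr_sqr.
by rewrite sqrtr_sqr (ger0_norm (n2_ge0 _ _)) -[leRHS]mulr1 -n2I cauchy_schwarz.
Qed.

(** Along the segment, |phi(x + h) - phi(x)|^2 is at most |h|^2 times the integral over t in [0, 1]
    of |grad phi|^2 at x + t h. Integrating in x and exchanging, translation invariance removes t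
    h. *)
Lemma C1_shift_le (phi : 'rV[R]_n -> R) h :
  (forall i x, derivable phi x (delta_mx ord0 i)) ->
  (forall i, continuous (partial_deriv i phi)) ->
  L2 phi -> (forall i, L2 (partial_deriv i phi)) ->
  n2 mu (fun x => phi (x + h) - phi x) ^+ 2 <=
    enorm h ^+ 2 * \sum_(i < n) n2 mu (partial_deriv i phi) ^+ 2.
Proof.
move=> dphi cphi phi2 pphi2.
pose P (x : 'rV[R]_n) := \sum_(i < n) partial_deriv i phi x ^+ 2.
have P0 x : 0 <= P x by apply: sumr_ge0 => i _; exact: sqr_ge0.
have mp i : measurable_fun setT (partial_deriv i phi) by exact: L2_measurable (pphi2 i).
have mP : measurable_fun setT P by apply: measurable_sum => i; exact: measurable_funX.
have PE : (\int[mu]_x (P x)%:E = (\sum_(i < n) n2 mu (partial_deriv i phi) ^+ 2)%:E)%E.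
  under eq_integral do rewrite -sumEFin.
  rewrite ge0_integral_sum//.
  - by rewrite -sumEFin; apply: eq_bigr => i _; rewrite sqr_n2E.
  - by move=> i; apply/measurable_EFinP; exact: measurable_funX.
  - by move=> i x _; rewrite lee_fin sqr_ge0.
have m1 : measurable_fun [set: measurableTypeR R] (\1_(`[0, 1]%classic) : R -> R).
  by apply: measurable_indic; exact: measurable_itv.
pose H (p : 'rV[R]_n * measurableTypeR R) : \bar R :=
  (\1_(`[0, 1]%classic) p.2 * (enorm h ^+ 2 * P (p.1 + p.2 *: h)))%:E.
have H0 p : (0 <= H p)%E by rewrite lee_fin mulr_ge0// mulr_ge0// sqr_ge0.
have mH : measurable_fun setT H.
  apply/measurable_EFinP; apply: measurable_funM; first exact: (measurableT_comp m1).
  apply: measurable_funM => //; apply: (measurableT_comp mP).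
  by apply: measurable_rV_add => //; exact: measurable_rV_scale.
rewrite -lee_fin sqr_n2E; last by apply: L2B => //; exact: L2_shift.
apply: (@le_trans _ _ (\int[mu]_x \int[leb]_t H (x, t))%E).
  apply: ge0_le_integral => //.
  - by move=> x _; rewrite lee_fin sqr_ge0.
  - apply/measurable_EFinP/measurable_funX/measurable_funB.
      by apply: L2_measurable; exact: L2_shift.
    exact: L2_measurable phi2.
  - exact: (measurable_fun_fubini_tonelli_F H).
  move=> x _; pose G t := \sum_(i < n) h ord0 i * partial_deriv i phi (x + t *: h).
  have cG : continuous G.
    move=> t; apply: cvg_bigsum => i; apply: cvgM; first exact: cvg_cst.
    have lt : x + s *: h @[s --> t] --> x + t *: h.
      by apply: cvgD; [exact: cvg_cst|exact: cvgZr_tmp].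
    exact: (cvg_comp _ _ lt (cphi i _)).
  have := @segment_sqr_le G (fun t => phi (x + t *: h)) cG.
  rewrite scale1r scale0r addr0; move=> /(_ _)/le_trans; apply.
    by move=> t; apply/is_derive_line; exact: C1_is_derive.
  apply: ge0_le_integral => //.
  - by move=> t _; rewrite lee_fin mulr_ge0// sqr_ge0.
  - apply/measurable_EFinP; apply: measurable_funM => //; apply: measurable_funX.
    exact: continuous_measurable_fun.
  - exact: (measurableT_comp mH (measurable_pair1 x)).
  move=> t _; rewrite lee_fin ler_wpM2l// sqr_enorm.
  exact: sum_cauchy_schwarz.
rewrite (fubini_tonelli H)//.
apply: (@le_trans _ _ (\int[leb]_t (\1_(`[0, 1]%classic) t *
   (enorm h ^+ 2 * \sum_(i < n) n2 mu (partial_deriv i phi) ^+ 2))%:E)%E).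
  rewrite le_eqVlt; apply/orP; left; apply/eqP; apply: eq_integral => t _; rewrite /H/=.
  under eq_integral do rewrite mulrA EFinM.
  rewrite ge0_integralZl//.
  - rewrite (integral_rV_shift (t *: h) (f := fun x => (P x)%:E)) ?PE -?EFinM ?mulrA//.
    exact/measurable_EFinP.
  - by apply/measurable_EFinP; apply: (measurableT_comp mP); exact: measurable_rV_shift.
  - by move=> x _; rewrite lee_fin.
  - by rewrite lee_fin mulr_ge0// sqr_ge0.
under eq_integral do rewrite EFinM.
rewrite ge0_integralZr//.
- by rewrite integral_indic//= setIT lebesgue_measure_itv/= lte01 oppr0 adde0 mul1e.
- exact/measurable_EFinP.
- by rewrite lee_fin mulr_ge0 ?sqr_ge0// sumr_ge0// => i _; exact: sqr_ge0.
Qed.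

End L2_rV.

Section restriction.
Context (R : realType) (n : nat).
Notation mu := (lebesgue_rV R n).
Notation L2 f := (f \in Lfun mu 2%:E).
Implicit Types (f g : 'rV[R]_n -> R) (D : set 'rV[R]_n).

Lemma restrictE D f x : (f \_ D) x = if x \in D then f x else 0.
Proof. by []. Qed.

Lemma L2fun_setT f : L2fun setT f <-> L2 f.
Proof.
rewrite /L2fun (_ : f \_ setT = f)//.
by apply/funext => x; rewrite restrictE in_setT.
Qed.

Lemma L2norm_n2 D f : L2norm D f = n2 mu (f \_ D).
Proof. exact: n2_Lnorm. Qed.

Lemma restrict_lin D (c : R) f g :
  (fun x => c * f x + g x) \_ D = (fun x => c * (f \_ D) x + (g \_ D) x).
Proof. by apply/funext => x; rewrite !restrictE; case: ifP => // _; rewrite mulr0 addr0. Qed.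

Lemma restrict_sub D f g : (f \- g) \_ D = (fun x => (f \_ D) x - (g \_ D) x).
Proof. by apply/funext => x; rewrite !restrictE; case: ifP => // _; rewrite subr0. Qed.

Lemma restrict_id D f : (forall x, ~ D x -> f x = 0) -> f \_ D = f.
Proof.
move=> f0; apply/funext => x; rewrite restrictE; case: ifPn => // xD.
by rewrite f0//; move/negP: xD; rewrite inE.
Qed.

Lemma L2_restrict D f : measurable D -> L2 f -> L2 (f \_ D).
Proof.
move=> mD /L2P[mf foo].
have mfD : measurable_fun setT (f \_ D).
  exact: ((measurable_restrictT f mD).1 (measurable_funTS mf)).
apply/L2P; split=> //; apply: le_lt_trans foo; apply: ge0_le_integral => //.
- by move=> x _; rewrite lee_fin sqr_ge0.
- exact/measurable_EFinP/measurable_funX.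
- exact/measurable_EFinP/measurable_funX.
move=> x _; rewrite lee_fin restrictE; case: ifP => // _.
by rewrite expr0n sqr_ge0.
Qed.

Lemma n2_restrict_ae D f : measurable D -> L2 f ->
  {ae mu, forall x, ~ D x -> f x = 0} -> n2 mu (f \_ D) = n2 mu f.
Proof.
move=> mD f2 f0; apply: n2_ae_eq => //; first exact: L2_restrict.
apply: filterS f0 => x fx; rewrite restrictE; case: ifPn => // xD.
by rewrite fx//; move/negP: xD; rewrite inE.
Qed.

Lemma Rintegral_restrict_ip D f g :
  \int[mu]_(x in D) (f x * g x) = ip mu (f \_ D) g.
Proof.
rewrite Rintegral_mkcond; apply: eq_Rintegral => x _.
by rewrite restrictE patchE; case: ifP => // _; rewrite mul0r.
Qed.

End restriction.

Section test_functions.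
Context (R : realType) (n : nat) (Omega : set 'rV[R]_n).
Notation mu := (lebesgue_rV R n).
Notation L2 f := (f \in Lfun mu 2%:E).
Implicit Types (phi psi : 'rV[R]_n -> R).

Lemma test_function_out phi : test_function Omega phi ->
  forall x, ~ Omega x -> phi x = 0.
Proof. by move=> [_ [K [_ KO phi0]]] x Ox; apply: phi0 => /KO. Qed.

Lemma test_function_derivable phi : test_function Omega phi ->
  forall i x, derivable phi x (delta_mx ord0 i).
Proof. by move=> [sphi _]; have [_ d] := sphi [::]. Qed.

Lemma test_function_continuous phi : test_function Omega phi -> continuous phi.
Proof. by move=> [sphi _]; have [c _] := sphi [::]. Qed.

(** The same compact set serves: its complement is open, so [phi] vanishes near each of its
    points. *)
Lemma test_function_partial phi i : test_function Omega phi ->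
  test_function Omega (partial_deriv i phi).
Proof.
move=> [sphi [K [cK KO phi0]]]; split.
  by move=> s; have := sphi (rcons s i); rewrite foldr_rcons.
exists K; split=> // x Kx.
have oK : open (~` K).
  by rewrite openC; apply: compact_closed => //; exact: norm_hausdorff.
rewrite /partial_deriv (@near_eq_derive _ _ _ _ (cst 0)) ?derive_cst//.
by apply: filterS (open_nbhs_nbhs (conj oK Kx)) => y /phi0.
Qed.

(** A continuous function is bounded on the compact support, which fits in a box of finite
    measure. *)
Lemma test_function_L2 phi : test_function Omega phi -> L2 phi.
Proof.
move=> tphi; have cphi := test_function_continuous tphi.
have [_ [K [cK KO phi0]]] := tphi.
have mphi : measurable_fun setT phi by exact: continuous_measurable_rV.
have [M [_ MK]] := compact_bounded cK.
have [C [_ CK]] := compact_bounded (continuous_compact (continuous_subspaceT cphi) cK).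
(* Boundedness provides a bound for each number strictly above [M] (respectively [C]), hence the
   added 1. *)
set M1 := `|M| + 1; set C1 := `|C| + 1.
have M1M : M < M1 by rewrite ltr_pwDr// ler_norm.
have C1C : C < C1 by rewrite ltr_pwDr// ler_norm.
have M10 : 0 <= M1 by rewrite addr_ge0.
pose box := [set x : 'rV[R]_n | forall i, (const_mx (- M1) : 'rV[R]_n) ord0 i <= x ord0 i <=
  (const_mx M1 : 'rV[R]_n) ord0 i].
have mubox : (mu box < +oo)%E.
  by rewrite lebesgue_rV_box ?ltry// => i; rewrite !mxE; lra.
have mbox : measurable box.
  rewrite (_ : box = \big[setI/setT]_(i < n)
      (rV_coord i @^-1` `[- M1, M1]%classic)).
    apply: bigsetI_measurable => i _; rewrite -[X in measurable X]setTI.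
    exact: measurable_rV_coord.
  apply/seteqP; split => x /=.
    move=> xB; rewrite -bigcap_seq => i _ /=; rewrite in_itv /=.
    by have := xB i; rewrite !mxE.
  rewrite -bigcap_seq => xB i; have := xB i (mem_index_enum i).
  by rewrite /= in_itv/= !mxE.
have Kbox : K `<=` box.
  move=> x Kx i; rewrite !mxE -ler_norml.
  apply: le_trans (MK _ M1M _ Kx); rewrite [leRHS]mx_normrE.
  exact: (le_bigmax _ (fun ij => `|x ij.1 ij.2|) (ord0, i)).
apply/L2P; split=> //.
apply: (@le_lt_trans _ _ (\int[mu]_x ((C1 ^+ 2) * \1_box x)%:E)%E).
  apply: ge0_le_integral => //.
  - by move=> x _; rewrite lee_fin sqr_ge0.
  - exact/measurable_EFinP/measurable_funX.
  - by apply/measurable_EFinP; apply: measurable_funM => //; exact: measurable_indic.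
  move=> x _; rewrite lee_fin; have [Kx|Kx] := pselect (K x); last first.
    by rewrite phi0// expr0n mulr_ge0// sqr_ge0.
  rewrite indicE mem_set ?mulr1; last exact: Kbox.
  rewrite -(real_normK (num_real _)) lerXn2r ?nnegrE ?addr_ge0//.
  by apply: CK => //; exists x.
under eq_integral do rewrite EFinM.
rewrite ge0_integralZl//.
- by rewrite integral_indic//= setIT lte_mul_pinfty// lee_fin sqr_ge0.
- by apply/measurable_EFinP; exact: measurable_indic.
- by rewrite lee_fin sqr_ge0.
Qed.

Lemma partial_deriv_lin (c : R) phi psi i :
  (forall x, derivable phi x (delta_mx ord0 i)) ->
  (forall x, derivable psi x (delta_mx ord0 i)) ->
  (forall x, derivable (fun x => c * phi x + psi x) x (delta_mx ord0 i)) /\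
  partial_deriv i (fun x => c * phi x + psi x) =
    (fun x => c * partial_deriv i phi x + partial_deriv i psi x).
Proof.
move=> dphi dpsi.
rewrite (_ : (fun x => c * phi x + psi x) = (c \*: phi) + psi)//.
split=> [x|]; first by apply: derivableD => //; exact: derivableZ.
apply/funext => x; rewrite /partial_deriv deriveD//; last exact: derivableZ.
by rewrite deriveZ.
Qed.

Lemma test_function_lin (c : R) phi psi :
  test_function Omega phi -> test_function Omega psi ->
  test_function Omega (fun x => c * phi x + psi x).
Proof.
move=> [sphi [K [cK KO phi0]]] [spsi [K' [cK' K'O psi0]]]; split; last first.
  exists (K `|` K'); split; [exact: compactU|by rewrite subUset|].
  by move=> x /not_orP[Kx K'x]; rewrite phi0// psi0// mulr0 addr0.
move=> s.
have E : foldr (@partial_deriv R n) (fun x => c * phi x + psi x) s =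
    (fun x => c * foldr (@partial_deriv R n) phi s x + foldr (@partial_deriv R n) psi s x).
  elim: s => [//|i s IH] /=; rewrite IH.
  by apply: (@partial_deriv_lin _ _ _ _ _ _).2 => x; [apply: (sphi s).2|apply: (spsi s).2].
rewrite E; split.
  have [cp _] := sphi s; have [cq _] := spsi s.
  by move=> x; exact: (cvgD (cvgM (cvg_cst c) (cp x)) (cq x)).
move=> i; apply: (@partial_deriv_lin _ _ _ _ _ _).1 => x; [apply: (sphi s).2|apply: (spsi s).2].
Qed.

End test_functions.

Section H10_theory.
Context (R : realType) (n : nat) (Omega : set 'rV[R]_n).
Hypothesis oOmega : open Omega.
Notation mu := (lebesgue_rV R n).
Notation L2 f := (f \in Lfun mu 2%:E).
Implicit Types (v w : 'rV[R]_n -> R).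

Let mOmega : measurable Omega. Proof. exact: open_measurable_rV. Qed.

Lemma weak_gradient_ip v g phi i : weak_gradient Omega v g -> test_function Omega phi ->
  ip mu (v \_ Omega) (partial_deriv i phi) = - ip mu (g i \_ Omega) phi.
Proof. by move=> [_ vg] tphi; rewrite -!Rintegral_restrict_ip; exact: vg. Qed.

Lemma weak_grad_spec v : H10 Omega v -> weak_gradient Omega v (weak_grad Omega v).
Proof. by move=> [_ _ [g vg _]]; exact: xgetI vg. Qed.

(* The weak gradient [w] chosen by [weak_grad] is only compared with the limit
   [g] of the gradients of [phi k] by testing both against [partial_deriv i (phi k)]. *)
Lemma H10_shift_le v h : H10 Omega v ->
  n2 mu (fun x => v (x + h) - v x) <= enorm h * H10norm Omega v.
Proof.
move=> Hv; have [/L2fun_setT v2 v0 [g vg [phi [tphi phiv phig]]]] := Hv.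
have vw := weak_grad_spec Hv.
set w := weak_grad Omega v in vw.
have phi2 k : L2 (phi k) by exact: test_function_L2 (tphi k).
have tpsi k i : test_function Omega (partial_deriv i (phi k)).
  exact: test_function_partial.
have psi2 k i : L2 (partial_deriv i (phi k)) by exact: test_function_L2 (tpsi k i).
have g2 i : L2 (g i \_ Omega) by have [gi _] := vg; exact: gi.
have w2 i : L2 (w i \_ Omega) by have [wi _] := vw; exact: wi.
pose E k := L2norm Omega (phi k \- v).
pose e k i := L2norm Omega (partial_deriv i (phi k) \- g i).
have EE k : E k = n2 mu (fun x => phi k x - v x).
  rewrite /E L2norm_n2 n2_restrict_ae//; first exact: L2B.
  apply: filterS v0 => x vx Ox.
  by rewrite /= vx// (test_function_out (tphi k))// subr0.
have eE k i : e k i = n2 mu (fun x => partial_deriv i (phi k) x - (g i \_ Omega) x).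
  by rewrite /e L2norm_n2 restrict_sub (restrict_id (test_function_out (tpsi k i))).
have psi_le k i : n2 mu (partial_deriv i (phi k)) <= e k i + L2norm Omega (w i).
  set psi := partial_deriv i (phi k).
  have gw : ip mu (g i \_ Omega) psi = ip mu (w i \_ Omega) psi.
    apply: oppr_inj; rewrite -(weak_gradient_ip i vg (tpsi k i)).
    by rewrite -(weak_gradient_ip i vw (tpsi k i)).
  (* The square of the norm is <psi - g, psi> + <w, psi>; Cauchy-Schwarz bounds both terms, and one
     factor [n2 mu psi] is then divided out. *)
  have : n2 mu psi ^+ 2 <= (e k i + L2norm Omega (w i)) * n2 mu psi.
    rewrite sqr_n2 [leLHS](_ : _ =
      ip mu (fun x => psi x - (g i \_ Omega) x) psi + ip mu (w i \_ Omega) psi); last first.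
      by rewrite ipBl ?psi2 ?g2// gw subrK.
    rewrite mulrDl lerD// (le_trans (ler_norm _))// ?eE ?L2norm_n2 cauchy_schwarz ?psi2//.
    by apply: L2B; [exact: psi2|exact: g2].
  have := n2_ge0 mu psi; rewrite le_eqVlt => /orP[/eqP<- _|psi0].
    by rewrite addr_ge0 // ?eE ?L2norm_n2 n2_ge0.
  by rewrite expr2 ler_pM2r.
(* The difference for [v] is compared with that for [phi k]. The approximation error is paid at x
   and at x + h, hence [E k] twice; both copies vanish in the limit. *)
have bound k : n2 mu (fun x => v (x + h) - v x) <=
    E k + E k + enorm h * Num.sqrt (\sum_(i < n) (e k i + L2norm Omega (w i)) ^+ 2).
  rewrite (_ : (fun x => v (x + h) - v x) = (fun x =>
    (phi k x - v x) - (phi k (x + h) - v (x + h)) + (phi k (x + h) - phi k x))); last first.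
    by apply/funext => x; ring.
  have D2 : L2 (fun x => phi k x - v x) by exact: L2B.
  have Dh2 : L2 (fun x => phi k (x + h) - v (x + h)) by exact: (L2_shift h D2).
  have P2 : L2 (fun x => phi k (x + h) - phi k x) by apply: L2B => //; exact: L2_shift.
  apply: le_trans (n2D (L2B D2 Dh2) P2) _; apply: lerD.
    apply: le_trans (n2B D2 Dh2) _; rewrite EE lerD2l.
    by rewrite (n2_shift h D2).
  rewrite -[leLHS](ger0_norm (n2_ge0 _ _)) -sqrtr_sqr.
  rewrite -[enorm h](ger0_norm (enorm_ge0 _)) -sqrtr_sqr -sqrtrM ?sqr_ge0//.
  apply: ler_wsqrtr.
  have Hd := test_function_derivable (tphi k).
  have Hc i := test_function_continuous (tpsi k i).
  apply: le_trans (C1_shift_le h Hd Hc (phi2 k) (psi2 k)) _.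
  apply: ler_wpM2l; first exact: sqr_ge0.
  apply: ler_sum => i _; rewrite lerXn2r ?nnegrE ?n2_ge0//.
  by rewrite addr_ge0// ?eE ?L2norm_n2 n2_ge0.
have E0 : E k @[k --> \oo] --> (0 : R) by exact: phiv.
have e0 i : e k i @[k --> \oo] --> (0 : R) by exact: phig.
have L : (E k + E k + enorm h * Num.sqrt (\sum_(i < n) (e k i + L2norm Omega (w i)) ^+ 2))
    @[k --> \oo] --> (0 : R) + 0 + enorm h *
      Num.sqrt (\sum_(i < n) (0 + L2norm Omega (w i)) ^+ 2).
  apply: cvgD; first exact: cvgD.
  apply: cvgM; first exact: cvg_cst.
  apply: continuous_cvg; first exact: sqrt_continuous.
  apply: cvg_bigsum => i.
  have ew : (e k i + L2norm Omega (w i)) @[k --> \oo] --> 0 + L2norm Omega (w i).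
    by apply: cvgD => //; exact: cvg_cst.
  exact: (cvg_comp _ _ ew (@exprn_continuous _ 2 _)).
have := ler_cvg_to (cvg_cst (n2 mu (fun x => v (x + h) - v x))) L (nearW _ bound).
rewrite !add0r; under eq_bigr do rewrite add0r.
by move=> H; exact: H.
Qed.

Lemma H10_lin (c : R) v w : H10 Omega v -> H10 Omega w ->
  H10 Omega (fun x => c * v x + w x).
Proof.
move=> [/L2fun_setT v2 v0 [g vg [phi [tphi phiv phig]]]].
move=> [/L2fun_setT w2 w0 [g' wg [psi [tpsi psiw psig]]]].
have L2D' (f f' : 'rV[R]_n -> R) : L2fun Omega f -> L2fun Omega f' ->
    L2fun Omega (fun x => c * f x + f' x).
  by move=> f2 f'2; rewrite /L2fun restrict_lin; apply: L2D => //; exact: L2Z.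
have cvg_lin (f f' : 'rV[R]_n -> R) (F F' : nat -> 'rV[R]_n -> R) :
    (forall k, L2fun Omega (F k)) -> (forall k, L2fun Omega (F' k)) ->
    L2fun Omega f -> L2fun Omega f' ->
    L2norm Omega (F k \- f) @[k --> \oo] --> 0 ->
    L2norm Omega (F' k \- f') @[k --> \oo] --> 0 ->
    L2norm Omega ((fun x => c * F k x + F' k x) \- (fun x => c * f x + f' x))
      @[k --> \oo] --> 0.
  move=> F2 F'2 f2 f'2 Ff F'f'.
  apply: (@squeeze_cvgr _ _ _ _ (fun=> 0)
    (fun k => `|c| * L2norm Omega (F k \- f) + L2norm Omega (F' k \- f'))).
  - near=> k; rewrite !L2norm_n2 n2_ge0/= !restrict_sub !restrict_lin.
    have D2 := L2B (F2 k) f2; have D'2 := L2B (F'2 k) f'2.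
    rewrite -n2Z// [X in n2 mu X <= _](_ : _ = (fun x =>
      c * ((F k \_ Omega) x - (f \_ Omega) x) + ((F' k \_ Omega) x - (f' \_ Omega) x))).
      by apply: n2D => //; exact: L2Z.
    by apply/funext => x; ring.
  - exact: cvg_cst.
  - rewrite -[X in _ --> X]addr0 -[X in _ --> X + _](mulr0 `|c|).
    by apply: cvgD => //; apply: cvgM => //; exact: cvg_cst.
have tL2 p : test_function Omega p -> L2fun Omega p.
  by move=> tp; apply: L2_restrict => //; exact: test_function_L2 tp.
have vO : L2fun Omega v by exact: L2_restrict.
have wO : L2fun Omega w by exact: L2_restrict.
split.
- by apply/L2fun_setT; apply: L2D => //; exact: L2Z.
- by apply: filterS2 v0 w0 => x vx wx Ox; rewrite vx// wx// mulr0 addr0.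
exists (fun i x => c * g i x + g' i x).
  split=> [i|p i tp]; first by apply: L2D'; [exact: vg.1|exact: wg.1].
  rewrite !Rintegral_restrict_ip !restrict_lin.
  have p2 := test_function_L2 tp.
  have dp2 := test_function_L2 (test_function_partial i tp).
  rewrite !ipDl ?ipZl//; try exact: L2Z; try exact: vg.1; try exact: wg.1.
  - by rewrite (weak_gradient_ip i vg)// (weak_gradient_ip i wg)//; ring.
  - by apply: L2Z; exact: vg.1.
exists (fun k x => c * phi k x + psi k x); split.
- by move=> k; exact: test_function_lin.
- by apply: cvg_lin => // k; exact: tL2.
move=> i.
have dphi k x : derivable (phi k) x (delta_mx ord0 i).
  by have H := test_function_derivable (tphi k); exact: H.
have dpsi k x : derivable (psi k) x (delta_mx ord0 i).
  by have H := test_function_derivable (tpsi k); exact: H.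
under eq_fun => k do rewrite (partial_deriv_lin c (dphi k) (dpsi k)).2.
apply: cvg_lin => //.
- by move=> k; apply: tL2; exact: test_function_partial.
- by move=> k; apply: tL2; exact: test_function_partial.
- exact: vg.1.
- exact: wg.1.
Unshelve. all: by end_near. Qed.

(** [span_in] fixes its members only up to a null set, so membership has to pass along almost
    everywhere equality. The weak gradient and the approximating sequence are kept. *)
Lemma H10_ae_eq v w : L2 w -> {ae mu, forall x, w x = v x} ->
  H10 Omega v -> H10 Omega w.
Proof.
move=> w2 wv [/L2fun_setT v2 v0 [g vg [phi [tphi phiv phig]]]].
have wvO : {ae mu, forall x, (w \_ Omega) x = (v \_ Omega) x}.
  by apply: filterS wv => x wvx; rewrite !restrictE wvx.
split.
- exact/L2fun_setT.
- by apply: filterS2 v0 wv => x vx -> /vx.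
exists g.
  split=> [|p i tp]; first exact: vg.1.
  rewrite -(vg.2 _ _ tp) !Rintegral_restrict_ip; apply: ip_ae_eql => //.
  - exact: L2_restrict.
  - exact: L2_restrict.
  - exact: test_function_L2 (test_function_partial i tp).
exists phi; split=> //.
rewrite (_ : (fun k => L2norm Omega (phi k \- w)) = (fun k => L2norm Omega (phi k \- v)))//.
apply/funext => k; rewrite !L2norm_n2 !restrict_sub.
have pO : L2 (phi k \_ Omega) by apply: L2_restrict => //; exact: test_function_L2 (tphi k).
apply: n2_ae_eq.
- by apply: L2B => //; exact: L2_restrict.
- by apply: L2B => //; exact: L2_restrict.
by apply: filterS wvO => x ->.
Qed.

Lemma H10_0 : H10 Omega (fun=> 0).
Proof.
have z2 : L2 (fun=> 0 : R).
  apply/L2P; split=> //; under eq_integral do rewrite expr0n/=.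
  by rewrite integral0 ltry.
have z2O (D : set 'rV[R]_n) : L2fun D (fun=> 0 : R) by rewrite /L2fun restrict_id.
have dz i : partial_deriv i (fun=> 0 : R) = (fun=> 0 : R) :> ('rV[R]_n -> R).
  by apply/funext => x; rewrite /partial_deriv derive_cst.
have nz : L2norm Omega ((fun=> 0 : R) \- (fun=> 0 : R)) = 0.
  rewrite L2norm_n2 restrict_id /n2 /ip => [|x _]; last by rewrite /= subr0.
  by under eq_Rintegral do rewrite /= subr0 mulr0; rewrite /Rintegral integral0 sqrtr0.
split=> //; first exact/nearW.
exists (fun=> fun=> 0).
  split=> [//|p i tp].
  under eq_Rintegral do rewrite mul0r.
  under [in RHS]eq_Rintegral do rewrite mul0r.
  by rewrite /Rintegral integral0 oppr0.
exists (fun=> fun=> 0); split.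
- move=> k; split; last by exists set0; split=> //; exact: compact0.
  move=> s; rewrite (_ : foldr _ _ _ = fun=> 0); last first.
    by elim: s => [//|i s IH] /=; rewrite IH dz.
  by split=> [|i x]; [exact: cst_continuous|exact: derivable_cst].
- by rewrite nz; exact: cvg_cst.
- by move=> i; rewrite dz nz; exact: cvg_cst.
Qed.

Lemma H10_sum (N : nat) (c : 'I_N -> R) (b : 'I_N -> 'rV[R]_n -> R) :
  (forall i, H10 Omega (b i)) -> H10 Omega (fun x => \sum_(i < N) c i * b i x).
Proof.
elim: N c b => [|N IH] c b Hb.
  by under eq_fun do rewrite big_ord0; exact: H10_0.
under eq_fun do rewrite big_ord_recl.
apply: H10_lin; first exact: Hb.
by apply: (IH (fun i => c (lift ord0 i)) (fun i => b (lift ord0 i))) => i; exact: Hb.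
Qed.

End H10_theory.

(** * Shell estimates *)

Section double_differences.
Context (R : realType) (n : nat) (gamma : 'rV[R]_n -> 'rV[R]_n -> R).
Hypothesis gamma_kernel : symmetric_kernel gamma.
Notation mu := (lebesgue_rV R n).
Notation mm := (mu \x mu)%E.
Implicit Types (u v : 'rV[R]_n -> R) (S : set ('rV[R]_n * 'rV[R]_n)).

(** With the square root of the kernel inside, [aform] becomes an L^2 inner product on the product
    space, and the general L^2 lemmas apply to it. *)
Definition weighted_diff S u (z : 'rV[R]_n * 'rV[R]_n) : R :=
  \1_S z * ((u z.1 - u z.2) * Num.sqrt (gamma z.1 z.2)).

Let gamma_ge0 x x' : 0 <= gamma x x'. Proof. by have [_ g0 _] := gamma_kernel. Qed.

Lemma weighted_diff_lin S c u v :
  weighted_diff S (fun x => c * u x + v x) =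
  (fun z => c * weighted_diff S u z + weighted_diff S v z).
Proof. by apply/funext => z; rewrite /weighted_diff; ring. Qed.

Lemma weighted_diffM S u v z : weighted_diff S u z * weighted_diff S v z =
  \1_S z * ((u z.1 - u z.2) * (v z.1 - v z.2) * gamma z.1 z.2).
Proof.
rewrite /weighted_diff -{3}(sqr_sqrtr (gamma_ge0 z.1 z.2)) indicE.
by case: (z \in S); rewrite ?mul1r ?mul0r//; ring.
Qed.

Lemma measurable_weighted_diff S u : measurable S -> measurable_fun setT u ->
  measurable_fun setT (weighted_diff S u).
Proof.
move=> mS mu1; apply: measurable_funM; first exact: measurable_indic.
apply: measurable_funM.
  by apply: measurable_funB; exact: (measurableT_comp mu1).
have [mg _ _] := gamma_kernel.
apply: (measurableT_comp (f := @Num.sqrt R)) mg.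
by apply: continuous_measurable_fun; exact: sqrt_continuous.
Qed.

Let measurable_enorm_diff :
  measurable_fun [set: 'rV[R]_n * 'rV[R]_n] (fun z => enorm (z.1 - z.2)).
Proof.
apply: (measurableT_comp (@measurable_enorm R n)).
by apply: measurable_rV_sub; [exact: measurable_fst|exact: measurable_snd].
Qed.

Lemma measurable_strip delta : measurable (@strip R n delta).
Proof. exact: measurable_set_le. Qed.

(** Half-open, so that for a <= b the strip of width b is the disjoint union of the strip of width a
    and this shell. *)
Definition shell (a b : R) : set ('rV[R]_n * 'rV[R]_n) :=
  [set z | a < enorm (z.1 - z.2) <= b].

Lemma measurable_shell a b : measurable (shell a b).
Proof.
rewrite (_ : shell a b = [set z | a < enorm (z.1 - z.2)] `&` [set z | enorm (z.1 - z.2) <= b]).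
  by apply: measurableI; [exact: measurable_set_lt|exact: measurable_set_le].
by apply/seteqP; split => z /= => [/andP|H]; last exact/andP.
Qed.

Lemma aform_ip u v delta :
  aform gamma u v delta = ip mm (weighted_diff (strip delta) u) (weighted_diff (strip delta) v).
Proof.
rewrite /aform Rintegral_mkcond; apply: eq_Rintegral => z _.
rewrite weighted_diffM patchE indicE.
by case: (z \in strip delta); rewrite ?mul1r ?mul0r.
Qed.

Lemma Vnorm_n2 delta v : Vnorm gamma delta v = n2 mm (weighted_diff (strip delta) v).
Proof. by rewrite /Vnorm aform_ip. Qed.

Lemma weighted_diff_strip (a b : R) u z : a <= b ->
  weighted_diff (strip b) u z = weighted_diff (strip a) u z + weighted_diff (shell a b) u z.
Proof.
move=> ab; rewrite /weighted_diff -mulrDl; congr (_ * _).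
rewrite /strip /shell !indic_predE; case: (leP _ a) => za /=; last by rewrite add0r.
by rewrite (le_trans za ab) addr0.
Qed.

Lemma weighted_diffM_strip (a b : R) u v z : a <= b ->
  weighted_diff (strip b) u z * weighted_diff (strip b) v z =
  weighted_diff (strip a) u z * weighted_diff (strip a) v z +
  weighted_diff (shell a b) u z * weighted_diff (shell a b) v z.
Proof.
move=> ab; rewrite !weighted_diffM -mulrDl; congr (_ * _).
rewrite /strip /shell !indic_predE; case: (leP _ a) => za /=; last by rewrite add0r.
by rewrite (le_trans za ab) addr0.
Qed.

Lemma VspaceP Omega delta v : Vspace Omega gamma delta v <->
  [/\ v \in Lfun mu 2%:E, {ae mu, forall x, ~ Omega x -> v x = 0} &
      weighted_diff (strip delta) v \in Lfun mm 2%:E].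
Proof.
have E : (\int[mm]_z (weighted_diff (strip delta) v z ^+ 2)%:E =
    \int[mm]_(z in strip delta) ((v z.1 - v z.2) ^+ 2 * gamma z.1 z.2)%:E)%E.
  rewrite [RHS]integral_mkcond; apply: eq_integral => z _.
  rewrite expr2 weighted_diffM patchE indicE -expr2.
  by case: (z \in strip delta); rewrite ?mul1r ?mul0r.
split=> [[/L2fun_setT v2 v0 foo]|[v2 v0 /L2P[_ foo]]]; split=> //.
- apply/L2P; split; last by rewrite E.
  apply: measurable_weighted_diff; first exact: measurable_strip.
  exact: L2_measurable v2.
- exact/L2fun_setT.
- by rewrite -E.
Qed.

Lemma Vspace_lin Omega delta c u v : Vspace Omega gamma delta u ->
  Vspace Omega gamma delta v -> Vspace Omega gamma delta (fun x => c * u x + v x).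
Proof.
move=> /VspaceP[u2 u0 Uu] /VspaceP[v2 v0 Uv]; apply/VspaceP; split.
- by apply: L2D => //; exact: L2Z.
- by apply: filterS2 u0 v0 => x ux vx Ox; rewrite ux// vx// mulr0 addr0.
- by rewrite weighted_diff_lin; apply: L2D => //; exact: L2Z.
Qed.

Lemma aform_linr Omega delta c u v w : Vspace Omega gamma delta u ->
  Vspace Omega gamma delta v -> Vspace Omega gamma delta w ->
  aform gamma w (fun x => c * u x + v x) delta =
  c * aform gamma w u delta + aform gamma w v delta.
Proof.
move=> /VspaceP[_ _ Uu] /VspaceP[_ _ Uv] /VspaceP[_ _ Uw].
by rewrite !aform_ip weighted_diff_lin ipDr ?ipZr//; exact: L2Z.
Qed.

Lemma aformC u v delta : aform gamma u v delta = aform gamma v u delta.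
Proof. by rewrite !aform_ip ipC. Qed.

Lemma aform_cauchy_schwarz Omega delta u v : Vspace Omega gamma delta u ->
  Vspace Omega gamma delta v ->
  `|aform gamma u v delta| <= Vnorm gamma delta u * Vnorm gamma delta v.
Proof.
move=> /VspaceP[_ _ Uu] /VspaceP[_ _ Uv].
by rewrite aform_ip !Vnorm_n2; exact: cauchy_schwarz.
Qed.

Lemma sqr_Vnorm delta v : Vnorm gamma delta v ^+ 2 = aform gamma v v delta.
Proof. by rewrite Vnorm_n2 sqr_n2 aform_ip. Qed.

End double_differences.

Section shell_estimates.
Context (R : realType) (n : nat) (n_gt0 : (0 < n)%N).
Context (gamma : 'rV[R]_n -> 'rV[R]_n -> R) (gamma_kernel : symmetric_kernel gamma).
Context (dmin dmax : R) (dmin_gt0 : 0 < dmin).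
Context (ghat : R -> R) (h2 : kernel_H2 dmin dmax gamma ghat).
Notation mu := (lebesgue_rV R n).
Notation mm := (mu \x mu)%E.
Notation leb := (@lebesgue_measure R).
Notation L2 f := (f \in Lfun mu 2%:E).
Implicit Types (u v : 'rV[R]_n -> R) (a b : R).

Lemma ghat_ge0 t : 0 < t -> 0 <= ghat t.
Proof. by have [H _ _] := h2; exact: H. Qed.

(** (H2) at the largest horizon, whose truncation is inactive here; the two points differ because
    their distance exceeds [dmin > 0]. *)
Lemma gamma_le_ghat x x' : dmin < enorm (x - x') <= dmax -> gamma x x' <= ghat (enorm (x - x')).
Proof.
move=> /andP[dx xd]; have [_ H _] := h2.
have := H dmax x x'; rewrite /truncated_kernel xd lexx andbT; apply.
  exact: le_trans (ltW dx) xd.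
by apply: contraTneq dx => ->; rewrite subrr -leNgt (_ : enorm 0 = 0) ?ltW//; apply/eqP; rewrite enorm_eq0.
Qed.

(** (H2) only makes t^(n-1) ghat(t) measurable on this interval, so the power is divided out. The
    absolute value makes the divisor nonnegative on the whole line. *)
Let measurable_ghat :
  measurable_fun (`]dmin, dmax[%classic : set (measurableTypeR R)) ghat.
Proof.
have [_ _ /measurable_int/measurable_EFinP mg] := h2.
have mi : measurable_fun [set: measurableTypeR R] (fun t : R => (`|t| ^+ n.-1)^-1).
  apply: measurable_ge0_inv => [t|]; first exact: exprn_ge0.
  by apply: measurable_funX; exact: (measurableT_comp (@normr_measurable R setT)).
apply: (eq_measurable_fun (fun t : measurableTypeR R => (t ^+ n.-1 * ghat t) * (`|t| ^+ n.-1)^-1)).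
  move=> t; rewrite inE/= in_itv/= => /andP[dt _].
  have t0 := lt_trans dmin_gt0 dt.
  by rewrite gtr0_norm// mulrAC mulfV ?mul1r// expf_neq0// gt_eqF.
exact: (measurable_funM mg (measurable_funTS mi)).
Qed.

(** Beyond the horizons [ghat] is not known to be measurable; the cut makes it a measurable function
    on the whole line, with the same half-open convention as [shell]. *)
Definition cut_ghat a b (t : R) : R := \1_(`]a, b]%classic) t * ghat t.

Lemma cut_ghatE a b t : cut_ghat a b t = if a < t <= b then ghat t else 0.
Proof.
rewrite /cut_ghat (_ : `]a, b]%classic = [set t | a < t <= b]); last first.
  by apply/seteqP; split => s /=; rewrite in_itv.
by rewrite indic_predE; case: ifP; rewrite ?mul1r ?mul0r.
Qed.

Lemma measurable_cut_ghat a b : dmin <= a -> b <= dmax ->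
  measurable_fun [set: measurableTypeR R] (cut_ghat a b).
Proof.
move=> da bd.
have mI : measurable (`]a, b]%classic : set (measurableTypeR R)) by exact: measurable_itv.
rewrite (_ : cut_ghat a b = ghat \_ `]a, b]%classic); last first.
  apply/funext => t; rewrite /cut_ghat indicE patchE.
  by case: (_ \in _); rewrite ?mul1r ?mul0r.
have mg : measurable_fun (`]a, b]%classic : set (measurableTypeR R)) ghat.
  apply/measurable_fun_itv_bndo_bndcP; apply: measurable_funS measurable_ghat => //.
  by apply: subset_itv; rewrite bnd_simp.
exact: ((measurable_restrictT ghat mI).1 mg).
Qed.

Lemma cut_ghat_ge0 a b t : dmin <= a -> 0 <= cut_ghat a b t.
Proof.
move=> da; rewrite cut_ghatE; case: ifP => // /andP[ta _]; apply: ghat_ge0.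
exact: lt_trans dmin_gt0 (le_lt_trans da ta).
Qed.

Let integrable_sub a b : dmin <= a -> b <= dmax ->
  leb.-integrable `]a, b[ (fun t => (t ^+ n.-1 * ghat t)%:E).
Proof.
move=> da bd; have [_ _ ig] := h2; apply: integrableS ig => //.
by apply: subset_itv; rewrite bnd_simp.
Qed.

Lemma radial_integral_EFin a b : dmin <= a -> b <= dmax ->
  ((radial_integral n ghat a b)%:E = \int[leb]_(t in `]a, b[) (t ^+ n.-1 * ghat t)%:E)%E.
Proof.
by move=> da bd; rewrite /radial_integral /Rintegral fineK//;
  apply: integrable_fin_num => //; exact: integrable_sub.
Qed.

Let integrand_ge0 a b t : dmin <= a -> `]a, b[%classic t -> 0 <= t ^+ n.-1 * ghat t.
Proof.
move=> da; rewrite /= in_itv/= => /andP[ta _].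
have t0 := lt_trans dmin_gt0 (le_lt_trans da ta).
by rewrite mulr_ge0 ?ghat_ge0// exprn_ge0// ltW.
Qed.

Lemma radial_integral_ge0 a b : dmin <= a -> 0 <= radial_integral n ghat a b.
Proof. by move=> da; apply: Rintegral_ge0 => t; exact: integrand_ge0. Qed.

Lemma radial_integral_le a b : dmin <= a -> b <= dmax ->
  radial_integral n ghat a b <= radial_integral n ghat dmin dmax.
Proof.
move=> da bd; rewrite -lee_fin !radial_integral_EFin//.
apply: ge0_subset_integral => //.
- by have [_ _ /measurable_int] := h2.
- by move=> t tI; rewrite lee_fin (integrand_ge0 (lexx dmin) tI).
- by apply: subset_itv; rewrite bnd_simp.
Qed.

Lemma radial_integral_le_lin Cgamma a b : kernel_H3 n dmin dmax ghat Cgamma ->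
  dmin <= a -> a <= b -> b <= dmax ->
  radial_integral n ghat a b <= Cgamma * (b - a).
Proof.
move=> [C0 h3] da ab bd; rewrite -lee_fin radial_integral_EFin//.
apply: (@le_trans _ _ (\int[leb]_(t in `]a, b[) Cgamma%:E)%E); last first.
  rewrite integral_cst//= lebesgue_measure_itv/= lte_fin.
  case: ltP => [_|ba]; first by rewrite -EFinB -EFinM.
  by rewrite mule0 lee_fin mulr_ge0 ?subr_ge0// ltW.
apply: ge0_le_integral => //.
- by move=> t tI; rewrite lee_fin (integrand_ge0 da tI).
- by have /measurable_int := integrable_sub da bd.
- by move=> t /=; rewrite in_itv/= => /andP[ta tb];
    rewrite lee_fin h3// (le_lt_trans da ta) (lt_le_trans tb bd).
Qed.

Lemma integral_cut_ghat a b : dmin <= a -> b <= dmax ->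
  (\int[mu]_h (cut_ghat a b (enorm h))%:E =
    (sphere_area R n * radial_integral n ghat a b)%:E)%E.
Proof.
move=> da bd; have mc := measurable_cut_ghat da bd.
rewrite (integral_radial_rV n_gt0 (g := EFin \o cut_ghat a b)); last 2 first.
- exact/measurable_EFinP.
- by move=> t; rewrite lee_fin cut_ghat_ge0.
rewrite [in RHS]EFinM radial_integral_EFin//; congr (_ * _)%E.
(* [radial_integral] is over an open interval and the shell contains its right end; a single point
   changes nothing. *)
rewrite [RHS](integral_itv_bndo_bndc (measurable_int _ (integrable_sub da bd))).
rewrite [LHS]integral_mkcond [RHS]integral_mkcond; apply: eq_integral => t _.
rewrite !patchE /= cut_ghatE.
have -> : (t \in `]a, b]%classic) = (a < t <= b).
  by apply/idP/idP; rewrite inE/= in_itv.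
have -> : (t \in `]0, +oo[%classic) = (0 < t).
  by apply/idP/idP; rewrite inE/= in_itv/= andbT.
case: (boolP (a < t <= b)) => [/andP[ta tb]|_]; last by case: ifP; rewrite ?mule0.
by rewrite (lt_trans dmin_gt0 (le_lt_trans da ta)) EFinM.
Qed.

End shell_estimates.

Section truncation_dependence.
Context (R : realType) (n : nat) (n_gt0 : (0 < n)%N).
Context (gamma : 'rV[R]_n -> 'rV[R]_n -> R) (gamma_kernel : symmetric_kernel gamma).
Context (dmin dmax : R) (dmin_gt0 : 0 < dmin).
Context (ghat : R -> R) (h2 : kernel_H2 dmin dmax gamma ghat).
Notation mu := (lebesgue_rV R n).
Notation mm := (mu \x mu)%E.
Notation L2 f := (f \in Lfun mu 2%:E).
Notation area := (sphere_area R n).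
Implicit Types (u v : 'rV[R]_n -> R) (a b : R).

Lemma sphere_area_ge0 : 0 <= area.
Proof.
rewrite -lee_fin -ball_sphere_area// mule_ge0//.
by apply: integral_ge0 => y _; rewrite lee_fin ball_indic_ge0.
Qed.

(** (p - q)^2 <= 2 p^2 + 2 q^2 separates the two points. In each half the variable not seen by [u]
    is integrated first, giving [area * radial_integral]; the constant 4 is 2 + 2. *)
Lemma shell_energy_le u a b : L2 u -> dmin <= a -> b <= dmax ->
  (\int[mm]_z (weighted_diff gamma (shell a b) u z ^+ 2)%:E <=
   (4 * area * radial_integral n ghat a b * n2 mu u ^+ 2)%:E)%E.
Proof.
move=> u2 da bd; have mu2 := L2_measurable u2.
pose c (h : 'rV[R]_n) := cut_ghat ghat a b (enorm h).
have c0 h : 0 <= c h by exact: (cut_ghat_ge0 dmin_gt0 h2).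
have mc : measurable_fun [set: 'rV[R]_n] c.
  apply: (measurableT_comp (measurable_cut_ghat dmin_gt0 h2 da bd)).
  exact: measurable_enorm.
have cE x : (\int[mu]_y (c (y - x))%:E = (area * radial_integral n ghat a b)%:E)%E.
  rewrite (integral_rV_shift (- x) (f := EFin \o c)); last exact/measurable_EFinP.
  exact: (integral_cut_ghat n_gt0 dmin_gt0 h2 da bd).
have mcd : measurable_fun [set: 'rV[R]_n * 'rV[R]_n] (fun z => c (z.1 - z.2)).
  apply: (measurableT_comp mc).
  by apply: measurable_rV_sub; [exact: measurable_fst|exact: measurable_snd].
(* The boolean selects which of the two points carries [u]; it decides the order of integration in
   Tonelli's theorem. *)
pose F i (z : 'rV[R]_n * 'rV[R]_n) : \bar R :=
  (2 * u (if i then z.1 else z.2) ^+ 2 * c (z.1 - z.2))%:E.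
have mF i : measurable_fun setT (F i).
  apply/measurable_EFinP; apply: measurable_funM => //; apply: measurable_funM => //.
  by apply: measurable_funX; case: i; exact: (measurableT_comp mu2).
have F0 i z : (0 <= F i z)%E by rewrite lee_fin mulr_ge0// mulr_ge0// sqr_ge0.
have FE i : (\int[mm]_z F i z = (2 * n2 mu u ^+ 2 * (area * radial_integral n ghat a b))%:E)%E.
  have step (G : 'rV[R]_n -> \bar R) : (forall x, G x = (2 * u x ^+ 2)%:E *
      (area * radial_integral n ghat a b)%:E)%E ->
      (\int[mu]_x G x = (2 * n2 mu u ^+ 2 * (area * radial_integral n ghat a b))%:E)%E.
    move=> GE; under eq_integral do rewrite GE.
    rewrite ge0_integralZr//.
    - under eq_integral do rewrite EFinM.
      rewrite ge0_integralZl//; first by rewrite -sqr_n2E// -!EFinM.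
      + exact/measurable_EFinP/measurable_funX.
      + by move=> x _; rewrite lee_fin sqr_ge0.
    - by apply/measurable_EFinP; apply: measurable_funM => //; exact: measurable_funX.
    - by move=> x _; rewrite lee_fin mulr_ge0// sqr_ge0.
    - by rewrite lee_fin mulr_ge0 ?sphere_area_ge0// (radial_integral_ge0 dmin_gt0 h2).
  case: i (mF i) (F0 i) => mFi F0i.
  - rewrite fubini_tonelli1//; apply: step => x; rewrite /fubini_F /F/=.
    under eq_integral do rewrite EFinM.
    rewrite ge0_integralZl//.
    + rewrite -(cE x); congr (_ * _)%E; apply: eq_integral => y _.
      by rewrite /c -enormN opprB.
    + apply/measurable_EFinP; exact: (measurableT_comp mcd (measurable_pair1 x)).
    + by move=> y _; rewrite lee_fin.
    + by rewrite lee_fin mulr_ge0// sqr_ge0.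
  - rewrite fubini_tonelli2//; apply: step => x; rewrite /fubini_G /F/=.
    under eq_integral do rewrite EFinM.
    rewrite ge0_integralZl//.
    + by rewrite -(cE x).
    + apply/measurable_EFinP; exact: (measurableT_comp mcd (measurable_pair2 x)).
    + by move=> y _; rewrite lee_fin.
    + by rewrite lee_fin mulr_ge0// sqr_ge0.
apply: (@le_trans _ _ (\int[mm]_z (F true z + F false z))%E).
  apply: ge0_le_integral => //.
  - by move=> z _; rewrite lee_fin sqr_ge0.
  - apply/measurable_EFinP/measurable_funX.
    by apply: (measurable_weighted_diff gamma_kernel) => //; exact: measurable_shell.
  - exact: emeasurable_funD.
  move=> z _; rewrite /F -EFinD lee_fin expr2 (weighted_diffM gamma_kernel).
  rewrite /shell indic_predE -mulrDl /c cut_ghatE; case: ifPn => zab; last by rewrite mul0r mulr0.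
  rewrite mul1r; have [/andP[za zb] [_ g0 _]] := (zab, gamma_kernel).
  apply: ler_pM => //; first by rewrite -expr2 sqr_ge0.
    have := sqr_ge0 (u z.1 + u z.2); rewrite -!expr2; nra.
  by apply: (gamma_le_ghat dmin_gt0 h2); rewrite (le_lt_trans da za) (le_trans zb bd).
rewrite ge0_integralD// !FE -EFinD lee_fin le_eqVlt; apply/orP; left; apply/eqP.
ring.
Qed.

Lemma shell_L2 u a b : L2 u -> dmin <= a -> b <= dmax ->
  weighted_diff gamma (shell a b) u \in Lfun mm 2%:E.
Proof.
move=> u2 da bd; apply/L2P; split.
  by apply: (measurable_weighted_diff gamma_kernel);
    [exact: measurable_shell|exact: L2_measurable u2].
exact: le_lt_trans (shell_energy_le u2 da bd) (ltry _).
Qed.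

Lemma shell_n2_le u a b : L2 u -> dmin <= a -> b <= dmax ->
  n2 mm (weighted_diff gamma (shell a b) u) ^+ 2 <=
  4 * area * radial_integral n ghat a b * n2 mu u ^+ 2.
Proof.
by move=> u2 da bd; rewrite -lee_fin sqr_n2E ?shell_energy_le//; exact: shell_L2.
Qed.

(** Two strips differ by a shell, on which every L^2 function has finite energy. *)
Lemma Vspace_indep Omega d d' v : dmin <= d <= dmax -> dmin <= d' <= dmax ->
  Vspace Omega gamma d v -> Vspace Omega gamma d' v.
Proof.
move=> /andP[d1 d2] /andP[d'1 d'2] /(VspaceP gamma_kernel)[v2 v0 Uv].
apply/(VspaceP gamma_kernel); split=> //.
have [dd'|/ltW d'd] := leP d d'.
  rewrite (_ : weighted_diff _ _ _ = fun z =>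
    weighted_diff gamma (strip d) v z + weighted_diff gamma (shell d d') v z); last first.
    by apply/funext => z; exact: weighted_diff_strip.
  by apply: L2D => //; exact: shell_L2.
rewrite (_ : weighted_diff _ _ _ = fun z =>
    weighted_diff gamma (strip d) v z - weighted_diff gamma (shell d' d) v z); last first.
  by apply/funext => z; rewrite (weighted_diff_strip _ _ _ d'd) addrK.
by apply: L2B => //; exact: shell_L2.
Qed.

Lemma aform_shell Omega d u v a b : dmin <= d <= dmax ->
  Vspace Omega gamma d u -> Vspace Omega gamma d v ->
  dmin <= a -> a <= b -> b <= dmax ->
  aform gamma u v b = aform gamma u v a +
    ip mm (weighted_diff gamma (shell a b) u) (weighted_diff gamma (shell a b) v).
Proof.
move=> dd Vu Vv da ab bd.
have dda : dmin <= a <= dmax by rewrite da (le_trans ab bd).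
have /(VspaceP gamma_kernel)[u2 _ Uu] := Vspace_indep dd dda Vu.
have /(VspaceP gamma_kernel)[v2 _ Uv] := Vspace_indep dd dda Vv.
rewrite !(aform_ip gamma_kernel) /ip -RintegralD//; last 2 first.
- exact: L2_integrable.
- by apply: L2_integrable; exact: shell_L2.
by apply: eq_Rintegral => z _; exact: weighted_diffM_strip.
Qed.

(** The difference is the form on the shell. Cauchy-Schwarz and the shell energy of each argument
    give two square roots of the same constant, which multiply to the constant itself. *)
Lemma aform_diff_le Omega d u v a b : dmin <= d <= dmax ->
  Vspace Omega gamma d u -> Vspace Omega gamma d v ->
  dmin <= a -> a <= b -> b <= dmax ->
  `|aform gamma u v b - aform gamma u v a| <=
    4 * area * radial_integral n ghat a b * (n2 mu u * n2 mu v).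
Proof.
move=> dd Vu Vv da ab bd; rewrite (aform_shell dd Vu Vv da ab bd) addrAC subrr add0r.
have /(VspaceP gamma_kernel)[u2 _ _] := Vu.
have /(VspaceP gamma_kernel)[v2 _ _] := Vv.
apply: le_trans (cauchy_schwarz (shell_L2 u2 da bd) (shell_L2 v2 da bd)) _.
have C0 : 0 <= 4 * area * radial_integral n ghat a b.
  apply: mulr_ge0; last exact: (radial_integral_ge0 dmin_gt0 h2).
  by rewrite mulr_ge0// sphere_area_ge0.
have N0 : 0 <= n2 mu u * n2 mu v by rewrite mulr_ge0 ?n2_ge0.
rewrite -ler_sqr ?nnegrE; [|by rewrite mulr_ge0 ?n2_ge0|exact: mulr_ge0].
rewrite exprMn.
apply: le_trans (ler_pM (sqr_ge0 _) (sqr_ge0 _)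
  (shell_n2_le u2 da bd) (shell_n2_le v2 da bd)) _.
by rewrite le_eqVlt; apply/orP; left; apply/eqP; ring.
Qed.

(** Comparison of energies in both directions, with factor 1 / [alpha_a]; it yields coercivity and,
    later, boundedness of the residual. *)
Lemma aform_le Omega CP d a b v : dmin <= d <= dmax ->
  open Omega -> poincare_constant Omega gamma dmin dmax CP ->
  Vspace Omega gamma d v -> dmin <= a <= dmax -> dmin <= b <= dmax ->
  aform gamma v v b <= (1 + 4 * CP ^+ 2 * C1gamma n ghat dmin dmax) * aform gamma v v a.
Proof.
move=> dd oO [CP0 hP _] Vv /andP[a1 a2] /andP[b1 b2].
have Va : Vspace Omega gamma a v by apply: Vspace_indep dd _ Vv; rewrite a1.
have := hP a v; rewrite a1 a2 => /(_ isT Va).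
have /(VspaceP gamma_kernel)[v2 v0 _] := Vv.
rewrite L2norm_n2 n2_restrict_ae//; last exact: open_measurable_rV.
move=> va; have N0 := n2_ge0 mu v.
have Ea0 : 0 <= aform gamma v v a by rewrite -(sqr_Vnorm gamma_kernel) sqr_ge0.
have C0 : 0 <= C1gamma n ghat dmin dmax.
  rewrite /C1gamma mulr_ge0 ?sphere_area_ge0//.
  exact: (radial_integral_ge0 dmin_gt0 h2).
have va2 : n2 mu v ^+ 2 <= CP ^+ 2 * aform gamma v v a.
  by rewrite -(sqr_Vnorm gamma_kernel) -exprMn lerXn2r ?nnegrE// (le_trans N0 va).
(* For b <= a a shell is dropped and the factor is at least 1. For a <= b the added shell is bounded
   by |v|_2^2, hence by the energy at [a] through the Poincaré inequality. *)
have [ab|/ltW ba] := leP a b; last first.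
  apply: (@le_trans _ _ (aform gamma v v a)); last first.
    rewrite ler_peMl// lerDl; apply: mulr_ge0 => //.
    by rewrite mulr_ge0// sqr_ge0.
  by rewrite (aform_shell dd Vv Vv b1 ba a2) lerDl -sqr_n2 sqr_ge0.
rewrite (aform_shell dd Vv Vv a1 ab b2) mulrDl mul1r lerD2l -sqr_n2.
apply: le_trans (shell_n2_le v2 a1 b2) _.
have rab := radial_integral_le dmin_gt0 h2 a1 b2.
rewrite /C1gamma in C0 *.
apply: (@le_trans _ _ (4 * (area * radial_integral n ghat dmin dmax) * n2 mu v ^+ 2)).
  rewrite ler_wpM2r ?sqr_ge0// -mulrA ler_wpM2l// ler_wpM2l// sphere_area_ge0//.
apply: le_trans (ler_wpM2l _ va2) _; first by rewrite mulr_ge0.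
by rewrite le_eqVlt; apply/orP; left; apply/eqP; ring.
Qed.

End truncation_dependence.

(** * Linear interpolation in the horizon *)

(** If the area were 0, so would be the ball volume, and then the Gaussian integral by polar
    coordinates. *)
Lemma sphere_area_gt0 (R : realType) (n : nat) : (0 < n)%N -> 0 < sphere_area R n.
Proof.
move=> n_gt0; rewrite lt_def sphere_area_ge0// andbT.
apply/eqP => area0.
have V0 : (\int[lebesgue_rV R n]_y (ball_indic y)%:E = 0)%E.
  have := ball_sphere_area R n_gt0; rewrite area0 => /eqP; rewrite mule_eq0.
  by rewrite eqe pnatr_eq0 gtn_eqF//= => /eqP.
have mg : measurable_fun [set: measurableTypeR R] (fun t : R => (expR (- t ^+ 2))%:E).
  apply/measurable_EFinP; apply: measurableT_comp => //; apply: measurable_funN.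
  exact: measurable_funX.
have := @radial_integral_ball R n n_gt0 _ mg (fun t => expR_ge0 _).
rewrite integral_gauss_rV V0 mul0e => -[/eqP].
by rewrite expf_eq0 n_gt0/= sqrtr_eq0 leNgt pi_gt0.
Qed.

(** Origin of the term (n-1)/t2 of [L_a']: with exponent n - 1 it bounds the increment of the polar
    density. *)
Lemma exprnB_le (R : realDomainType) (m : nat) (s t : R) : 0 <= s -> s <= t ->
  t ^+ m.+1 - s ^+ m.+1 <= m.+1%:R * t ^+ m * (t - s).
Proof.
move=> s0 st; have t0 := le_trans s0 st; have ts : 0 <= t - s by rewrite subr_ge0.
elim: m => [|m IH]; first by rewrite !expr1 expr0 !mul1r.
rewrite [leLHS](_ : _ = t * (t ^+ m.+1 - s ^+ m.+1) + s ^+ m.+1 * (t - s)); last first.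
  by rewrite !exprS; ring.
have H1 : t * (t ^+ m.+1 - s ^+ m.+1) <= t * (m.+1%:R * t ^+ m * (t - s)).
  exact: ler_wpM2l.
have H2 : s ^+ m.+1 * (t - s) <= t ^+ m.+1 * (t - s).
  by apply: ler_wpM2r => //; apply: lerXn2r.
apply: le_trans (lerD H1 H2) _; rewrite le_eqVlt; apply/orP; left; apply/eqP.
by rewrite -[m.+2]addn1 natrD exprS; ring.
Qed.

Section correlation.
Context (R : realType) (n : nat) (Omega : set 'rV[R]_n) (oOmega : open Omega).
Notation mu := (lebesgue_rV R n).
Notation L2 f := (f \in Lfun mu 2%:E).
Context (u v : 'rV[R]_n -> R) (u2 : L2 u) (v2 : L2 v).

Definition correlation (h : 'rV[R]_n) : R :=
  ip mu (fun x => u x - u (x + h)) (fun x => v x - v (x + h)).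

Lemma correlation_le h : `|correlation h| <= 4 * (n2 mu u * n2 mu v).
Proof.
have uh := L2_shift h u2; have vh := L2_shift h v2.
apply: le_trans (cauchy_schwarz (L2B u2 uh) (L2B v2 vh)) _.
have := n2B u2 uh; have := n2B v2 vh; rewrite !n2_shift//.
set U := n2 mu (fun x => u x - _); set V := n2 mu (fun x => v x - _).
have U0 : 0 <= U by exact: n2_ge0.
have V0 : 0 <= V by exact: n2_ge0.
move=> HV HU; have := ler_pM U0 V0 HU HV.
by move=> /le_trans; apply; rewrite le_eqVlt; apply/orP; left; apply/eqP; ring.
Qed.

(** Translation invariance moves every shift onto [u]. Hence regularity is asked of [u] alone, and
    [v] enters only through its L^2 norm. *)
Lemma correlationE h :
  correlation h = 2 * ip mu u v - (ip mu (fun x => u (x - h)) v + ip mu (fun x => u (x + h)) v).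
Proof.
have uh := L2_shift h u2; have vh := L2_shift h v2; have umh := L2_shift (- h) u2.
rewrite /correlation ipBl ?ipBr//; last exact: L2B.
have -> : ip mu (fun x => u (x - h)) v = ip mu u (fun x => v (x + h)).
  rewrite -(ip_shift h umh v2); congr ip; apply/funext => x.
  by rewrite addrK.
by rewrite (ip_shift h u2 v2); ring.
Qed.

(** The difference of the two translates is itself the translate by [h'] of u(. + (h - h')) - u,
    which [H10_shift_le] bounds. *)
Lemma shift_ip_le (h h' : 'rV[R]_n) : H10 Omega u ->
  `|ip mu (fun x => u (x + h)) v - ip mu (fun x => u (x + h')) v| <=
    enorm (h - h') * H10norm Omega u * n2 mu v.
Proof.
move=> Hu; have uh := L2_shift h u2; have uh' := L2_shift h' u2.
rewrite -ipBl//; apply: le_trans (cauchy_schwarz (L2B uh uh') v2) _.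
apply: ler_wpM2r; first exact: n2_ge0.
apply: le_trans (H10_shift_le oOmega (h - h') Hu).
have D2 : L2 (fun x => u (x + (h - h')) - u x) by apply: L2B => //; exact: L2_shift.
rewrite -(n2_shift h' D2) (_ : (fun x => _) = (fun x => u (x + h' + (h - h')) - u (x + h')))//.
by apply/funext => x; congr (u _ - _); rewrite -addrA [h' + _]addrC subrK.
Qed.

Lemma correlation_lip (h h' : 'rV[R]_n) : H10 Omega u ->
  `|correlation h - correlation h'| <= 2 * (enorm (h - h') * H10norm Omega u * n2 mu v).
Proof.
move=> Hu; rewrite !correlationE.
rewrite [X in `|X|](_ : _ =
  (ip mu (fun x => u (x - h')) v - ip mu (fun x => u (x - h)) v) +
  (ip mu (fun x => u (x + h')) v - ip mu (fun x => u (x + h)) v)); last by ring.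
apply: le_trans (ler_normD _ _) _; rewrite mulr2n mulrDl mul1r; apply: lerD.
  apply: le_trans (shift_ip_le _ _ Hu) _.
  by rewrite opprK addrC.
apply: le_trans (shift_ip_le _ _ Hu) _.
by rewrite -enormN opprB.
Qed.

End correlation.

Lemma integrable_fubini_G_setT d1 d2 (T1 : measurableType d1) (T2 : measurableType d2)
    (R : realType) (m1 : {sigma_finite_measure set T1 -> \bar R})
    (m2 : {sigma_finite_measure set T2 -> \bar R}) (f : T1 * T2 -> \bar R) :
  ((m1 \x m2)%E.-integrable setT f -> m2.-integrable setT (fubini_G m1 f))%E.
Proof.
move=> fi; have mf := measurable_int _ fi; apply/integrableP; split.
  exact: (measurable_fubini_G fi).
have /integrableP[_] := fi.
rewrite fubini_tonelli2//; last exact: measurableT_comp.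
apply: le_lt_trans; apply: ge0_le_integral => //.
- by apply: measurableT_comp => //; exact: (measurable_fubini_G fi).
- by apply: (measurable_fun_fubini_tonelli_G (abse \o f)) => [|x];
    [exact: measurableT_comp|exact: abse_ge0].
- move=> y _; apply: le_abse_integral => //.
  exact: (measurableT_comp mf (measurable_pair2 y)).
Qed.

Section zero_mean.
Context (R : realType).
Notation leb := (@lebesgue_measure R).

(* The weight of the linear interpolation error of a primitive: it has zero
   mean, so only the oscillation of the integrand matters. *)
Definition interp_weight (a d b t : R) : R :=
  (b - d) / (b - a) * \1_(`]a, d]%classic) t - (d - a) / (b - a) * \1_(`]d, b]%classic) t.

Lemma interp_weightE a d b t : interp_weight a d b t =
  if a < t <= d then (b - d) / (b - a) else
  if d < t <= b then - ((d - a) / (b - a)) else 0.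
Proof.
have E x y : `]x, y]%classic = [set t : R | x < t <= y].
  by apply/seteqP; split => s /=; rewrite in_itv.
rewrite /interp_weight !E !indic_predE; case: ifPn => [/andP[at1 td]|_].
  by rewrite ltNge td/= mulr1 mulr0 subr0.
by case: ifP => _; rewrite mulr0 sub0r ?mulr1// mulr0 oppr0.
Qed.

(** The weight has integral (b-d)(d-a)/(b-a) - (d-a)(b-d)/(b-a) = 0, so [g0] can be subtracted from
    [g]; then |w| <= 1 and the support []a, b]] give the bound. Measurability is asked of the
    product only, because [g] will contain [ghat], which is controlled only between the horizons. *)
Lemma interp_weight_mean_bound (a d b g0 L : R) (g : R -> R) :
  a < b -> a <= d <= b -> 0 <= L ->
  measurable_fun [set: measurableTypeR R] (fun t => interp_weight a d b t * g t) ->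
  (forall t, a < t <= b -> `|g t - g0| <= L) ->
  (`|\int[leb]_t (interp_weight a d b t * g t)%:E| <= (L * (b - a))%:E)%E.
Proof.
move=> ab /andP[ad db] L0 mwg gL.
have ba0 : 0 < b - a by rewrite subr_gt0.
pose w := interp_weight a d b.
have mI x y : measurable (`]x, y]%classic : set (measurableTypeR R)) by exact: measurable_itv.
have mw : measurable_fun [set: measurableTypeR R] w.
  by apply: measurable_funB; apply: measurable_funM => //; exact: measurable_indic.
have indic_int x y : x <= y -> (\int[leb]_t (\1_(`]x, y]%classic) t)%:E = (y - x)%:E)%E.
  move=> xy; rewrite integral_indic//= setIT lebesgue_measure_itv/= lte_fin.
  by case: ltP => [_|yx]; [rewrite EFinB|rewrite (le_anti (introT andP (conj xy yx))) subrr].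
have indic_itg x y : x <= y -> leb.-integrable setT (EFin \o (\1_(`]x, y]%classic) : R -> R)).
  move=> xy; apply/integrableP; split; first exact/measurable_EFinP/measurable_indic.
  rewrite (eq_integral (fun t : measurableTypeR R => (\1_(`]x, y]%classic) t)%:E)) ?indic_int ?ltry// => t _.
  by rewrite /= ger0_norm.
have w_int : leb.-integrable setT (EFin \o w).
  rewrite (_ : EFin \o w = (fun t => ((b - d) / (b - a))%:E * (EFin \o (\1_(`]a, d]%classic) : R -> R)) t)
    \- (fun t => ((d - a) / (b - a))%:E * (EFin \o (\1_(`]d, b]%classic) : R -> R)) t))%E//.
  by apply: integrableB => //; apply: integrableZl => //; exact: indic_itg.
have w0 : (\int[leb]_t (w t)%:E = 0)%E.
  under eq_integral do rewrite EFinB !EFinM.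
  rewrite integralB//; try by apply: integrableZl => //; exact: indic_itg.
  rewrite !integralZl//; try exact: indic_itg.
  by rewrite !indic_int// -!EFinM -EFinB; congr EFin; field; rewrite gt_eqF.
have wab t : w t != 0 -> a < t <= b.
  rewrite /w interp_weightE; case: ifPn => [/andP[-> td] _|_]; first by rewrite (le_trans td db).
  by case: ifPn => [/andP[dt ->] _|_]; [rewrite (le_lt_trans ad dt)|rewrite eqxx].
have w1 t : `|w t| <= 1.
  rewrite /w interp_weightE; case: ifP => _.
    rewrite ger0_norm ?divr_ge0 ?subr_ge0 ?(ltW ab)//.
    by rewrite ler_pdivrMr// mul1r lerD2l lerN2.
  case: ifP => _; last by rewrite normr0.
  rewrite normrN ger0_norm ?divr_ge0 ?subr_ge0 ?(ltW ab)//.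
  by rewrite ler_pdivrMr// mul1r lerD2r.
pose r t := w t * (g t - g0).
have rE t : r t = w t * g t - g0 * w t by rewrite /r; ring.
have mr : measurable_fun [set: measurableTypeR R] r.
  rewrite (_ : r = fun t => w t * g t - g0 * w t); last by apply/funext.
  by apply: measurable_funB => //; exact: measurable_funM.
have r_le t : `|r t| <= L * \1_(`]a, b]%classic) t.
  have [wt0|/wab tab] := eqVneq (w t) 0.
    by rewrite /r wt0 mul0r normr0 mulr_ge0.
  rewrite indicE mem_set/= ?in_itv// mulr1 normrM -[leRHS]mul1r.
  by apply: ler_pM => //; exact: gL.
have r_int : leb.-integrable setT (EFin \o r).
  have Li : leb.-integrable setT
      (fun t : measurableTypeR R => L%:E * (EFin \o (\1_(`]a, b]%classic) : R -> R)) t)%E.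
    by apply: integrableZl => //; apply: indic_itg; exact: ltW.
  apply: (le_integrable _ _ _ Li) => //; first exact/measurable_EFinP.
  by move=> t _; rewrite -EFinM !abse_EFin lee_fin (le_trans (r_le t))// ler_norm.
have -> : (\int[leb]_t (w t * g t)%:E = \int[leb]_t (r t)%:E)%E.
  transitivity (\int[leb]_t ((r t)%:E + g0%:E * (w t)%:E))%E.
    by apply: eq_integral => t _; rewrite -EFinM -EFinD rE subrK.
  rewrite integralD//; last exact: integrableZl.
  by rewrite integralZl// w0 mule0 adde0.
apply: le_trans (le_abse_integral _ _ _) _ => //; first exact/measurable_EFinP.
have mE : measurable_fun [set: measurableTypeR R] (EFin \o (\1_(`]a, b]%classic) : R -> R)).
  exact/measurable_EFinP/measurable_indic.
rewrite EFinM -(indic_int a b (ltW ab)) -ge0_integralZl//.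
apply: ge0_le_integral => //.
- by apply: measurableT_comp => //; exact/measurable_EFinP.
- exact: emeasurable_funM.
- by move=> t _; rewrite abse_EFin -EFinM lee_fin.
Qed.

End zero_mean.

Section interpolation_error.
Context (R : realType) (n : nat) (n_gt0 : (0 < n)%N).
Context (Omega : set 'rV[R]_n) (oOmega : open Omega).
Context (gamma : 'rV[R]_n -> 'rV[R]_n -> R) (gamma_kernel : symmetric_kernel gamma).
Context (dmin dmax : R) (dmin_gt0 : 0 < dmin) (dmin_lt_dmax : dmin < dmax).
Context (ghat : R -> R) (h2 : kernel_H2 dmin dmax gamma ghat).
Context (CP : R) (hP : poincare_constant Omega gamma dmin dmax CP).
Context (Lgamma : R) (gamma_radial : radial_kernel gamma ghat).
Hypothesis ghat_lip : forall s t, dmin <= s <= dmax -> dmin <= t <= dmax ->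
  `|ghat s - ghat t| <= Lgamma * `|s - t|.
Notation mu := (lebesgue_rV R n).
Notation mm := (mu \x mu)%E.
Notation leb := (@lebesgue_measure R).
Notation L2 f := (f \in Lfun mu 2%:E).
Notation area := (sphere_area R n).
Notation La := (L_a' n ghat dmin dmax CP Lgamma).

Let CP0 : 0 < CP. Proof. by have [] := hP. Qed.
Let area0 : 0 < area. Proof. exact: sphere_area_gt0. Qed.

Let Lgamma_ge0 : 0 <= Lgamma.
Proof.
have := @ghat_lip dmax dmin; rewrite !lexx (ltW dmin_lt_dmax) => /(_ isT isT).
move=> /(le_trans (normr_ge0 _)); rewrite pmulr_lge0// normr_gt0 subr_eq0.
by rewrite gt_eqF.
Qed.

(** An upper bound of [ghat] on the horizons, used to show that the supremum [L_a'] is taken over a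
    bounded set. *)
Let gbound := ghat dmin + Lgamma * (dmax - dmin).

Let ghat_le t : dmin <= t <= dmax -> 0 <= ghat t <= gbound.
Proof.
move=> /[dup] tI /andP[dt td]; rewrite (ghat_ge0 h2) ?(lt_le_trans dmin_gt0)//=.
have := @ghat_lip t dmin tI; rewrite lexx (ltW dmin_lt_dmax) => /(_ isT).
have := ler_norm (ghat t - ghat dmin); rewrite (ger0_norm (_ : 0 <= t - dmin)) ?subr_ge0//.
have : Lgamma * (t - dmin) <= Lgamma * (dmax - dmin) by rewrite ler_wpM2l// lerD2r.
by rewrite /gbound; lra.
Qed.

Let La_term (s t : R) := 2 * area * t ^+ n.-1 *
  (2 * CP * (n.-1%:R * t^-1 * ghat s + Lgamma) + ghat t).

(** A supremum bounds its members only if the set has an upper bound; replacing each quantity by its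
    extreme value between [dmin] and [dmax] provides one. *)
Let La_ge s t : dmin <= s -> s < t -> t <= dmax -> La_term s t <= La.
Proof.
move=> ds st td; apply: ub_le_sup; last by exists s, t.
exists (2 * area * dmax ^+ n.-1 *
  (2 * CP * (n.-1%:R * dmin^-1 * gbound + Lgamma) + gbound)).
move=> _ [t1 [t2 [d1 t12 d2 ->]]].
have t20 : 0 < t2 by rewrite (lt_trans dmin_gt0)// (le_lt_trans d1).
have /ghat_le/andP[g10 g1] : dmin <= t1 <= dmax by rewrite d1 (le_trans (ltW t12)).
have /ghat_le/andP[g20 g2] : dmin <= t2 <= dmax by rewrite d2 andbT (le_trans d1 (ltW t12)).
have dmax0 : 0 <= dmax by rewrite ltW// (lt_trans dmin_gt0).
apply: ler_pM.
- by rewrite mulr_ge0 ?exprn_ge0 ?(ltW t20)// mulr_ge0// ltW.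
- apply: addr_ge0 => //; apply: mulr_ge0; first by rewrite mulr_ge0// ltW.
  by apply: addr_ge0 => //; rewrite !mulr_ge0// invr_ge0 ltW.
- apply: ler_wpM2l; first by rewrite mulr_ge0// ltW.
  by apply: lerXn2r; rewrite ?nnegrE// ltW.
- apply: lerD => //; apply: ler_wpM2l; first by rewrite mulr_ge0// ltW.
  rewrite lerD2r; apply: ler_pM => //; first by rewrite mulr_ge0// invr_ge0 ltW.
  by apply: ler_wpM2l => //; rewrite lef_pV2 ?posrE// (le_trans d1 (ltW t12)).
Qed.

Lemma L_a'_ge0 : 0 <= La.
Proof.
apply: le_trans (La_ge (lexx dmin) dmin_lt_dmax (lexx dmax)).
have /ghat_le/andP[g10 _] : dmin <= dmin <= dmax by rewrite lexx ltW.
have /ghat_le/andP[g20 _] : dmin <= dmax <= dmax by rewrite lexx ltW.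
have dmax0 : 0 <= dmax by rewrite ltW// (lt_trans dmin_gt0).
rewrite /La_term; apply: mulr_ge0.
  by apply: mulr_ge0; [rewrite mulr_ge0// ltW|exact: exprn_ge0].
apply: addr_ge0 => //; apply: mulr_ge0; first by rewrite mulr_ge0// ltW.
by apply: addr_ge0 => //; rewrite !mulr_ge0// invr_ge0.
Qed.

Variables (u v : 'rV[R]_n -> R) (u2 : L2 u) (v2 : L2 v).
Hypothesis u0 : {ae mu, forall x, ~ Omega x -> u x = 0}.
Hypothesis Hu : H10 Omega u.

Let M := H10norm Omega u * n2 mu v.

Let M0 : 0 <= M. Proof. by rewrite mulr_ge0 ?n2_ge0// sqrtr_ge0. Qed.

Let n2u : n2 mu u <= CP * H10norm Omega u.
Proof.
have [_ _ H] := hP; have := H u Hu.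
by rewrite L2norm_n2 n2_restrict_ae//; exact: open_measurable_rV.
Qed.

Let W s t := correlation u v (t *: s).

Let W_le s t : `|W s t| <= 4 * CP * M.
Proof.
apply: le_trans (correlation_le u2 v2 _) _.
by rewrite -mulrA ler_wpM2l// /M mulrA ler_wpM2r// n2_ge0.
Qed.

Let W_lip s (t1 t2 : R) : enorm s = 1 -> t1 <= t2 -> `|W s t2 - W s t1| <= 2 * ((t2 - t1) * M).
Proof.
move=> s1 t12; apply: le_trans (correlation_lip oOmega u2 v2 _ _ Hu) _.
rewrite -scalerBl enormZ s1 mulr1 ger0_norm ?subr_ge0//.
by rewrite /M; lra.
Qed.

Let p s t := t ^+ n.-1 * ghat t * W s t.

(** The three increments contribute t2^(n-1) ghat(t2) 2 M from W, t2^(n-1) Lgamma 4 CP M from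
    [ghat], and (n-1) t2^(n-2) ghat(t1) 4 CP M from the power. Their sum is exactly the term of
    [L_a'] at (t1, t2), divided by the area. *)
Let p_lip s t1 t2 : enorm s = 1 -> dmin <= t1 -> t1 < t2 -> t2 <= dmax ->
  `|p s t2 - p s t1| <= (t2 - t1) * (La / area * M).
Proof.
move=> s1 d1 t12 d2.
have t10 : 0 < t1 by rewrite (lt_le_trans dmin_gt0).
have t20 : 0 < t2 by rewrite (lt_trans t10).
have I1 : dmin <= t1 <= dmax by rewrite d1 (le_trans (ltW t12)).
have I2 : dmin <= t2 <= dmax by rewrite d2 andbT (le_trans d1 (ltW t12)).
have /andP[g10 _] := ghat_le I1.
have /andP[g20 _] := ghat_le I2.
have dt : 0 <= t2 - t1 by rewrite subr_ge0 ltW.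
have P1 : 0 <= t1 ^+ n.-1 by rewrite exprn_ge0// ltW.
have P2 : 0 <= t2 ^+ n.-1 by rewrite exprn_ge0// ltW.
have dP0 : 0 <= t2 ^+ n.-1 - t1 ^+ n.-1.
  by rewrite subr_ge0 lerXn2r ?nnegrE// ltW.
have dP : t2 ^+ n.-1 - t1 ^+ n.-1 <= n.-1%:R * t2^-1 * t2 ^+ n.-1 * (t2 - t1).
  case: (n.-1) => [|m]; first by rewrite !expr0 subrr !mul0r.
  apply: le_trans (exprnB_le m (ltW t10) (ltW t12)) _.
  rewrite le_eqVlt; apply/orP; left; apply/eqP; rewrite [in RHS]exprS.
  by field; rewrite gt_eqF.
have dg := ghat_lip I2 I1; rewrite (ger0_norm dt) in dg.
have W1 := W_le s t1; have dW := W_lip s1 (ltW t12).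
have := La_ge d1 t12 d2; rewrite /La_term => HL.
have {}HL : 2 * t2 ^+ n.-1 *
    (2 * CP * (n.-1%:R * t2^-1 * ghat t1 + Lgamma) + ghat t2) <= La / area.
  by rewrite ler_pdivlMr// (le_trans _ HL)// le_eqVlt; apply/orP; left; apply/eqP; ring.
(* The order of telescoping matters: it leaves [ghat] at t2 beside the increment of W and at t1
   beside that of the power, as in [L_a']. *)
have -> : p s t2 - p s t1 = t2 ^+ n.-1 * ghat t2 * (W s t2 - W s t1) +
  (t2 ^+ n.-1 * (ghat t2 - ghat t1) * W s t1 + (t2 ^+ n.-1 - t1 ^+ n.-1) * ghat t1 * W s t1).
  by rewrite /p; ring.
apply: le_trans (ler_normD _ _) _.
have A1 : `|t2 ^+ n.-1 * ghat t2 * (W s t2 - W s t1)| <=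
    t2 ^+ n.-1 * ghat t2 * (2 * ((t2 - t1) * M)).
  by rewrite normrM (ger0_norm (mulr_ge0 P2 g20)) ler_wpM2l// mulr_ge0.
have A2 : `|t2 ^+ n.-1 * (ghat t2 - ghat t1) * W s t1| <=
    t2 ^+ n.-1 * (Lgamma * (t2 - t1)) * (4 * CP * M).
  rewrite !normrM (ger0_norm P2); apply: ler_pM => //; first by rewrite mulr_ge0.
  by rewrite ler_wpM2l.
have A3 : `|(t2 ^+ n.-1 - t1 ^+ n.-1) * ghat t1 * W s t1| <=
    n.-1%:R * t2^-1 * t2 ^+ n.-1 * (t2 - t1) * ghat t1 * (4 * CP * M).
  rewrite !normrM (ger0_norm dP0) (ger0_norm g10); apply: ler_pM => //.
    by rewrite mulr_ge0.
  by rewrite ler_wpM2r.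
apply: le_trans (lerD A1 (le_trans (ler_normD _ _) (lerD A2 A3))) _.
have := ler_wpM2l (mulr_ge0 dt M0) HL => /(le_trans _) H.
rewrite [leRHS](_ : _ = (t2 - t1) * M * (La / area)); last by ring.
by apply: H; rewrite le_eqVlt; apply/orP; left; apply/eqP; ring.
Qed.

Let p_lip_abs s t1 t2 : enorm s = 1 -> dmin <= t1 <= dmax -> dmin <= t2 <= dmax ->
  `|p s t2 - p s t1| <= `|t2 - t1| * (La / area * M).
Proof.
move=> s1 /andP[d1 d1'] /andP[d2 d2']; have [t12|t21|->] := ltgtP t1 t2.
- by rewrite (ger0_norm (_ : 0 <= t2 - t1)) ?subr_ge0 ?(ltW t12)// p_lip.
- rewrite distrC (ler0_norm (_ : t2 - t1 <= 0)) ?subr_le0 ?(ltW t21)//.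
  by rewrite opprB p_lip.
- by rewrite !subrr normr0 mul0r.
Qed.

Variables (a d b : R).
Hypotheses (da : dmin <= a) (ab : a < b) (bd : b <= dmax) (adb : a <= d <= b).

Let w := interp_weight a d b.

Let f (z : 'rV[R]_n * 'rV[R]_n) : R :=
  w (enorm (z.1 - z.2)) * ghat (enorm (z.1 - z.2)) * ((u z.1 - u z.2) * (v z.1 - v z.2)).

(** On the shells the points are distinct, so the radial kernel is [ghat] of their distance; the
    weight then selects the shell and its coefficient. *)
Let fE z : f z =
  (b - d) / (b - a) * (weighted_diff gamma (shell a d) u z * weighted_diff gamma (shell a d) v z) -
  (d - a) / (b - a) * (weighted_diff gamma (shell d b) u z * weighted_diff gamma (shell d b) v z).
Proof.
have a0 := lt_le_trans dmin_gt0 da.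
have /andP[ad db] := adb.
rewrite !(weighted_diffM gamma_kernel) /shell !indic_predE /f /w interp_weightE.
have g t : a < t -> t = enorm (z.1 - z.2) -> gamma z.1 z.2 = ghat (enorm (z.1 - z.2)).
  move=> at0 tE; apply: gamma_radial; rewrite -subr_eq0 -enorm_eq0 -tE gt_eqF//.
  exact: lt_trans a0 at0.
case: ifPn => [/andP[z1 z2]|_].
  by rewrite ltNge z2/= (g _ z1 erefl); ring.
case: ifPn => [/andP[z1 z2]|_]; last by rewrite !mul0r !mulr0 subrr.
by rewrite (g _ (le_lt_trans ad z1) erefl)/=; ring.
Qed.

Let d_in : dmin <= d <= dmax.
Proof. by have /andP[ad dB] := adb; rewrite (le_trans da ad) (le_trans dB bd). Qed.

Let shell_int x y : dmin <= x -> y <= dmax -> mm.-integrable setT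
  (EFin \o (fun z => weighted_diff gamma (shell x y) u z * weighted_diff gamma (shell x y) v z)).
Proof.
by move=> dx yd; apply: L2_integrable;
  [exact: (shell_L2 n_gt0 gamma_kernel dmin_gt0 h2 u2)|
   exact: (shell_L2 n_gt0 gamma_kernel dmin_gt0 h2 v2)].
Qed.

Let f_int : mm.-integrable setT (EFin \o f).
Proof.
have /andP[dd dd'] := d_in.
have /andP[ad db] := adb.
have c1 := @integrableZl _ _ R mm setT measurableT ((b - d) / (b - a)) _ (shell_int da dd').
have c2 := @integrableZl _ _ R mm setT measurableT ((d - a) / (b - a)) _ (shell_int dd bd).
apply: eq_integrable (integrableB measurableT c1 c2) => // z _.
by rewrite /= fE EFinB !EFinM.
Qed.

Let shear (z : 'rV[R]_n * 'rV[R]_n) := (z.1, z.1 + z.2).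

Let mshear : measurable_fun setT shear.
Proof.
apply/measurable_fun_pair; first exact: measurable_fst.
by apply: measurable_rV_add; [exact: measurable_fst|exact: measurable_snd].
Qed.

Let mf : measurable_fun setT (EFin \o f). Proof. exact: measurable_int f_int. Qed.

Let fs_int : mm.-integrable setT ((EFin \o f) \o shear).
Proof.
apply/integrableP; split; first exact: measurableT_comp.
have /integrableP[_] := f_int.
have mabs : measurable_fun setT (abse \o (EFin \o f)) by exact: measurableT_comp.
have := @ge0_integral_pushforward _ _ _ _ R _ mshear mm setT _ measurableT mabs
  (fun z _ => abse_ge0 _).
rewrite preimage_setT => <-.
apply: le_lt_trans; rewrite le_eqVlt; apply/orP; left; apply/eqP.
by apply: eq_measure_integral => A mA _; exact: lebesgue_rV_shear.
Qed.

Let shear_integral : (\int[mm]_z (f z)%:E = \int[mm]_z (f (shear z))%:E)%E.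
Proof.
have := @integral_pushforward _ _ _ _ R _ mshear mm setT _ mf.
rewrite preimage_setT => /(_ fs_int measurableT) /= <-.
apply/esym.
by apply: eq_measure_integral => A mA _; exact: lebesgue_rV_shear.
Qed.

Let F (h : 'rV[R]_n) : \bar R := (w (enorm h) * ghat (enorm h) * correlation u v h)%:E.

(** After the shear the second variable is the increment h. The weight and [ghat] depend on |h|
    alone and leave the integral over x, which is the correlation. *)
Let FE : fubini_G mu ((EFin \o f) \o shear) = F.
Proof.
apply/funext => h; rewrite /fubini_G /F.
have uh := L2_shift h u2; have vh := L2_shift h v2.
transitivity (\int[mu]_x ((w (enorm h) * ghat (enorm h))%:E *
    ((u x - u (x + h)) * (v x - v (x + h)))%:E))%E.
  apply: eq_integral => x _; rewrite /= /f/= -EFinM.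
  by rewrite opprD addrA subrr add0r enormN.
have uv_int := L2_integrable (L2B u2 uh) (L2B v2 vh).
rewrite integralZl//.
rewrite [RHS]EFinM; congr (_ * _)%E.
by rewrite /correlation /ip /Rintegral fineK//; exact: integrable_fin_num.
Qed.

Let F_int : mu.-integrable setT F.
Proof. by rewrite -FE; exact: integrable_fubini_G_setT. Qed.

(** On a ray the integrand is n w p with w of zero mean. One factor b - a is the Lipschitz
    oscillation of p around its value at d, the other the length of the cell. *)
Let ray_bound s : enorm s = 1 ->
  (`|\int[leb]_t ((radial_weight n t)%:E * F (t *: s)%R)| <=
   (n%:R * (La / area * M * (b - a) ^+ 2))%:E)%E.
Proof.
move=> s1; have a0 := lt_le_trans dmin_gt0 da.
have /andP[ad db] := adb.
have La0 := L_a'_ge0.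
have E t : ((radial_weight n t)%:E * F (t *: s) = (w t * (n%:R * p s t))%:E)%E.
  rewrite /F -EFinM enormZ s1 mulr1 radial_weightE; case: ltP => t0.
    by rewrite gtr0_norm// /p /W; congr EFin; ring.
  (* For t <= 0 the weight vanishes because a > 0, in agreement with [radial_weight]. *)
  have ta := le_trans t0 (ltW a0); have td := le_trans ta ad.
  have -> : w t = 0 by rewrite /w interp_weightE !ltNge ta td.
  by rewrite !mul0r.
under eq_integral do rewrite E.
have wp_meas : measurable_fun [set: measurableTypeR R] (fun t => w t * (n%:R * p s t)).
  apply/measurable_EFinP.
  rewrite (_ : _ \o _ = fun t => ((radial_weight n t)%:E * F (t *: s))%E); last first.
    by apply/funext => t; rewrite E.
  apply: emeasurable_funM.
    by apply/measurable_EFinP; exact: measurable_radial_weight.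
  apply: (measurableT_comp (measurable_int _ F_int)).
  exact: measurable_rV_scale.
have -> : n%:R * (La / area * M * (b - a) ^+ 2) =
  n%:R * (La / area * M * (b - a)) * (b - a) by ring.
have LM0 : 0 <= La / area * M by rewrite mulr_ge0// divr_ge0// ltW.
apply: (interp_weight_mean_bound (g0 := n%:R * p s d) ab adb) => //.
  by rewrite mulr_ge0// mulr_ge0// subr_ge0 ltW.
move=> t /andP[ta tb]; rewrite -mulrBr normrM ger0_norm// ler_wpM2l//.
have tI : dmin <= t <= dmax by rewrite (le_trans da (ltW ta)) (le_trans tb bd).
apply: le_trans (p_lip_abs s1 d_in tI) _.
rewrite mulrC ler_wpM2l//.
rewrite ler_norml; apply/andP; split; lra.
Qed.

(** With I1 and I2 the forms on the shells []a, d]] and []d, b]], the interpolation error is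
    (b-d)/(b-a) I1 - (d-a)/(b-a) I2, the integral of [f]. Shearing and polar coordinates reduce it
    to the ray bound. *)
Lemma aform_interpolation_error dd : dmin <= dd <= dmax ->
  Vspace Omega gamma dd u -> Vspace Omega gamma dd v ->
  `|aform gamma u v d - ((b - d) / (b - a) * aform gamma u v a +
     (d - a) / (b - a) * aform gamma u v b)| <= La * (b - a) ^+ 2 * M.
Proof.
move=> ddI Vu Vv; have /andP[ad db] := adb; have /andP[d1 d2] := d_in.
have E1 := aform_shell n_gt0 gamma_kernel dmin_gt0 h2 ddI Vu Vv da ad d2.
have E2 := aform_shell n_gt0 gamma_kernel dmin_gt0 h2 ddI Vu Vv d1 db bd.
have ba0 : b - a != 0 by rewrite subr_eq0 gt_eqF.
set I1 := ip mm _ _ in E1; set I2 := ip mm _ _ in E2.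
have fI : \int[mm]_z f z = (b - d) / (b - a) * I1 - (d - a) / (b - a) * I2.
  rewrite /I1 /I2 /ip -!RintegralZl//; try exact: shell_int.
  have c1 := @integrableZl _ _ R mm setT measurableT ((b - d) / (b - a)) _ (shell_int da d2).
  have c2 := @integrableZl _ _ R mm setT measurableT ((d - a) / (b - a)) _ (shell_int d1 bd).
  rewrite -RintegralB//.
  by apply: eq_Rintegral => z _; exact: fE.
rewrite [X in `|X|](_ : _ = \int[mm]_z f z); last first.
  by rewrite fI E2 E1; field.
rewrite -lee_fin -abse_EFin /Rintegral fineK; last exact: integrable_fin_num f_int.
rewrite shear_integral.
rewrite -(integral21_prod_meas1 fs_int) FE.
have -> : La * (b - a) ^+ 2 * M = area * (La / area * M * (b - a) ^+ 2).
  by field; rewrite gt_eqF.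
exact: polar_integral_bound ray_bound.
Qed.

End interpolation_error.

(** * The affine approximation and the error estimate *)

Section partition.
Context (R : realType) (dmin dmax : R) (K : nat) (d : nat -> R).
Hypothesis d_partition : partition_of dmin dmax K d.

Lemma partition_lt i j : (i < j)%N -> (j <= K)%N -> d i < d j.
Proof.
have [_ _ dS] := d_partition; elim: j => // j IH.
rewrite ltnS leq_eqVlt => /orP[/eqP ->|ij] jK; first exact: dS.
by rewrite (lt_trans (IH ij (ltnW jK)))// dS.
Qed.

Lemma partition_le i j : (i <= j)%N -> (j <= K)%N -> d i <= d j.
Proof. by rewrite leq_eqVlt => /orP[/eqP ->//|ij] jK; exact/ltW/partition_lt. Qed.

Lemma partition_in i : (i <= K)%N -> dmin <= d i <= dmax.
Proof.
by move=> iK; have [<- <- _] := d_partition; rewrite !partition_le.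
Qed.

Lemma partition_cell delta : dmin <= delta <= dmax ->
  delta = d 0%N \/ exists2 k, (k < K)%N & d k < delta <= d k.+1.
Proof.
have [d0 dK dS] := d_partition; rewrite -d0 -dK => /andP[].
rewrite le_eqVlt => /orP[/eqP <- _|d0d]; first by left.
move=> ddK; right.
suff : forall m, (m <= K)%N -> delta <= d m -> exists2 k, (k < K)%N & d k < delta <= d k.+1.
  by apply; first exact: leqnn.
elim=> [_|m IH mK dm]; first by rewrite leNgt d0d.
have [|dlt] := leP delta (d m); first exact/IH/ltnW.
by exists m => //; rewrite dlt.
Qed.

Lemma partition_cell_unique delta j k : (j < K)%N -> (k < K)%N ->
  d j < delta <= d j.+1 -> d k < delta <= d k.+1 -> j = k.
Proof.
move=> jK kK /andP[j1 j2] /andP[k1 k2]; case: (ltngtP j k) => // jk.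
- have := lt_le_trans k1 (le_trans j2 (partition_le jk (ltnW kK))).
  by rewrite ltxx.
- have := lt_le_trans j1 (le_trans k2 (partition_le jk (ltnW jK))).
  by rewrite ltxx.
Qed.

Lemma mesh_ge k : (k < K)%N -> d k.+1 - d k <= mesh K d.
Proof.
by move=> kK; exact: (le_bigmax _ (fun i : 'I_K => d i.+1 - d i) (Ordinal kK)).
Qed.

Lemma mesh_ge0 : 0 <= mesh K d.
Proof. exact: bigmax_ge_id. Qed.

Lemma sum_two_terms (F : nat -> R) k : (k < K)%N ->
  (forall j, (j <= K)%N -> j != k -> j != k.+1 -> F j = 0) ->
  \sum_(j < K.+1) F j = F k + F k.+1.
Proof.
move=> kK F0; have kK1 : (k < K.+1)%N by exact: ltnW.
have kK2 : (k.+1 < K.+1)%N by [].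
rewrite (bigD1 (Ordinal kK1))//= (bigD1 (Ordinal kK2))//=; last first.
  by apply/eqP => -[] /eqP; rewrite (gtn_eqF (ltnSn k)).
rewrite big1 ?addr0// => j /andP[jk jk1]; apply: F0; first by rewrite -ltnS.
- by apply: contraNneq jk => jk; apply/eqP/val_inj.
- by apply: contraNneq jk1 => jk1; apply/eqP/val_inj.
Qed.

End partition.

Section aform_approx_cells.
Context (R : realType) (n : nat) (dmin dmax : R) (K : nat) (d : nat -> R).
Hypothesis d_partition : partition_of dmin dmax K d.
Context (gamma : 'rV[R]_n -> 'rV[R]_n -> R) (ghat : R -> R).

(** Cells are open on the left, so none contains the first node, and only the special clause for k =
    0 acts. *)
Lemma aform_approx_left c u v :
  aform_approx c gamma ghat K d u v (d 0%N) = aform gamma u v (d 0%N).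
Proof.
rewrite /aform_approx big_ord_recl big1 ?addr0 => [|j _].
  by case: c; rewrite /theta_approx /theta_constant /theta_linear /= eqxx /= mul1r.
have d0 i : (i <= K)%N -> (d i < d 0%N) = false.
  by move=> iK; apply/negbTE; rewrite -leNgt (partition_le d_partition).
have jK : (j.+1 <= K)%N by exact: ltn_ord.
rewrite lift0; case: c; rewrite /theta_approx /theta_constant /theta_linear /=
  ?(d0 _ (ltnW jK)) ?(d0 _ jK) /= ?andbF ?mul0r //.
Qed.

Section cell.
Context (delta : R) (k : nat) (kK : (k < K)%N) (dk : d k < delta <= d k.+1).

Let delta_neq : (delta == d 0%N) = false.
Proof.
apply/negbTE; rewrite gt_eqF//; have /andP[+ _] := dk; apply: le_lt_trans.
by apply: (partition_le d_partition) => //; exact: ltnW.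
Qed.

Let cell_eq j : (j < K)%N -> (d j < delta <= d j.+1) = (j == k).
Proof.
move=> jK; apply/idP/eqP => [jd|->//].
exact: (partition_cell_unique d_partition jK kK jd dk).
Qed.

Let right_cond j : (j <= K)%N -> (0 < j)%N && (d j.-1 < delta <= d j) = (j == k.+1).
Proof. by case: j => // j jK /=; rewrite cell_eq. Qed.

Let left_cond j : (j < K)%N && (d j < delta <= d j.+1) = (j == k).
Proof.
have [jK/=|jK/=] := ltnP j K; first exact: cell_eq.
by apply/esym/negbTE; rewrite neq_ltn (leq_trans kK jK) orbT.
Qed.

(** On the cell only k and k+1 can be selected, and their two tests, one strict and one not, are
    complementary: exactly one coefficient is 1. *)
Lemma aform_approx_constant u v : exists2 j, (j = k \/ j = k.+1) &
  aform_approx PiecewiseConstant gamma ghat K d u v delta = aform gamma u v (d j).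
Proof.
have TE j : (j <= K)%N -> theta_constant n ghat K d j delta =
    if ((j == k.+1) && (radial_integral n ghat delta (d j) < radial_integral n ghat (d j.-1) delta))
    || ((j == k) && (radial_integral n ghat (d j) delta <= radial_integral n ghat delta (d j.+1)))
    then 1 else 0.
  move=> jK; rewrite /theta_constant delta_neq andbF/=.
  by rewrite !andbA -!(andbA _ (_ < _) (_ <= _)) right_cond// left_cond.
rewrite /aform_approx (@sum_two_terms _ _
  (fun j => theta_constant n ghat K d j delta * aform gamma u v (d j)) k)//; last first.
  by move=> j jK jk jk1; rewrite TE// (negbTE jk) (negbTE jk1)/= mul0r.
have kS : (k == k.+1) = false by rewrite ltn_eqF.
have Sk : (k.+1 == k) = false by rewrite gtn_eqF.
rewrite !TE ?(ltnW kK)// kS Sk !eqxx/= orbF.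
case: leP => _; first by exists k; [left|rewrite mul1r mul0r addr0].
by exists k.+1; [right|rewrite mul1r mul0r add0r].
Qed.

Lemma aform_approx_linear u v :
  aform_approx PiecewiseLinear gamma ghat K d u v delta =
  (d k.+1 - delta) / (d k.+1 - d k) * aform gamma u v (d k) +
  (delta - d k) / (d k.+1 - d k) * aform gamma u v (d k.+1).
Proof.
have TE j : (j <= K)%N -> theta_linear K d j delta =
    if j == k.+1 then (delta - d j.-1) / (d j - d j.-1) else
    if j == k then (d j.+1 - delta) / (d j.+1 - d j) else 0.
  by move=> jK; rewrite /theta_linear delta_neq andbF right_cond// left_cond.
rewrite /aform_approx (@sum_two_terms _ _
  (fun j => theta_linear K d j delta * aform gamma u v (d j)) k)//; last first.
  by move=> j jK jk jk1; rewrite TE// (negbTE jk) (negbTE jk1)/= mul0r.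
have kS : (k == k.+1) = false by rewrite ltn_eqF.
by rewrite !TE ?(ltnW kK)// kS !eqxx.
Qed.

End cell.
End aform_approx_cells.

Section dual_norm_theory.
Context (R : realType) (n : nat) (V : set ('rV[R]_n -> R)) (N F : ('rV[R]_n -> R) -> R).
Hypotheses (F_dual : in_dual V N F) (N0 : forall v, 0 <= N v)
  (VZ : forall c v, V v -> V (fun x => c * v x))
  (NZ : forall c v, V v -> N (fun x => c * v x) = `|c| * N v).

(** [in_dual] states linearity for c v + w, so F(0) = 0 is obtained first, from -1 v + v. *)
Lemma in_dualZ c v : V v -> F (fun x => c * v x) = c * F v.
Proof.
have [lF _] := F_dual; move=> Vv.
have zE : (fun x => -1 * v x + v x) = (fun x => 0 * v x).
  by apply/funext => x; ring.
have F0 : F (fun x => 0 * v x) = 0 by rewrite -zE lF// mulN1r addNr.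
have := lF c v (fun x => 0 * v x) Vv (VZ 0 Vv); rewrite F0 addr0 => <-.
by congr F; apply/funext => x; rewrite mul0r addr0.
Qed.

Let ub : has_ubound [set `|F v| | v in [set v | V v /\ N v <= 1]].
Proof.
have [_ [C FC]] := F_dual; exists `|C| => _ [v [Vv Nv] <-].
apply: le_trans (FC v Vv) _; apply: le_trans (ler_wpM2r (N0 v) (ler_norm C)) _.
by rewrite -[leRHS]mulr1 ler_wpM2l.
Qed.

(** If N v = 0, where v cannot be normalised, boundedness of F already forces F v = 0. Otherwise v /
    N v is admissible in the supremum. *)
Lemma dual_norm_le v : V v -> `|F v| <= dual_norm V N F * N v.
Proof.
move=> Vv; have [_ [C FC]] := F_dual.
have := N0 v; rewrite le_eqVlt => /orP[/eqP Nv0|Nv0].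
  by have := FC v Vv; rewrite -Nv0 !mulr0.
rewrite -ler_pdivrMr//; apply: (ub_le_sup ub).
exists (fun x => (N v)^-1 * v x); last first.
  by rewrite in_dualZ// normrM ger0_norm ?invr_ge0// mulrC.
split; first exact: VZ.
by rewrite NZ// ger0_norm ?invr_ge0// mulVf// gt_eqF.
Qed.

Lemma dual_norm_ge0 v : V v -> 0 <= dual_norm V N F.
Proof.
move=> Vv; apply: (@le_trans _ _ `|F (fun x => 0 * v x)|) => //.
apply: (ub_le_sup ub); exists (fun x => 0 * v x) => //; split; first exact: VZ.
by rewrite NZ// normr0 mul0r.
Qed.

End dual_norm_theory.

Unset Implicit Arguments.

Theorem proposition7p1 (R : realType) (n : nat) (n_gt0 : (0 < n)%N)
  (Omega : set 'rV[R]_n) (Omega_domain : is_domain Omega)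
  (Omega_bounded : bounded_set Omega)
  (Omega_lipschitz : lipschitz_boundary Omega)
  (dmin dmax : R) (dmin_gt0 : 0 < dmin) (dmin_lt_dmax : dmin < dmax)
  (gamma : 'rV[R]_n -> 'rV[R]_n -> R) (gamma_kernel : symmetric_kernel gamma)
  (ghat : R -> R) (Cgamma : R)
  (h1 : kernel_H1 dmin dmax gamma) (h2 : kernel_H2 dmin dmax gamma ghat)
  (h3 : kernel_H3 n dmin dmax ghat Cgamma)
  (CP : R) (hP : poincare_constant Omega gamma dmin dmax CP)
  (dstar : R) (dstar_in : dmin <= dstar <= dmax)
  (K : nat) (d : nat -> R) (d_partition : partition_of dmin dmax K d)
  (f : ('rV[R]_n -> R) -> R)
  (f_dual : in_dual (Vspace Omega gamma dstar) (Vnorm gamma dstar) f)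
  (u : R -> 'rV[R]_n -> R)
  (u_solves : forall delta', dmin <= delta' <= dmax ->
     nonlocal_solution gamma (Vspace Omega gamma dstar) f delta' (u delta'))
  (N : nat) (deltas : 'I_N -> R)
  (deltas_in : forall i, dmin <= deltas i <= dmax)
  (delta : R) (delta_in : dmin <= delta <= dmax)
  (c : approx_case) (uN : 'rV[R]_n -> R) (Lgamma : R)
  (uN_in : span_in (Vspace Omega gamma dstar) (fun i => u (deltas i)) uN)
  (uN_solves : forall v,
     span_in (Vspace Omega gamma dstar) (fun i => u (deltas i)) v ->
     aform_approx c gamma ghat K d uN v delta = f v)
  (hlinear : c = PiecewiseLinear ->
     [/\ radial_kernel gamma ghat,
         (forall s t, dmin <= s <= dmax -> dmin <= t <= dmax ->
            `|ghat s - ghat t| <= Lgamma * `|s - t|) &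
         (forall delta', dmin <= delta' <= dmax -> H10 Omega (u delta'))]) :
  let V := Vspace Omega gamma dstar in
  let r := fun v => aform_approx c gamma ghat K d uN v delta - f v in
  let alpha := alpha_a n ghat dmin dmax CP in
  Vnorm gamma dstar (uN \- u delta) <=
    dual_norm V (Vnorm gamma dstar) r / alpha +
    CP / alpha *
      match c with
      | PiecewiseConstant => C_a n Cgamma * mesh K d * L2norm Omega uN
      | PiecewiseLinear =>
          L_a' n ghat dmin dmax CP Lgamma * mesh K d ^+ 2 * H10norm Omega uN
      end.
Proof.
cbv zeta; set V := Vspace Omega gamma dstar; set r := (fun v => _ - f v).
set alpha := alpha_a _ _ _ _ _; set Err := match c with
  | PiecewiseConstant => C_a n Cgamma * mesh K d * L2norm Omega uN
  | PiecewiseLinear => L_a' n ghat dmin dmax CP Lgamma * mesh K d ^+ 2 * H10norm Omega uN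
  end.
have oOmega : open Omega by have [] := Omega_domain.
have mOmega := open_measurable_rV oOmega.
have [VuN [coef uN_span]] := uN_in.
have [Vu fu] := u_solves _ delta_in.
have CP0 : 0 < CP by have [] := hP.
have area0 := sphere_area_gt0 R n_gt0.
have area4 : 0 <= 4 * sphere_area R n by rewrite mulr_ge0// ltW.
have mesh0 := mesh_ge0 K d.
set e := uN \- u delta.
have eE : e = (fun x => -1 * u delta x + uN x).
  by apply/funext => x; rewrite /e/= mulN1r addrC.
have Ve : V e by rewrite eE; exact: (Vspace_lin gamma_kernel).
have VL2 v : V v -> v \in Lfun (lebesgue_rV R n) 2%:E.
  by case/(VspaceP gamma_kernel).
have V0 v : V v -> {ae lebesgue_rV R n, forall x, ~ Omega x -> v x = 0}.
  by case/(VspaceP gamma_kernel).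
have L2V v : V v -> L2norm Omega v = n2 (lebesgue_rV R n) v.
  by move=> Vv; rewrite L2norm_n2 n2_restrict_ae//; [exact: VL2|exact: V0].
have Vany dd v : dmin <= dd <= dmax -> V v -> Vspace Omega gamma dd v.
  by move=> ddI; exact: (Vspace_indep n_gt0 gamma_kernel dmin_gt0 h2 dstar_in ddI).
have lin dd cc v1 v2 w : dmin <= dd <= dmax -> V v1 -> V v2 -> V w ->
    aform gamma w (fun x => cc * v1 x + v2 x) dd =
    cc * aform gamma w v1 dd + aform gamma w v2 dd.
  by move=> ddI V1 V2 Vw; apply: (aform_linr gamma_kernel);
    [exact: Vany V1|exact: Vany V2|exact: Vany Vw].
have din := partition_in d_partition.
have VZ cc v : V v -> V (fun x => cc * v x).
  move=> Vv; have -> : (fun x => cc * v x) = (fun x => (cc - 1) * v x + v x).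
    by apply/funext => x; ring.
  exact: (Vspace_lin gamma_kernel).
have NZ cc v : V v -> Vnorm gamma dstar (fun x => cc * v x) = `|cc| * Vnorm gamma dstar v.
  move=> /(VspaceP gamma_kernel)[_ _ Uv]; rewrite !(Vnorm_n2 gamma_kernel) -n2Z//.
  by congr n2; apply/funext => z; rewrite /weighted_diff; ring.
have N_ge0 v : 0 <= Vnorm gamma dstar v by exact: sqrtr_ge0.
(* [A] is the inverse of [alpha]. *)
set A := 1 + 4 * CP ^+ 2 * C1gamma n ghat dmin dmax.
have coer a b v : dmin <= a <= dmax -> dmin <= b <= dmax -> V v ->
    aform gamma v v b <= A * aform gamma v v a.
  by move=> aI bI Vv; exact: (aform_le n_gt0 gamma_kernel dmin_gt0 h2 dstar_in oOmega hP Vv aI bI).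
have A0 : 0 < A.
  rewrite ltr_pwDl// mulr_ge0//; first by rewrite mulr_ge0// sqr_ge0.
  by rewrite /C1gamma mulr_ge0 ?(ltW area0)//; exact: (radial_integral_ge0 dmin_gt0 h2).
(* Needed for the dual norm to be a supremum over a bounded set. Each [aform gamma uN v (d k)] is
   bounded by Cauchy-Schwarz at horizon [d k], and [coer] converts that norm of v to the norm at
   [dstar], at the cost of the square root of [A]. *)
have r_dual : in_dual V (Vnorm gamma dstar) r.
  have [lf [C fC]] := f_dual; split.
    move=> cc v w Vv Vw; rewrite /r lf// /aform_approx.
    have -> : \sum_(k < K.+1) theta_approx c n ghat K d k delta *
        aform gamma uN (fun x => cc * v x + w x) (d k) =
      cc * (\sum_(k < K.+1) theta_approx c n ghat K d k delta * aform gamma uN v (d k)) +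
      \sum_(k < K.+1) theta_approx c n ghat K d k delta * aform gamma uN w (d k).
      rewrite mulr_sumr -big_split/=; apply: eq_bigr => k _.
      by rewrite lin//; [ring|apply: din; rewrite -ltnS].
    by ring.
  exists (\sum_(k < K.+1) `|theta_approx c n ghat K d k delta| *
    (Vnorm gamma (d k) uN * Num.sqrt A) + C) => v Vv.
  apply: le_trans (ler_normB _ _) _; rewrite mulrDl; apply: lerD; last exact: fC.
  apply: le_trans (ler_norm_sum _ _ _) _; rewrite mulr_suml; apply: ler_sum => k _.
  have kI : dmin <= d k <= dmax by apply: din; rewrite -ltnS.
  rewrite normrM -mulrA ler_wpM2l//.
  apply: le_trans (aform_cauchy_schwarz gamma_kernel (Vany _ _ kI VuN) (Vany _ _ kI Vv)) _.
  rewrite -mulrA ler_wpM2l ?sqrtr_ge0// /Vnorm -sqrtrM ?(ltW A0)//.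
  by apply: ler_wsqrtr; exact: coer.
have rD := dual_norm_le r_dual N_ge0 VZ NZ Ve.
have D0 := dual_norm_ge0 r_dual N_ge0 VZ NZ Ve.
set D := dual_norm V (Vnorm gamma dstar) r in rD D0 *.
set Ne := Vnorm gamma dstar e in rD *.
(* Origin of the factor C_P in front of the approximation error. *)
have ne : n2 (lebesgue_rV R n) e <= CP * Ne.
  by have [_ H _] := hP; have := H dstar e dstar_in Ve; rewrite L2V.
have diff s t : dmin <= s <= dmax -> dmin <= t <= dmax ->
    `|aform gamma uN e t - aform gamma uN e s| <=
    C_a n Cgamma * `|t - s| * (n2 (lebesgue_rV R n) uN * n2 (lebesgue_rV R n) e).
  wlog st : s t / s <= t.
    move=> H sI tI; have [st|/ltW ts] := leP s t; first exact: H.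
    by rewrite distrC (distrC t); exact: H.
  move=> /andP[s1 s2] /andP[t1 t2].
  apply: le_trans (aform_diff_le n_gt0 gamma_kernel dmin_gt0 h2 dstar_in VuN Ve s1 st t2) _.
  rewrite ler_wpM2r ?mulr_ge0 ?n2_ge0// ger0_norm ?subr_ge0// /C_a.
  rewrite -[leRHS]mulrA ler_wpM2l//.
  exact: (radial_integral_le_lin dmin_gt0 h2 h3).
have Ca0 : 0 <= C_a n Cgamma.
  have [/ltW Cg0 _] := h3; by rewrite /C_a mulr_ge0.
(* Nonnegativity of [Err] is carried along because the right-hand side must be nonnegative even if
   the error has norm 0. *)
have [err Err0] : `|aform gamma uN e delta - aform_approx c gamma ghat K d uN e delta| <=
    Err * n2 (lebesgue_rV R n) e /\ 0 <= Err.
  have [->|[k kK dk]] := partition_cell d_partition delta_in.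
    rewrite (aform_approx_left d_partition) subrr normr0.
    suff Err0 : 0 <= Err by split=> //; rewrite mulr_ge0// n2_ge0.
    rewrite /Err; move: hlinear; case cE: c => hl.
      by rewrite L2norm_n2 mulr_ge0 ?n2_ge0// mulr_ge0.
    have [gr gl _] := hl erefl.
    rewrite mulr_ge0 ?sqrtr_ge0// mulr_ge0 ?sqr_ge0//.
    exact: (L_a'_ge0 n_gt0 dmin_gt0 dmin_lt_dmax h2 hP gl).
  have /andP[dk1 dk2] := dk.
  have kI := din _ (ltnW kK); have k1I := din _ kK.
  have mk := mesh_ge d kK.
  rewrite /Err; move: hlinear; case cE: c => hl.
    split; last by rewrite L2norm_n2 mulr_ge0 ?n2_ge0// mulr_ge0.
    have [j jk ->] := aform_approx_constant d_partition gamma ghat kK dk uN e.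
    have jI : dmin <= d j <= dmax by case: jk => ->.
    apply: le_trans (diff _ _ jI delta_in) _; rewrite L2V// -(mulrA (_ * mesh K d)).
    rewrite ler_wpM2r ?mulr_ge0 ?n2_ge0// ler_wpM2l//; apply: le_trans mk.
    rewrite ler_norml; case: jk => ->; apply/andP; split; lra.
  have [gr gl uH] := hl erefl.
  (* [uN] agrees almost everywhere with a combination of the solutions, each of which lies in
     H^1_0. *)
  have HuN : H10 Omega uN.
    apply: (H10_ae_eq oOmega (VL2 _ VuN) uN_span); apply: (H10_sum oOmega) => i.
    exact: uH.
  have La0 := L_a'_ge0 n_gt0 dmin_gt0 dmin_lt_dmax h2 hP gl.
  split; last by rewrite mulr_ge0 ?sqrtr_ge0// mulr_ge0 ?sqr_ge0.
  rewrite (aform_approx_linear d_partition gamma ghat kK dk).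
  have /andP[k1 k2] := kI; have /andP[k3 k4] := k1I.
  have dkk : d k < d k.+1 := lt_le_trans dk1 dk2.
  have dI : d k <= delta <= d k.+1 by rewrite (ltW dk1).
  apply: le_trans (aform_interpolation_error n_gt0 oOmega gamma_kernel dmin_gt0
    dmin_lt_dmax h2 hP gr gl (VL2 _ VuN) (VL2 _ Ve) (V0 _ VuN) HuN k1 dkk k4 dI
    dstar_in VuN Ve) _.
  rewrite -(mulrA (_ * mesh K d ^+ 2)).
  rewrite ler_wpM2r ?mulr_ge0 ?n2_ge0 ?sqrtr_ge0// ler_wpM2l//.
  by rewrite lerXn2r ?nnegrE ?subr_ge0 ?(ltW dkk).
(* Since e lies in V, a(u, e; delta) = f(e). Adding and subtracting the approximate form of (uN, e)
   leaves the approximation error and the residual at e. *)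
have aee : aform gamma e e delta =
    (aform gamma uN e delta - aform_approx c gamma ghat K d uN e delta) + r e.
  have -> : aform gamma e e delta = aform gamma e (fun x => -1 * u delta x + uN x) delta.
    by rewrite -eE.
  by rewrite lin// (aformC gamma_kernel e (u delta)) fu// (aformC gamma_kernel e uN) /r; ring.
(* Coercivity at [delta] against the norm at [dstar], with every term on the right linear in [Ne],
   so that one factor [Ne] can be cancelled. *)
have key : Ne ^+ 2 <= A * ((D + CP * Err) * Ne).
  rewrite (sqr_Vnorm gamma_kernel).
  apply: le_trans (coer _ _ _ delta_in dstar_in Ve) _.
  rewrite ler_wpM2l ?(ltW A0)// aee mulrDl addrC; apply: lerD.
    exact: le_trans (ler_norm _) rD.
  apply: le_trans (ler_norm _) _; apply: le_trans err _.
  by rewrite (mulrC CP) -mulrA ler_wpM2l.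
have -> : D / alpha + CP / alpha * Err = A * (D + CP * Err).
  by rewrite /alpha /alpha_a -/A; field; rewrite gt_eqF.
have : 0 <= Ne by exact: N_ge0.
rewrite le_eqVlt => /orP[/eqP <-|Ne0].
  by rewrite mulr_ge0 ?(ltW A0)// addr_ge0// mulr_ge0// ltW.
by rewrite -(ler_pM2r Ne0) -expr2 -mulrA.
Qed.
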